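(* Let $K$ be a regular self-similar set in $\mathbb{R}^{d}$ satisfying the open set condition (OSC). If $K$ is totally disconnected, then $\tilde s_{0}(K)\geq\dim_M K$.
   Context: **Self-similar sets.** Let $N\ge 2$ and let $S_1,\dots,S_N:\mathbb{R}^d\to\mathbb{R}^d$ be contracting similarities with ratios $r_i\in(0,1)$. The self-similar set generated by $\{S_1,\dots,S_N\}$ is the unique nonempty compact set $K$ with $K=\bigcup_i S_iK$. It satisfies OSC if there is a nonempty open set $O$ with $\bigcup_i S_iO\subset O$ and $S_iO\cap S_jO=\emptyset$ for $i\ne j$. $\dim_M$ denotes Minkowski (box) dimension (it exists for such $K$). **Curvature-direction measure $\widetilde C_0$.** For a closed set $X\subset\mathbb{R}^d$ of positive reach (Federer) let $\mathrm{nor}\,X=\{(x,n): x\in\partial X,\ n\in S^{d-1}\cap\mathrm{Nor}(X,x)\}$, $\mathrm{Nor}(X,x)$ being the polar cone of the tangent cone of $X$ at $x$. For $\mathcal H^{d-1}$-a.e. $(x,n)\in\mathrm{nor}\,X$ there are generalized principal curvatures $\kappa_i(x,n)\in(-\infty,\infty]$ and orthonormal principal directions $a_i(x,n)$, $i=1,\dots,d-1$, such that the vectors $\left(\frac{a_i}{\sqrt{1+\kappa_i^2}},\frac{\kappa_ia_i}{\sqrt{1+\kappa_i^2}}\right)$ (equal to $(0,a_i)$ if $\kappa_i=\infty$) form an orthonormal basis of the tangent space of $\mathrm{nor}\,X$ at $(x,n)$. For Borel $\beta\subset\mathbb{R}^d\times S^{d-1}$ put $$\widetilde C_0(X,\beta)=\frac1{\mathcal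 H^{d-1}(S^{d-1})}\int_{\mathrm{nor}\,X}\mathbf 1_\beta(x,n)\prod_{i=1}^{d-1}\frac{\kappa_i(x,n)}{\sqrt{1+\kappa_i(x,n)^2}}\,d\mathcal H^{d-1}(x,n)$$ (a factor is $1$ if $\kappa_i=\infty$). For bounded $F\subset\mathbb{R}^d$ let $F_\varepsilon=\{y:\mathrm{dist}(y,F)\le\varepsilon\}$. A value $\varepsilon>0$ is regular for $F$ if the closure $\widetilde{F_\varepsilon}$ of the complement of $F_\varepsilon$ has positive reach and $\partial F_\varepsilon$ is a Lipschitz manifold. For regular $\varepsilon$ put $\widetilde C_0(F_\varepsilon,\cdot):=(-1)^{d-1}\widetilde C_0(\widetilde{F_\varepsilon},\rho(\cdot))$ with $\rho(x,n)=(x,-n)$, and let $\widetilde C_0^{\mathrm{var}}(F_\varepsilon)$ be the total mass of its total variation measure. A set $K$ is called regular if Lebesgue-almost all $\varepsilon>0$ are regular for $K$. **Scaling exponent.** $\tilde s_0(F):=\inf\{s\ge0:\ \mathrm{ess\,lim}_{\varepsilon\to0}\,\varepsilon^{s}\widetilde C_0^{\mathrm{var}}(F_\varepsilon)=0\}$ (with $\inf\emptyset=\infty$), where the essential limit means the limit after discarding a Lebesgue null set of $\varepsilon$'s. *)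

(* Defs.v *)
From HB Require Import structures.
From mathcomp Require Import all_boot all_order all_algebra.
From mathcomp Require Import all_classical all_reals all_analysis.

Set Implicit Arguments.
Unset Strict Implicit.
Unset Printing Implicit Defensive.

Import Order.TTheory GRing.Theory Num.Theory.
Import numFieldNormedType.Exports.

Local Open Scope classical_set_scope.
Local Open Scope ring_scope.

(* The library norm on row vectors is the sup norm.  It induces the Euclidean
   topology, so [open], [closure], [compact] and [totally_disconnected] are the
   library's, but every metric notion below uses the Euclidean norm [enorm]. *)
Section Euclidean.
Context {R : realType} {n : nat}.
Implicit Types (x y u v : 'rV[R]_n) (A : set 'rV[R]_n).

Definition dot u v : R := \sum_(i < n) u 0 i * v 0 i.
Definition enorm u : R := Num.sqrt (dot u u).
Definition eucl_dist x y : R := enorm (x - y).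

Definition dist_to y A : R := inf [set eucl_dist y x | x in A].

Definition ediam A : \bar R :=
  ereal_sup [set (eucl_dist x y)%:E | x in A & y in A].

Definition boundary A : set 'rV[R]_n := closure A `\` A°.

Definition borel_sets : set (set 'rV[R]_n) := <<s open >>.

Definition orthonormal m (b : 'I_m -> 'rV[R]_n) : Prop :=
  forall i j, dot (b i) (b j) = (i == j)%:R.

Definition linear_span m (b : 'I_m -> 'rV[R]_n) : set 'rV[R]_n :=
  [set \sum_(i < m) c i *: b i | c in [set: 'I_m -> R]].

End Euclidean.

Definition caratheodory_measure {R : realType} {T : pointedType}
    (mu : {outer_measure set T -> \bar R}) :
    {measure set (caratheodory_type mu) -> \bar R} :=
  mu : set (caratheodory_type mu) -> \bar R.

Section HausdorffMeasure.
Context {R : realType} {n : nat}.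
Implicit Types (m : nat) (delta : R) (A U : set 'rV[R]_n).
Local Open Scope ereal_scope.

(* The value +oo imposes the bound [delta] on the diameters of covering sets;
   the empty set is treated apart because 0 ^+ 0 = 1. *)
Definition hausdorff_gauge m delta U : \bar R :=
  if U == set0 then 0
  else if ediam U <= delta%:E then ((fine (ediam U)) ^+ m)%R%:E else +oo.

Definition hausdorff_delta m delta A : \bar R :=
  ereal_inf [set \sum_(k <oo) hausdorff_gauge m delta (F k) |
             F in [set F : (set 'rV[R]_n)^nat | A `<=` \bigcup_k F k]].

(* No normalising constant: below, H^(d-1) only occurs divided by the measure
   of the unit sphere with respect to H^(d-1), where the constant cancels. *)
Definition hausdorff m A : \bar R :=
  ereal_sup [set hausdorff_delta m delta A | delta in [set delta | (0 < delta)%R]].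

Lemma ediam_ge0 U : U !=set0 -> 0 <= ediam U.
Proof.
move=> [x Ux]; apply: le_trans (ereal_sup_ubound _); last first.
  by exists x => //; exists x.
by rewrite lee_fin sqrtr_ge0.
Qed.

Lemma hausdorff_gauge0 m delta : hausdorff_gauge m delta set0 = 0.
Proof. by rewrite /hausdorff_gauge eqxx. Qed.

Lemma hausdorff_gauge_ge0 m delta U : 0 <= hausdorff_gauge m delta U.
Proof.
rewrite /hausdorff_gauge; case: ifPn => // /set0P U0.
case: ifP => // _; rewrite lee_fin exprn_ge0 ?fine_ge0 ?ediam_ge0 //.
Qed.

(* [mu_ext] for the discrete sigma-algebra *)
Let D := g_sigma_algebraType [set: set 'rV[R]_n].

Lemma hausdorff_deltaE m delta :
  hausdorff_delta m delta = mu_ext (hausdorff_gauge m delta : set D -> \bar R).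
Proof.
apply/funext => A; congr (ereal_inf (_ @` _)).
apply/seteqP; split => F /=; last by case.
by move=> AF; split => // k; exact: sub_gen_smallest.
Qed.

Lemma hausdorff_delta_le m delta A : (0 < delta)%R ->
  hausdorff_delta m delta A <= hausdorff m A.
Proof. by move=> d0; apply: ereal_sup_ubound; exists delta. Qed.

Lemma hausdorff_ge0 m A : 0 <= hausdorff m A.
Proof.
apply: le_trans (hausdorff_delta_le m A ltr01).
rewrite hausdorff_deltaE; exact/mu_ext_ge0/hausdorff_gauge_ge0.
Qed.

Lemma hausdorff0 m : hausdorff m set0 = 0.
Proof.
apply/eqP; rewrite eq_le hausdorff_ge0 andbT.
apply: ge_ereal_sup => _ [delta _ <-]; rewrite hausdorff_deltaE.
by rewrite mu_ext0 ?hausdorff_gauge0 //; exact: hausdorff_gauge_ge0.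
Qed.

Lemma le_hausdorff m : {homo hausdorff m : A B / A `<=` B >-> A <= B}.
Proof.
move=> A B AB; apply: ge_ereal_sup => _ [delta d0 <-].
apply: le_trans (hausdorff_delta_le m B d0).
by rewrite hausdorff_deltaE; exact: le_mu_ext.
Qed.

Lemma hausdorff_sigma_subadditive m : sigma_subadditive (hausdorff m).
Proof.
move=> F; apply: ge_ereal_sup => _ [delta d0 <-].
rewrite hausdorff_deltaE.
have := @mu_ext_sigma_subadditive _ D R (hausdorff_gauge m delta)
  (@hausdorff_gauge_ge0 m delta) F.
move=> /le_trans; apply.
apply: lee_nneseries => [k _ _|k _].
  exact/mu_ext_ge0/hausdorff_gauge_ge0.
by rewrite -hausdorff_deltaE hausdorff_delta_le.
Qed.

HB.instance Definition _ m := isOuterMeasure.Build R 'rV[R]_n (hausdorff m)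
  (hausdorff0 m) (hausdorff_ge0 m) (@le_hausdorff m)
  (@hausdorff_sigma_subadditive m).

End HausdorffMeasure.

Section Reach.
Context {R : realType} {n : nat}.
Implicit Types (X : set 'rV[R]_n) (x y u v : 'rV[R]_n).

Definition nearest X y x : Prop :=
  X x /\ forall x', X x' -> eucl_dist y x <= eucl_dist y x'.

Definition positive_reach X : Prop :=
  closed X /\
  exists2 r : R, 0 < r &
    forall y, (exists2 x, X x & eucl_dist y x < r) -> exists! x, nearest X y x.

Definition tangent_cone X x : set 'rV[R]_n :=
  [set u | u = 0 \/
    forall e : R, 0 < e -> exists y, [/\ X y, 0 < eucl_dist y x < e &
      eucl_dist ((enorm (y - x))^-1 *: (y - x)) ((enorm u)^-1 *: u) < e]].

Definition normal_cone X x : set 'rV[R]_n :=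
  [set v | forall u, tangent_cone X x u -> dot u v <= 0].

Definition unit_sphere : set 'rV[R]_n := [set u | enorm u = 1].

(* M is locally bi-Lipschitz homeomorphic to open subsets of R^m. *)
Definition lipschitz_manifold (m : nat) (M : set 'rV[R]_n) : Prop :=
  forall x, M x -> exists (U : set 'rV[R]_n) (V : set 'rV[R]_m)
      (phi : 'rV[R]_m -> 'rV[R]_n) (c C : R),
    [/\ open U /\ U x, open V, phi @` V = M `&` U, 0 < c &
        forall s t, V s -> V t ->
          c * eucl_dist s t <= eucl_dist (phi s) (phi t) <= C * eucl_dist s t].

End Reach.

(* Pairs (x, n) in R^d x R^d are encoded as row_mx x n in R^(d + d), so that
   the Euclidean metric and the Hausdorff measures are those of R^(2d). *)
Section CurvatureDirection.
Context {R : realType} {d : nat}.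
Implicit Types (X F : set 'rV[R]_d) (z : 'rV[R]_(d + d)) (x n : 'rV[R]_d).
Implicit Types (beta : set 'rV[R]_(d + d)).

Definition normal_bundle X : set 'rV[R]_(d + d) :=
  [set z | [/\ boundary X (lsubmx z), unit_sphere (rsubmx z) &
               normal_cone X (lsubmx z) (rsubmx z)]].

(* 1 / sqrt (1 + k^2) and k / sqrt (1 + k^2), with limits 0 and 1 at k = +oo;
   the value at -oo is irrelevant, see [principal_frame]. *)
Definition curv_cos (k : \bar R) : R :=
  if k is r%:E then (Num.sqrt (1 + r ^+ 2))^-1 else 0.
Definition curv_sin (k : \bar R) : R :=
  if k is r%:E then r / Num.sqrt (1 + r ^+ 2) else 1.

Definition frame_vector (k : \bar R) (a : 'rV[R]_d) : 'rV[R]_(d + d) :=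
  row_mx (curv_cos k *: a) (curv_sin k *: a).

(* [kappa] and [a] are generalized principal curvatures and directions of X at
   the point z of its normal bundle. *)
Definition principal_frame X z
    (kappa : 'I_d.-1 -> \bar R) (a : 'I_d.-1 -> 'rV[R]_d) : Prop :=
  let b i := frame_vector (kappa i) (a i) in
  [/\ forall i, kappa i != -oo%E, orthonormal a, orthonormal b &
      tangent_cone (normal_bundle X) z = linear_span b].

(* A frame exists at H^(d-1)-almost every point of the normal bundle of a set
   of positive reach, and the product does not depend on its choice. *)
Definition curvature_product X z : R :=
  xget 0 [set p | exists kappa a, principal_frame X z kappa a /\
                    p = \prod_(i < d.-1) curv_sin (kappa i)].

Definition C0 X beta : \bar R :=
  (((fine (hausdorff d.-1 (@unit_sphere R d)))^-1)%:E *
   \int[caratheodory_measure (@hausdorff R (d + d) d.-1)]_(z in normal_bundle X)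
      (\1_beta z * curvature_product X z)%:E)%E.

Definition parallel_set F (e : R) : set 'rV[R]_d :=
  [set y | dist_to y F <= e].

Definition closed_complement F (e : R) : set 'rV[R]_d :=
  closure (~` parallel_set F e).

Definition regular_value F (e : R) : Prop :=
  positive_reach (closed_complement F e) /\
  lipschitz_manifold d.-1 (boundary (parallel_set F e)).

Definition regular_set F : Prop :=
  {ae @lebesgue_measure R, forall e, 0 < e -> regular_value F e}.

Definition flip z : 'rV[R]_(d + d) := row_mx (lsubmx z) (- rsubmx z).

Definition C0_parallel F (e : R) beta : \bar R :=
  (((-1) ^+ d.-1)%:E * C0 (closed_complement F e) (flip @` beta))%E.

Definition borel_partition (B : (set 'rV[R]_(d + d))^nat) : Prop :=
  [/\ forall i, borel_sets (B i), trivIset setT B &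
      \bigcup_i B i = [set z | unit_sphere (rsubmx z)]].

Definition C0_var F (e : R) : \bar R :=
  ereal_sup [set (\sum_(i <oo) `|C0_parallel F e (B i)|)%E
            | B in borel_partition].

End CurvatureDirection.

Definition ess_lim_right0 {R : realType} (f : R -> \bar R) (l : \bar R) : Prop :=
  exists2 Z : set R, (@lebesgue_measure R).-negligible Z &
    f e @[e --> within (~` Z) (0 : R)^'+] --> l.

Definition scaling_exponent {R : realType} {d : nat} (F : set 'rV[R]_d) : \bar R :=
  ereal_inf [set s%:E | s in [set s : R | 0 <= s /\
    ess_lim_right0 (fun e => (e `^ s)%:E * C0_var F e)%E 0%E]].

Section BoxDimension.
Context {R : realType} {d : nat}.
Implicit Type F : set 'rV[R]_d.

Definition covering_number F (delta : R) : R :=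
  inf [set k%:R | k in [set k : nat | exists c : 'I_k -> 'rV[R]_d,
    F `<=` \bigcup_i [set y | eucl_dist (c i) y <= delta]]].

Definition minkowski_dim F : R :=
  lim (ln (covering_number F delta) / - ln delta @[delta --> (0 : R)^'+]).

End BoxDimension.

Section SelfSimilar.
Context {R : realType} {d N : nat}.
Implicit Type S : 'I_N -> 'rV[R]_d -> 'rV[R]_d.

Definition similarity (r : R) (T : 'rV[R]_d -> 'rV[R]_d) : Prop :=
  forall x y, eucl_dist (T x) (T y) = r * eucl_dist x y.

Definition self_similar_set S (K : set 'rV[R]_d) : Prop :=
  [/\ K !=set0, compact K & K = \bigcup_i (S i @` K)].

Definition open_set_condition S : Prop :=
  exists O : set 'rV[R]_d,
    [/\ O !=set0, open O, \bigcup_i (S i @` O) `<=` O &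
        forall i j, i != j -> (S i @` O) `&` (S j @` O) = set0].

End SelfSimilar.

(* Main.v *)
(* Let X be the closure of the complement of the parallel set of K at distance
   e.  By the open set condition, K is at every scale rho locally a bounded union
   of copies of itself of size about rho, so that total disconnectedness gives:
   a chain in K with steps at most tau has diameter O(tau).  Hence K splits into
   compact clusters of diameter O(e) and mutual distance at least 3 e, and
   their number is at least a covering number of K at scale O(e).

   For a cluster A and a unit vector n, a point a of A that maximises <., n>
   gives a pair (a + e n, - n) of the normal bundle of X.  The set P of these pairs
   projects onto the sphere, so its measure is at least that of the sphere.  At
   almost every point of P all the curvatures of X are - 1 / e: otherwise the
   center x + e n of the pair (x, n) varies to first order, and as the centers lie
   in K, where fine chains are short, the normal rays of P leave a hole nearby.
   The exceptional rays therefore sweep out a porous, hence null, set.  Its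
   slice by some level set of the distance to X is then null in dimension d - 1,
   and the exceptional points are a Lipschitz image of that slice.

   For e <= 1 each cluster thus adds at least 2 ^ (1 - d) to the total variation,
   which dominates the covering number and hence grows at least like
   e ^ (- dim K). *)

Require Import Defs.
From HB Require Import structures.
From mathcomp Require Import all_boot all_order all_algebra.
From mathcomp Require Import all_classical all_reals all_analysis.
From mathcomp Require Import measurable_realfun ring lra zify.

Set Implicit Arguments.
Unset Strict Implicit.
Unset Printing Implicit Defensive.

Import Order.TTheory GRing.Theory Num.Theory.
Import numFieldNormedType.Exports.

Local Open Scope classical_set_scope.
Local Open Scope ring_scope.

(** * Euclidean row vectors *)

(** The integrand [curvature_product] is a choice made pointwise from tangent cones of the normal
    bundle, so neither its measurability nor its variation from point to point is visible in
    advance. The proof isolates the pairs at which the center map has derivative 0: there the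
    tangent cone can be computed by hand and the integrand is one constant. As the other pairs of P
    are null and the Caratheodory measure is complete, the integrand is then measurable on P.

    Nullity is wanted in dimension d - 1 inside R^(2 d), where P has no volume to compare holes
    with. Sweeping the pairs along their normals turns the question into one about volume in R^d,
    where a hole is a ball and disjoint holes add up; slicing leads back to dimension d - 1.

    The total variation is a supremum over partitions whose pieces enter with absolute values, so
    each flipped cluster bundle can be a piece of its own, and nothing elsewhere in the normal
    bundle can cancel its contribution. *)

Section Dot.
Context {R : realType} {n : nat}.
Implicit Types (u v w x y z : 'rV[R]_n) (A : set 'rV[R]_n).

Lemma dotC u v : dot u v = dot v u.
Proof. by apply: eq_bigr => i _; rewrite mulrC. Qed.

Lemma dotDl u v w : dot (u + v) w = dot u w + dot v w.
Proof. by rewrite /dot -big_split; apply: eq_bigr => i _; rewrite mxE mulrDl. Qed.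

Lemma dotZl (a : R) u v : dot (a *: u) v = a * dot u v.
Proof. by rewrite /dot mulr_sumr; apply: eq_bigr => i _; rewrite mxE mulrA. Qed.

Lemma dotNl u v : dot (- u) v = - dot u v.
Proof. by rewrite -scaleN1r dotZl mulN1r. Qed.

Lemma dotBl u v w : dot (u - v) w = dot u w - dot v w.
Proof. by rewrite dotDl dotNl. Qed.

Lemma dotDr u v w : dot u (v + w) = dot u v + dot u w.
Proof. by rewrite dotC dotDl !(dotC u). Qed.

Lemma dotZr (a : R) u v : dot u (a *: v) = a * dot u v.
Proof. by rewrite dotC dotZl dotC. Qed.

Lemma dotNr u v : dot u (- v) = - dot u v.
Proof. by rewrite dotC dotNl dotC. Qed.

Lemma dotBr u v w : dot u (v - w) = dot u v - dot u w.
Proof. by rewrite dotDr dotNr. Qed.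

Definition dotE := (dotDl, dotDr, dotNl, dotNr, dotZl, dotZr).

Lemma dot0l u : dot 0 u = 0.
Proof. by rewrite -(scale0r u) dotZl mul0r. Qed.

Lemma dot0r u : dot u 0 = 0. Proof. by rewrite dotC dot0l. Qed.

Lemma dot_ge0 u : 0 <= dot u u.
Proof. by apply: sumr_ge0 => i _; rewrite -expr2 sqr_ge0. Qed.

Lemma enorm_ge0 u : 0 <= enorm u. Proof. exact: sqrtr_ge0. Qed.

Lemma enorm_sqr u : enorm u ^+ 2 = dot u u.
Proof. by rewrite sqr_sqrtr// dot_ge0. Qed.

Lemma dot_eq0 u : (dot u u == 0) = (u == 0).
Proof.
apply/eqP/eqP => [u0|->]; last exact: dot0l.
apply/rowP => i; rewrite mxE; apply/eqP; rewrite -sqrf_eq0 expr2.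
apply/eqP; apply: (psumr_eq0P _ u0) => // j _.
by rewrite -expr2 sqr_ge0.
Qed.

Lemma enorm0 : enorm (0 : 'rV[R]_n) = 0.
Proof. by rewrite /enorm dot0l sqrtr0. Qed.

Lemma enorm_eq0 u : (enorm u == 0) = (u == 0).
Proof. by rewrite -sqrf_eq0 enorm_sqr dot_eq0. Qed.

Lemma enorm_gt0 u : (0 < enorm u) = (u != 0).
Proof. by rewrite lt0r enorm_eq0 enorm_ge0 andbT. Qed.

Lemma enormZ (a : R) u : enorm (a *: u) = `|a| * enorm u.
Proof.
by rewrite /enorm dotZl dotZr mulrA -expr2 sqrtrM ?sqr_ge0// sqrtr_sqr.
Qed.

Lemma enormN u : enorm (- u) = enorm u.
Proof. by rewrite -scaleN1r enormZ normrN1 mul1r. Qed.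

Lemma cauchy_schwarz u v : dot u v <= enorm u * enorm v.
Proof.
have [->|v0] := eqVneq v 0; first by rewrite dot0r enorm0 mulr0.
have v2 : 0 < dot v v by rewrite lt0r dot_eq0 v0 dot_ge0.
rewrite (le_trans (ler_norm _))// -(ler_pXn2r (_ : 0 < 2)%N) ?nnegrE//; last first.
  by rewrite mulr_ge0 ?enorm_ge0.
rewrite exprMn !enorm_sqr real_normK ?num_real//.
have := dot_ge0 (dot v v *: u - dot u v *: v).
rewrite !dotE (dotC v u).
set a := dot u u; set b := dot u v; set c := dot v v.
rewrite (_ : _ + _ = c * (a * c - b ^+ 2)); last by ring.
by rewrite pmulr_rge0// subr_ge0.
Qed.

Lemma ler_enormD u v : enorm (u + v) <= enorm u + enorm v.
Proof.
rewrite -(ler_pXn2r (_ : 0 < 2)%N) ?nnegrE ?addr_ge0 ?enorm_ge0//.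
rewrite sqrrD !enorm_sqr !dotE (dotC v u).
have := cauchy_schwarz u v; lra.
Qed.

Lemma eucl_distC x y : eucl_dist x y = eucl_dist y x.
Proof. by rewrite /eucl_dist -enormN opprB. Qed.

Lemma eucl_distxx x : eucl_dist x x = 0.
Proof. by rewrite /eucl_dist subrr enorm0. Qed.

Lemma eucl_dist_ge0 x y : 0 <= eucl_dist x y. Proof. exact: enorm_ge0. Qed.

Lemma eucl_dist_eq0 x y : (eucl_dist x y == 0) = (x == y).
Proof. by rewrite enorm_eq0 subr_eq0. Qed.

Lemma eucl_distD y x z : eucl_dist x z <= eucl_dist x y + eucl_dist y z.
Proof. by rewrite /eucl_dist -[x - z](subrKA y) ler_enormD. Qed.

Lemma eucl_dist_sqr x y : eucl_dist x y ^+ 2 = dot (x - y) (x - y).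
Proof. exact: enorm_sqr. Qed.

Lemma le_enorm u (a : R) : 0 <= a -> (enorm u <= a) = (dot u u <= a ^+ 2).
Proof. by move=> a0; rewrite -enorm_sqr ler_pXn2r// nnegrE ?enorm_ge0. Qed.

Lemma ge_enorm u (a : R) : 0 <= a -> (a <= enorm u) = (a ^+ 2 <= dot u u).
Proof. by move=> a0; rewrite -enorm_sqr ler_pXn2r// nnegrE ?enorm_ge0. Qed.

Lemma ler_dist_enorm u v : `|enorm u - enorm v| <= enorm (u - v).
Proof.
have := ler_enormD (u - v) v; have := ler_enormD (v - u) u.
by rewrite !subrK -(enormN (v - u)) opprB ler_norml => ? ?; apply/andP; split; lra.
Qed.

Lemma ler_coord_enorm u i : `|u 0 i| <= enorm u.
Proof.
rewrite -(ler_pXn2r (_ : 0 < 2)%N) ?nnegrE ?enorm_ge0// enorm_sqr.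
rewrite real_normK ?num_real// /dot (bigD1 i)//= expr2 lerDl.
by apply: sumr_ge0 => j _; rewrite -expr2 sqr_ge0.
Qed.

End Dot.

Section Metric.
Context {R : realType} {n : nat}.
Implicit Types (u v w x y z : 'rV[R]_n) (A : set 'rV[R]_n).

Lemma enorm_le_coord u (c : R) : (forall i, `|u 0 i| <= c) -> enorm u <= n%:R * c.
Proof.
case: n u => [|m] u uc.
  by rewrite /enorm /dot big_ord0 sqrtr0 mul0r.
have c0 : 0 <= c by rewrite (le_trans _ (uc ord0)).
rewrite le_enorm ?mulr_ge0//.
apply: (@le_trans _ _ (\sum_(i < m.+1) c ^+ 2)).
  apply: ler_sum => i _; rewrite -expr2 -[_ ^+ 2]real_normK ?num_real//.
  by rewrite ler_pXn2r ?nnegrE.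
rewrite sumr_const card_ord -[X in X <= _]mulr_natl exprMn; apply: ler_wpM2r; rewrite ?sqr_ge0//.
by rewrite -natrX ler_nat expnS leq_pmulr.
Qed.

Lemma norm_le_enorm x : `|x| <= enorm x.
Proof.
rewrite [X in X <= _]mx_normrE; apply: bigmax_le; rewrite ?enorm_ge0// => -[i j] _ /=.
by rewrite ord1 ler_coord_enorm.
Qed.

Lemma ler_coord_norm x i : `|x 0 i| <= `|x|.
Proof.
rewrite [X in _ <= X]mx_normrE.
by apply: (@le_bigmax _ _ _ 0 (fun ij => `|x ij.1 ij.2|) (0, i)).
Qed.

Lemma enorm_le_norm x : enorm x <= n%:R * `|x|.
Proof. by apply: enorm_le_coord => i; exact: ler_coord_norm. Qed.

Lemma nbhs_euclP x A :
  nbhs x A <-> exists2 r : R, 0 < r & forall y, eucl_dist x y < r -> A y.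
Proof.
split.
  move=> /nbhs_ballP[r /= r0 rA]; exists r => // y xy; apply: rA.
  by rewrite -ball_normE/=; apply: le_lt_trans xy; exact: norm_le_enorm.
move=> [r r0 rA]; apply/nbhs_ballP; exists (r / n.+1%:R) => /=.
  by rewrite divr_gt0.
move=> y; rewrite -ball_normE/= => xy; apply: rA.
apply: le_lt_trans (enorm_le_norm _) _.
apply: (@le_lt_trans _ _ (n.+1%:R * `|x - y|)); first by rewrite ler_wpM2r// ler_nat.
by rewrite mulrC -ltr_pdivlMr.
Qed.

Lemma open_euclP A :
  open A <-> forall x, A x -> exists2 r : R, 0 < r & forall y, eucl_dist x y < r -> A y.
Proof.
rewrite openE; split => [oA x Ax|oA x Ax].
  by apply/nbhs_euclP; exact: oA.
by apply/nbhs_euclP; exact: oA.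
Qed.

Lemma closure_euclP A x :
  closure A x <-> forall r : R, 0 < r -> exists2 y, A y & eucl_dist x y < r.
Proof.
split=> [Ax r r0|Ax B /nbhs_euclP[r /Ax[y Ay xy] rB]].
  have /Ax[y [Ay /= xy]] : nbhs x [set y | eucl_dist x y < r].
    by apply/nbhs_euclP; exists r.
  by exists y.
by exists y; split => //; exact: rB.
Qed.

Lemma closed_euclP A :
  closed A <->
  forall x, (forall r : R, 0 < r -> exists2 y, A y & eucl_dist x y < r) -> A x.
Proof.
split=> [cA x Ax|cA x /closure_euclP]; last exact: cA.
by apply: cA; apply/closure_euclP.
Qed.

Lemma interior_euclP A x :
  A° x <-> exists2 r : R, 0 < r & forall y, eucl_dist x y < r -> A y.
Proof. exact: nbhs_euclP. Qed.

Lemma continuous_eucl_dist x : continuous (eucl_dist x).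
Proof.
move=> y; apply/(@cvgrPdist_lt R R^o _ (nbhs y)) => /= e e0; apply/nbhs_euclP; exists e => // z yz /=.
apply: le_lt_trans (ler_dist_enorm _ _) _.
by rewrite (_ : _ - _ = z - y) -/(eucl_dist z y) ?[eucl_dist z y]eucl_distC//; apply/rowP => i; rewrite !mxE; ring.
Qed.

Lemma continuous_dot u : continuous (dot u).
Proof.
move=> y; apply/(@cvgrPdist_lt R R^o _ (nbhs y)) => /= e e0; apply/nbhs_euclP.
exists (e / (1 + enorm u)); first by rewrite divr_gt0// ltr_pwDl ?enorm_ge0.
move=> z /=; rewrite ltr_pdivlMr ?ltr_pwDl ?enorm_ge0// => yz.
have := cauchy_schwarz u (y - z); have := cauchy_schwarz (- u) (y - z).
rewrite enormN -/(eucl_dist y z) dotNl dotBr.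
have := eucl_dist_ge0 y z; have := enorm_ge0 u => *.
by rewrite ltr_norml; apply/andP; split; lra.
Qed.

Lemma compact_closed_bounded (A : set 'rV[R]_n) :
  compact A <-> closed A /\ exists M : R, forall x, A x -> enorm x <= M.
Proof.
split=> [cA|[cA [M AM]]].
  split; first exact: (compact_closed (@norm_hausdorff _ _)).
  have /compact_bounded[M [_ AM]] := cA.
  exists (n%:R * (M + 1)) => x Ax; apply: le_trans (enorm_le_norm _) _.
  by rewrite ler_wpM2l//; apply: AM => //; rewrite ltrDl.
apply: bounded_closed_compact => //.
exists M; split; first exact: num_real.
by move=> N MN x Ax; apply: (le_trans (norm_le_enorm _)); apply: le_trans (AM _ Ax) (ltW MN).
Qed.

(** The filter generated by the sets [F eta] plays the role of a sequence with [eta] tending to 0,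
    and [p] is its cluster point. The compactness arguments on chains go through this form. *)
Lemma compact_cluster A (F : R -> set 'rV[R]_n) : compact A ->
  (forall eta eta', 0 < eta -> eta <= eta' -> F eta `<=` F eta') ->
  (forall eta, 0 < eta -> F eta !=set0) ->
  (forall eta, 0 < eta -> F eta `<=` A) ->
  exists2 p, A p & forall eta r, 0 < eta -> 0 < r ->
    exists2 x, F eta x & eucl_dist p x < r.
Proof.
move=> cA Fle F0 FA.
pose B := filter_from [set eta : R | 0 < eta] F.
have BF : Filter B.
  apply: filter_from_filter; first by exists 1 => /=; rewrite ltr01.
  move=> i j /= i0 j0; exists (Num.min i j); first by rewrite lt_min i0.
  by move=> x Fx; split; apply: Fle Fx; rewrite ?lt_min ?i0 ?j0// ge_min lexx ?orbT.
have PB : ProperFilter B by apply: filter_from_proper.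
have BA : B A by exists 1 => //=; apply: FA.
have [p [Ap pB]] := cA B PB BA.
exists p => // eta r eta0 r0.
have [|x [Fx /= px]] := pB (F eta) [set x | eucl_dist p x < r] (ex_intro2 _ _ eta eta0 (@subset_refl _ _)).
  by apply/nbhs_euclP; exists r.
by exists x.
Qed.

Lemma compact_argmax_dot A u : compact A -> A !=set0 ->
  exists2 a, A a & forall b, A b -> dot u b <= dot u a.
Proof.
move=> cA A0.
have [|a aA aM] := @EVT_max_rV R n (dot u) A A0 cA.
  by apply: continuous_subspaceT => x; exact: continuous_dot.
exists a; first by move: aA; rewrite inE.
by move=> b Ab; apply: aM; rewrite inE.
Qed.

Lemma compact_nearest A y : compact A -> A !=set0 ->
  exists a, nearest A y a.
Proof.
move=> cA A0.
have [|a aA aM] := @EVT_min_rV R n (eucl_dist y) A A0 cA.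
  by apply: continuous_subspaceT => x; exact: continuous_eucl_dist.
exists a; split; first by move: aA; rewrite inE.
by move=> b Ab; apply: aM; rewrite inE.
Qed.

Lemma closed_eucl_ball x (r : R) : closed [set y | eucl_dist x y <= r].
Proof.
apply/closed_euclP => y yr /=; rewrite leNgt; apply/negP => ry.
have [|z /= zr yz] := yr (eucl_dist x y - r); first by rewrite subr_gt0.
have := eucl_distD z x y; rewrite (eucl_distC z y); lra.
Qed.

Lemma compact_closed_ball A x (r : R) : closed A ->
  compact (A `&` [set y | eucl_dist x y <= r]).
Proof.
move=> cA; apply/compact_closed_bounded; split.
  by apply: closedI => //; exact: closed_eucl_ball.
exists (r + enorm x) => y [_ /= xy]; rewrite -[y](subrK x).
apply: le_trans (ler_enormD _ _) _.
by rewrite lerD2r -/(eucl_dist y x) eucl_distC.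
Qed.

Lemma closed_nearest A y : closed A -> A !=set0 -> exists a, nearest A y a.
Proof.
move=> cA [b Ab].
have [|a [[Aa ya] an]] := compact_nearest y (compact_closed_ball (x := y) (r := eucl_dist y b) cA).
  by exists b; split => //=.
exists a; split => // a' Aa'; have [?|?] := leP (eucl_dist y a') (eucl_dist y b).
  exact: an.
by apply: le_trans ya _; exact: ltW.
Qed.

Lemma dist_to_le y A a : A a -> dist_to y A <= eucl_dist y a.
Proof.
move=> Aa; apply: ge_inf; last by exists a.
by exists 0 => _ [x _ <-]; exact: eucl_dist_ge0.
Qed.

Lemma le_dist_to y A (r : R) : A !=set0 ->
  (forall a, A a -> r <= eucl_dist y a) -> r <= dist_to y A.
Proof.
move=> [a Aa] rA; apply: lb_le_inf; first by exists (eucl_dist y a); exists a.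
by move=> _ [x Ax <-]; exact: rA.
Qed.

Lemma dist_to_nearest y A a : nearest A y a -> dist_to y A = eucl_dist y a.
Proof.
move=> [Aa an]; apply/eqP; rewrite eq_le dist_to_le//=.
by apply: le_dist_to => //; exists a.
Qed.

Lemma dist_toD x y A : A !=set0 -> dist_to x A <= eucl_dist x y + dist_to y A.
Proof.
move=> A0; rewrite -lerBlDl; apply: le_dist_to => // a Aa.
rewrite lerBlDl; apply: le_trans (dist_to_le _ Aa) _; exact: eucl_distD.
Qed.

Lemma dist_to_ge0 y A : 0 <= dist_to y A.
Proof.
have [->|/set0P A0] := eqVneq A set0; last first.
  by apply: le_dist_to => // a _; exact: eucl_dist_ge0.
by rewrite /dist_to image_set0 inf0.
Qed.

End Metric.

(** * Hausdorff measures *)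

Section HausdorffBasics.
Context {R : realType} {n : nat}.
Implicit Types (m : nat) (delta : R) (A B E U : set 'rV[R]_n).
Local Open Scope ereal_scope.

Lemma ediam_le U (c : R) :
  (forall x y, U x -> U y -> (eucl_dist x y <= c)%R) -> ediam U <= c%:E.
Proof. by move=> Uc; apply: ge_ereal_sup => _ [x Ux [y Uy <-]]; rewrite lee_fin Uc. Qed.

Lemma le_ediam U x y : U x -> U y -> (eucl_dist x y)%:E <= ediam U.
Proof. by move=> Ux Uy; apply: ereal_sup_ubound; exists x => //; exists y. Qed.


Lemma hausdorff_gauge_le m delta U (c : R) : (0 <= c <= delta)%R ->
  (forall x y, U x -> U y -> (eucl_dist x y <= c)%R) ->
  hausdorff_gauge m delta U <= (c ^+ m)%:E.
Proof.
move=> /andP[c0 cd] Uc; rewrite /hausdorff_gauge; case: ifPn => [_|/set0P U0].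
  by rewrite lee_fin exprn_ge0.
have Ud := ediam_le Uc.
rewrite (le_trans Ud) ?lee_fin//.
apply: lerXn2r; rewrite ?nnegrE// ?fine_ge0 ?ediam_ge0//.
rewrite -lee_fin fineK// ge0_fin_numE ?ediam_ge0//.
exact: le_lt_trans Ud (ltry _).
Qed.

Lemma hausdorff_gauge_ediam m delta U : U !=set0 ->
  hausdorff_gauge m delta U < +oo ->
  [/\ ediam U \is a fin_num, (fine (ediam U) <= delta)%R &
     hausdorff_gauge m delta U = (fine (ediam U) ^+ m)%:E].
Proof.
move=> U0; rewrite /hausdorff_gauge ifF; last by apply/negbTE/set0P.
case: ifPn => // Ud _.
have fU : ediam U \is a fin_num.
  by rewrite ge0_fin_numE ?ediam_ge0//; exact: le_lt_trans Ud (ltry _).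
by rewrite -lee_fin fineK.
Qed.

Lemma fine_ediam_ge U x y : ediam U \is a fin_num -> U x -> U y ->
  (eucl_dist x y <= fine (ediam U))%R.
Proof. by move=> fU Ux Uy; rewrite -lee_fin fineK// le_ediam. Qed.

Let D := g_sigma_algebraType [set: set 'rV[R]_n].

Lemma hausdorff_delta_ge0 m delta A : 0 <= hausdorff_delta m delta A.
Proof. by rewrite hausdorff_deltaE; exact/mu_ext_ge0/hausdorff_gauge_ge0. Qed.

Lemma hausdorff_delta0 m delta : hausdorff_delta m delta (set0 : set 'rV[R]_n) = 0.
Proof.
by rewrite hausdorff_deltaE mu_ext0 ?hausdorff_gauge0//; exact: hausdorff_gauge_ge0.
Qed.

Lemma le_hausdorff_delta m delta :
  {homo @hausdorff_delta R n m delta : A B / A `<=` B >-> A <= B}.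
Proof. by move=> A B AB; rewrite hausdorff_deltaE; exact: le_mu_ext. Qed.

Lemma hausdorff_delta_sigma_subadditive m delta :
  sigma_subadditive (@hausdorff_delta R n m delta).
Proof.
move=> F; rewrite hausdorff_deltaE.
exact: (@mu_ext_sigma_subadditive _ D R (hausdorff_gauge m delta)
  (@hausdorff_gauge_ge0 R n m delta) F).
Qed.

(** Already at a fixed [delta] the set function is an outer measure, so countable subadditivity can
    be used before the supremum over [delta] is taken. *)
HB.instance Definition _ m delta := isOuterMeasure.Build R 'rV[R]_n
  (hausdorff_delta m delta) (hausdorff_delta0 m delta)
  (hausdorff_delta_ge0 m delta) (@le_hausdorff_delta m delta)
  (@hausdorff_delta_sigma_subadditive m delta).

Lemma hausdorff_delta_cover m delta A (F : (set 'rV[R]_n)^nat) :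
  A `<=` \bigcup_k F k ->
  hausdorff_delta m delta A <= \sum_(k <oo) hausdorff_gauge m delta (F k).
Proof. by move=> AF; apply: ereal_inf_lbound; exists F. Qed.

Lemma hausdorff_delta_le_gauge m delta U :
  hausdorff_delta m delta U <= hausdorff_gauge m delta U.
Proof.
apply: (@le_trans _ _ (\sum_(k <oo) hausdorff_gauge m delta (if k is 0%N then U else set0))).
  by apply: hausdorff_delta_cover => x Ux; exists 0%N.
rewrite nneseries_recl//; last by move=> k _; exact: hausdorff_gauge_ge0.
rewrite eseries0 ?adde0// => -[|k]//= _ _; exact: hausdorff_gauge0.
Qed.

Lemma hausdorff_delta_anti m (delta delta' : R) A : (delta <= delta')%R ->
  hausdorff_delta m delta' A <= hausdorff_delta m delta A.
Proof.
move=> dd; apply: le_ereal_inf_tmp => _ [F AF <-].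
apply: le_trans (hausdorff_delta_cover m delta' AF) _.
apply: lee_nneseries => [k _ _|k _]; first exact: hausdorff_gauge_ge0.
rewrite /hausdorff_gauge; case: ifPn => // _.
have [Fd|_] := boolP (ediam (F k) <= delta%:E); last exact: leey.
by rewrite (le_trans Fd) ?lee_fin.
Qed.

Lemma hausdorff_le_near m A (c : \bar R) :
  (forall delta : R, (0 < delta)%R ->
     exists2 delta', (0 < delta' <= delta)%R & hausdorff_delta m delta' A <= c) ->
  hausdorff m A <= c.
Proof.
move=> Ac; apply: ge_ereal_sup => _ [delta d0 <-].
have [delta' /andP[d'0 d'd] Ad'] := Ac _ d0.
exact: le_trans (hausdorff_delta_anti m A d'd) Ad'.
Qed.

(** With exponent 0 a nonempty covering set costs at least 1. This is the base case of the induction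
    on dimension in [hausdorff_gt0_coords]. *)
Lemma hausdorff_gt0 A : A !=set0 -> 0 < hausdorff 0 A.
Proof.
move=> [a Aa]; apply: (@lt_le_trans _ _ 1) => //.
apply: le_trans (hausdorff_delta_le 0 A ltr01).
apply: le_ereal_inf_tmp => _ [F AF <-].
have [k _ Fa] := AF a Aa.
rewrite (@nneseriesD1 _ _ k)//; last by move=> j _; exact: hausdorff_gauge_ge0.
apply: (@le_trans _ _ (hausdorff_gauge 0 1 (F k))); last first.
  by rewrite leeDl//; apply: nneseries_ge0 => j _ _; exact: hausdorff_gauge_ge0.
rewrite /hausdorff_gauge; case: ifPn => [/eqP F0|_]; first by move: Fa; rewrite F0.
by case: ifPn; rewrite ?expr0 ?leey.
Qed.

End HausdorffBasics.

(** * Lipschitz images and upper bounds *)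

Section HausdorffLipschitz.
Context {R : realType}.
Local Open Scope ereal_scope.

Lemma hausdorff_lipschitz n p m (f : 'rV[R]_n -> 'rV[R]_p) (L : R) E : (0 < L)%R ->
  (forall x y, E x -> E y -> (eucl_dist (f x) (f y) <= L * eucl_dist x y)%R) ->
  hausdorff m (f @` E) <= (L ^+ m)%:E * hausdorff m E.
Proof.
move=> L0 fL; apply: ge_ereal_sup => _ [delta /= d0 <-].
have dL : (0 < delta / L)%R by rewrite divr_gt0.
apply: (@le_trans _ _ ((L ^+ m)%:E * hausdorff_delta m (delta / L) E)); last first.
  by rewrite lee_pmul2l ?fin_numE//= ?lte_fin ?exprn_gt0// hausdorff_delta_le.
rewrite -lee_pdivrMl ?exprn_gt0//.
apply: le_ereal_inf_tmp => _ [F EF <-].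
rewrite lee_pdivrMl ?exprn_gt0// -nneseriesZl; last by move=> k _; exact: hausdorff_gauge_ge0.
(* The covering sets are cut down to [E], where alone [f] is known to be Lipschitz. *)
apply: le_trans (@hausdorff_delta_cover _ _ _ _ _ (fun k => f @` (F k `&` E)) _) _.
  by move=> _ [x Ex <-]; have [k _ Fx] := EF x Ex; exists k => //; exists x.
apply: lee_nneseries => [k _ _|k _]; first exact: hausdorff_gauge_ge0.
have [FE0|/set0P[x [Fx Ex]]] := eqVneq (F k `&` E) set0.
  rewrite FE0 image_set0 hausdorff_gauge0 mule_ge0 ?hausdorff_gauge_ge0//.
  by rewrite lee_fin exprn_ge0// ltW.
have [|goo] := ltP (hausdorff_gauge m (delta / L) (F k)) +oo; last first.
  rewrite (_ : hausdorff_gauge m (delta / L) (F k) = +oo); last first.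
    by apply/eqP; rewrite -leye_eq.
  by rewrite gt0_muley ?leey// lte_fin exprn_gt0.
move=> /hausdorff_gauge_ediam[|fF Fd ->]; first by exists x.
rewrite -EFinM -exprMn; apply: hausdorff_gauge_le.
  rewrite mulrC -ler_pdivlMr// Fd andbT mulr_ge0 ?(ltW L0)//.
  by rewrite fine_ge0 ?ediam_ge0//; exists x.
move=> _ _ [u [Fu Eu] <-] [v [Fv Ev] <-]; apply: le_trans (fL _ _ Eu Ev) _.
by rewrite ler_pM2l// fine_ediam_ge.
Qed.

(** The fibres of [f] are the covering sets: at most [C * k ^ m] of them, each of diameter at most
    [c / k], so that the total cost does not depend on [k]. *)
Lemma hausdorff_finite_pieces n m (E : set 'rV[R]_n) (C c : R) : (0 <= c)%R ->
  (forall k : nat, (0 < k)%N -> exists (I : finType) (f : 'rV[R]_n -> I),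
     ((#|I|%:R <= C * k%:R ^+ m)%R) /\
     forall x y, E x -> E y -> f x = f y -> (eucl_dist x y <= c / k%:R)%R) ->
  hausdorff m E <= (C * c ^+ m)%:E.
Proof.
move=> c0 Ef; apply: hausdorff_le_near => delta d0.
pose k := (Num.truncn (c / delta)).+1.
have k0 : (0 < k%:R :> R)%R by rewrite ltr0n.
have ck : (c / k%:R <= delta)%R.
  rewrite ler_pdivrMr// mulrC -ler_pdivrMr// ltW//.
  by rewrite /k; exact: truncnS_gt.
exists delta; first by rewrite d0 lexx.
have [|I [f [Ik fE]]] := Ef k; first by [].
pose F (i : nat) := if insub i is Some j then E `&` [set x | f x = enum_val (j : 'I_#|I|)] else set0.
have EF : E `<=` \big[setU/set0]_(i < #|I|) F i.
  move=> x Ex; rewrite -bigcup_mkord; exists (enum_rank (f x)); first by rewrite /= ltn_ord.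
  by rewrite /F valK; split => //=; rewrite enum_rankK.
apply: le_trans (le_hausdorff_delta m delta EF) _.
apply: le_trans (outer_measure_subadditive _ _ _) _.
apply: (@le_trans _ _ (\sum_(i < #|I|) ((c / k%:R) ^+ m)%:E)).
  apply: lee_sum => i _; apply: le_trans (hausdorff_delta_le_gauge _ _ _) _.
  apply: hausdorff_gauge_le; first by rewrite ck divr_ge0.
  by rewrite /F valK => x y [Ex fx] [Ey fy]; apply: fE => //; rewrite fx fy.
rewrite sumEFin lee_fin sumr_const card_ord -[X in (X <= _)%R]mulr_natl expr_div_n.
by rewrite mulrA ler_pdivrMr ?exprn_gt0// mulrAC ler_wpM2r// exprn_ge0.
Qed.

End HausdorffLipschitz.

(** Meant for layers around a set: neighbouring layers may touch, but layers two indices apart have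
    a gap, so sums over indices of one parity are bounded by the measure of the whole. *)
Lemma nneseries_even_odd_le (R : realType) (a : (\bar R)^nat) (C : \bar R) :
  (forall k, 0 <= a k)%E ->
  (forall p k, \sum_(i < k) a (i.*2 + p)%N <= C)%E ->
  (\sum_(k <oo) a k <= C + C)%E.
Proof.
move=> a0 aC; apply: lime_le; first exact: is_cvg_nneseries.
apply: nearW => k; rewrite big_mkord.
apply: (@le_trans _ _ (\sum_(i < k.*2) a i)%E).
  rewrite -!(big_mkord xpredT a).
  by apply: lee_sum_nneg_natr => [i _ _|] //; rewrite -addnn leq_addr.
have -> : (\sum_(i < k.*2) a i =
    \sum_(i < k) a (i.*2 + 0)%N + \sum_(i < k) a (i.*2 + 1)%N)%E.
  elim: k => [|k IH]; first by rewrite !big_ord0 adde0.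
  rewrite doubleS !big_ord_recr/= IH addn0 addn1 -!addeA; congr (_ + _)%E.
  by rewrite addeCA.
by apply: leeD; exact: aC.
Qed.

(** * Additivity on separated sets and measurability of closed sets *)

Section MetricOuterMeasure.
Context {R : realType} {n : nat}.
Implicit Types (m : nat) (delta : R) (A B C E U X : set 'rV[R]_n).
Local Open Scope ereal_scope.

(** A covering set of diameter at most [delta < s] cannot meet both [A] and [B], so every cover
    splits into a cover of [A] and one of [B]. *)
Lemma hausdorff_delta_separated m delta (s : R) A B : (delta < s)%R ->
  (forall a b, A a -> B b -> (s <= eucl_dist a b)%R) ->
  hausdorff_delta m delta A + hausdorff_delta m delta B <=
  hausdorff_delta m delta (A `|` B).
Proof.
move=> ds AB; apply: le_ereal_inf_tmp => _ [F ABF <-].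
have cover V : V `<=` A `|` B -> hausdorff_delta m delta V <=
    \sum_(k <oo) hausdorff_gauge m delta (F k `&` V).
  move=> VAB; apply: hausdorff_delta_cover => x Vx.
  by have [k _ Fx] := ABF _ (VAB _ Vx); exists k.
apply: le_trans (leeD (cover A _) (cover B _)) _ => //.
rewrite -nneseriesD; try by move=> *; exact: hausdorff_gauge_ge0.
apply: lee_nneseries => [k _ _|k _]; first by rewrite adde_ge0 ?hausdorff_gauge_ge0.
have gI V : hausdorff_gauge m delta (F k `&` V) <= hausdorff_gauge m delta (F k).
  have [->|/set0P[x [Fx Vx]]] := eqVneq (F k `&` V) set0.
    by rewrite hausdorff_gauge0 hausdorff_gauge_ge0.
  have [|goo] := ltP (hausdorff_gauge m delta (F k)) +oo; last first.
    by apply: le_trans goo; exact: leey.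
  move=> /hausdorff_gauge_ediam[|fF Fd ->]; first by exists x.
  apply: hausdorff_gauge_le.
    by rewrite Fd andbT fine_ge0 ?ediam_ge0//; exists x.
  by move=> u v [Fu _] [Fv _]; exact: fine_ediam_ge.
have [FA0|/set0P[x [Fx Ax]]] := eqVneq (F k `&` A) set0.
  by rewrite FA0 hausdorff_gauge0 add0e.
have [FB0|/set0P[y [Fy By]]] := eqVneq (F k `&` B) set0.
  by rewrite FB0 hausdorff_gauge0 adde0.
have [|goo] := ltP (hausdorff_gauge m delta (F k)) +oo; last first.
  by apply: le_trans goo; exact: leey.
move=> /hausdorff_gauge_ediam[|fF Fd _]; first by exists x.
have := AB _ _ Ax By; have := fine_ediam_ge fF Fx Fy => h1 h2.
by have := lt_le_trans ds (le_trans h2 (le_trans h1 Fd)); rewrite ltxx.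
Qed.

Lemma hausdorff_separated m (s : R) A B : (0 < s)%R ->
  (forall a b, A a -> B b -> (s <= eucl_dist a b)%R) ->
  hausdorff m A + hausdorff m B <= hausdorff m (A `|` B).
Proof.
move=> s0 AB; have [|] := ltP (hausdorff m (A `|` B)) +oo; last first.
  by move=> oo; apply: le_trans oo; exact: leey.
move=> ABoo.
have fB : hausdorff m B \is a fin_num.
  rewrite ge0_fin_numE ?hausdorff_ge0//; apply: le_lt_trans ABoo.
  by apply: le_hausdorff => x; right.
rewrite -leeBrDr//; apply: ge_ereal_sup => _ [d1 /= d10 <-].
have fA : hausdorff_delta m d1 A \is a fin_num.
  rewrite ge0_fin_numE ?hausdorff_delta_ge0//; apply: le_lt_trans ABoo.
  apply: le_trans (hausdorff_delta_le m A d10) _.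
  by apply: le_hausdorff => x; left.
rewrite leeBrDr// addeC -leeBrDr//.
apply: ge_ereal_sup => _ [d2 /= d20 <-].
rewrite leeBrDr// addeC.
pose d := Num.min (Num.min d1 d2) (s / 2)%R.
have d0 : (0 < d)%R by rewrite !lt_min d10 d20 divr_gt0.
have ds : (d < s)%R by rewrite /d gt_min; apply/orP; right; lra.
apply: le_trans (hausdorff_delta_le m _ d0).
apply: le_trans (hausdorff_delta_separated m ds AB).
by apply: leeD; apply: hausdorff_delta_anti; rewrite !ge_min lexx ?orbT.
Qed.

(** The gap [s] may depend on [i]: each set is split off from the union of the later ones only. *)
Lemma hausdorff_separated_sum m (E : (set 'rV[R]_n)^nat) k :
  (forall i, exists2 s : R, (0 < s)%R & forall j, (i < j)%N ->
     forall a b, E i a -> E j b -> (s <= eucl_dist a b)%R) ->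
  \sum_(i < k) hausdorff m (E i) <= hausdorff m (\bigcup_i E i).
Proof.
elim: k E => [|k IH] E Es; first by rewrite big_ord0 hausdorff_ge0.
rewrite big_ord_recl.
have [s s0 sE] := Es 0%N.
apply: le_trans (leeD (lexx _) (IH (fun i => E i.+1) _)) _.
  move=> i; have [t t0 tE] := Es i.+1; exists t => // j ij.
  exact: tE.
apply: le_trans (hausdorff_separated m s0 _) _.
  by move=> a b E0a [i _ Eb]; exact: (sE i.+1).
by apply: le_hausdorff => x [|[i _]] Ex; [exists 0%N|exists i.+1].
Qed.

(* Caratheodory's criterion for metric outer measures. *)
Lemma hausdorff_closed_measurable m C : closed C ->
  (@hausdorff R n m).-caratheodory C.
Proof.
move=> cC; apply: le_caratheodory_measurable => X.
have [->|/set0P C0] := eqVneq C set0.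
  by rewrite setI0 outer_measure0 add0e setC0 setIT.
have [|oo] := ltP (hausdorff m X) +oo; last by apply: le_trans oo; exact: leey.
move=> Xoo.
pose g x := dist_to x C.
pose a (k : nat) : R := (k.+1%:R^-1)%R.
have a0 k : (0 < a k)%R by rewrite invr_gt0.
have aS k l : (k < l)%N -> (a l < a k)%R by rewrite ltf_pV2 ?posrE// ltr_nat ltnS.
have aW k l : (k <= l)%N -> (a l <= a k)%R by rewrite lef_pV2 ?posrE// ler_nat ltnS.
(* [T k] keeps the distance [a k] from [C], so its measure and that of [X] inside [C] add up. What
   [T k] misses of [X] outside [C] lies in the layers [D i] with [k <= i], whose measures are
   summable. *)
pose T k := X `&` [set x | (a k <= g x)%R].
pose D k := X `&` [set x | (a k.+1 <= g x < a k)%R].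
have gD x y : (g x <= eucl_dist x y + g y)%R by exact: dist_toD.
have D2 p k : \sum_(i < k) hausdorff m (D (i.*2 + p)%N) <= hausdorff m X.
  apply: (@le_trans _ _ (hausdorff m (\bigcup_i D (i.*2 + p)%N))); last first.
    by apply: le_hausdorff => x [i _ []].
  apply: (@hausdorff_separated_sum m (fun i => D (i.*2 + p)%N)) => i.
  exists (a (i.*2 + p).+1 - a (i.*2 + p).+2)%R; first by rewrite subr_gt0 aS.
  move=> j ij x y [_ /= /andP[gx _]] [_ /= /andP[_ gy]].
  have := aW (i.*2 + p).+2 (j.*2 + p)%N; rewrite -addSn -addSn leq_add2r => /(_ _) => h.
  have {}h := h (_ : i.*2.+2 <= j.*2)%N; rewrite -doubleS leq_double in h.
  have := h ij; have := gD x y; rewrite addSn addSn; lra.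
have Dsum : \sum_(k <oo) hausdorff m (D k) < +oo.
  apply: (@le_lt_trans _ _ (hausdorff m X + hausdorff m X)); last by rewrite lte_add_pinfty.
  by apply: nneseries_even_odd_le => [k|p k]; [exact: hausdorff_ge0|exact: D2].
have step k : hausdorff m (X `&` C) + hausdorff m (X `&` ~` C) <=
    hausdorff m X + \sum_(k <= i <oo) hausdorff m (D i).
  have XC : X `&` ~` C `<=` T k `|` \bigcup_(i in ~` `I_k) D i.
    move=> x [Xx Cx]; have [gk|gk] := leP (a k) (g x); first by left.
    right; have gx0 : (0 < g x)%R.
      rewrite lt0r dist_to_ge0 andbT; apply/eqP => gx0; apply: Cx.
      have [c xc] := closed_nearest x cC C0.
      move: gx0; rewrite /g (dist_to_nearest xc) => /eqP; rewrite eucl_dist_eq0 => /eqP ->.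
      by case: xc.
    have ex : exists l, (a l <= g x)%R.
      exists (Num.truncn (g x)^-1); rewrite /a invf_ple ?posrE// ltW//.
      exact: truncnS_gt.
    have [l gl lmin] := ex_minnP ex.
    case: l gl lmin => [|l] gl lmin.
      by have := lt_le_trans gk (aW 0%N k (leq0n _)); rewrite ltNge gl.
    have gl' : (g x < a l)%R.
      by rewrite ltNge; apply/negP => /lmin; rewrite ltnn.
    exists l => /=; last by split => //=; rewrite gl gl'.
    by move=> lk; have := aW l.+1 k lk => h; move: gk; rewrite ltNge => /negP; apply; exact: le_trans h gl.
  apply: (@le_trans _ _ (hausdorff m (X `&` C) + (hausdorff m (T k) + \sum_(k <= i <oo) hausdorff m (D i)))).
    rewrite leeD2l//; apply: le_trans (le_hausdorff m XC) _.
    apply: le_trans (outer_measureU2 _ _ _) _.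
    by rewrite leeD2l//; exact: outer_measure_sigma_subadditive_tail.
  rewrite addeA leeD2r//.
  apply: le_trans (hausdorff_separated m (a0 k) _) _.
    move=> x y [_ Cx] [_ /= gy]; apply: le_trans gy _; rewrite eucl_distC.
    exact: dist_to_le.
  by apply: le_hausdorff => x [[]|[]].
have cv := nneseries_tail_cvg (P := xpredT) Dsum (fun k _ => hausdorff_ge0 m (D k)).
have cvX : hausdorff m X + \sum_(k <= i <oo) hausdorff m (D i) @[k --> \oo] --> hausdorff m X.
  rewrite -[X in _ --> X]adde0; apply: cvgeD => //; last exact: cvg_cst.
  by rewrite fin_num_adde_defl.
apply: (le_trans _ (_ : limn (fun k => hausdorff m X + \sum_(k <= i <oo) hausdorff m (D i)) <= hausdorff m X)); last by rewrite (cvg_lim _ cvX).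
apply: lime_ge; first by apply/cvg_ex; eexists; exact: cvX.
by apply: nearW => k; exact: step.
Qed.

End MetricOuterMeasure.

(** * Slices of null sets *)

Section Slicing.
Context {R : realType} {n : nat}.
Local Open Scope ereal_scope.

(* Eilenberg's inequality for null sets: the covers that witness the nullity of
   [E] have summable slice costs, by Tonelli, so some slice is null. *)
Lemma hausdorff_null_slice m (E : set 'rV[R]_n) (tau : 'rV[R]_n -> R) (a b : R) :
  (forall x y, E x -> E y -> (`|tau x - tau y| <= eucl_dist x y)%R) ->
  hausdorff m.+1 E = 0 -> (a < b)%R ->
  exists2 t, (a < t < b)%R & hausdorff m (E `&` [set x | tau x = t]) = 0.
Proof.
move=> tauL HE ab.
have [F FP] : {F : nat -> (set 'rV[R]_n)^nat & forall j,
    E `<=` \bigcup_k F j k /\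
    \sum_(k <oo) hausdorff_gauge m.+1 (j.+1%:R^-1) (F j k) <= (1 / (2 ^ j.+1)%:R)%:E}.
  apply: (@choice _ _ (fun j (G : (set 'rV[R]_n)^nat) => E `<=` \bigcup_k G k /\
    \sum_(k <oo) hausdorff_gauge m.+1 (j.+1%:R^-1) (G k) <= (1 / (2 ^ j.+1)%:R)%:E)) => j.
  have e0 : (0 < 1 / (2 ^ j.+1)%:R :> R)%R by rewrite divr_gt0// ltr0n expn_gt0.
  have : hausdorff_delta m.+1 (j.+1%:R^-1) E = 0.
    apply/eqP; rewrite eq_le hausdorff_delta_ge0 andbT -HE.
    by apply: hausdorff_delta_le; rewrite invr_gt0.
  rewrite /hausdorff_delta; set S := (X in ereal_inf X) => S0.
  have fS : ereal_inf S \is a fin_num by rewrite S0.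
  have [_ [G EG <-] Ge] := lb_ereal_inf_adherent e0 fS.
  by exists G; split => //; apply: ltW; rewrite S0 add0e in Ge.
have goodF j k : F j k !=set0 -> 
    [/\ ediam (F j k) \is a fin_num, (fine (ediam (F j k)) <= j.+1%:R^-1)%R &
     hausdorff_gauge m.+1 (j.+1%:R^-1) (F j k) = (fine (ediam (F j k)) ^+ m.+1)%:E].
  move=> F0; apply: hausdorff_gauge_ediam => //.
  apply: (@le_lt_trans _ _ (1 / (2 ^ j.+1)%:R)%:E); last exact: ltry.
  apply: le_trans (FP j).2; rewrite (@nneseriesD1 _ _ k)//; last by move=> i _; exact: hausdorff_gauge_ge0.
  rewrite leeDl//; apply: nneseries_ge0 => i _ _; exact: hausdorff_gauge_ge0.
pose G j k := F j k `&` E.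
pose p j k := xget 0%R (G j k).
pose r j k := fine (ediam (F j k)).
(* As [tau] is 1-Lipschitz on [E], its values on [F j k] within [E] fill at most an interval of
   twice the diameter of [F j k]. *)
pose I j k : set R := if G j k == set0 then set0 else `[(tau (p j k) - r j k)%R, (tau (p j k) + r j k)%R]%classic.
have mI j k : measurable (I j k : set (measurableTypeR R)).
  by rewrite /I; case: ifP => // _; exact: measurable_itv.
have GI j k x : G j k x -> I j k (tau x).
  move=> Gx; rewrite /I ifF; last by apply/negbTE/set0P; exists x.
  have Gp : G j k (p j k) by apply: xgetPex; exists x.
  have [fF _ _] := goodF j k (ex_intro _ x Gx.1).
  have := le_trans (tauL _ _ Gx.2 Gp.2) (fine_ediam_ge fF Gx.1 Gp.1).
  by rewrite -/(r j k) /= in_itv/= ler_distl.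
(* The cost of [F j k] in dimension [m], charged only to the slices it can meet. Its integral over
   [t] is at most twice the cost in dimension [m.+1]. *)
pose h j k (t : R) : \bar R := (r j k ^+ m)%:E * (\1_(I j k) t)%:E.
have r0 j k : (0 <= r j k)%R.
  rewrite /r; have [->|/set0P F0] := eqVneq (F j k) set0; last by rewrite fine_ge0 ?ediam_ge0.
  rewrite /ediam (_ : [set _ | _ in _ & _ in _] = set0) ?ereal_sup0//.
  by apply/seteqP; split => // y [u []].
have h0 j k t : 0 <= h j k t.
  by rewrite /h mule_ge0// lee_fin ?exprn_ge0// indicE.
have mh j k : measurable_fun [set: measurableTypeR R] (h j k : measurableTypeR R -> \bar R).
  apply: emeasurable_funM; first exact: measurable_cst.
  by apply/measurable_EFinP; apply: measurable_indic; exact: mI.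
have int_h j k : \int[lebesgue_measure]_t h j k t <= 2%:E * hausdorff_gauge m.+1 (j.+1%:R^-1) (F j k).
  have mf : measurable_fun [set: measurableTypeR R] (fun t : measurableTypeR R => (\1_(I j k) t)%:E : \bar R).
    by apply/measurable_EFinP; apply: measurable_indic; exact: mI.
  rewrite /h ge0_integralZl ?lee_fin ?exprn_ge0//.
  rewrite integral_indic// setIT /I; case: ifPn => [_|/set0P[x Gx]].
    by rewrite measure0 mule0 mule_ge0 ?hausdorff_gauge_ge0// lee_fin.
  have [_ _ ->] := goodF j k (ex_intro _ x Gx.1).
  rewrite [X in _ * X <= _](_ : _ = (r j k *+ 2)%:E); last first.
    etransitivity; first exact: lebesgue_measure_itv.
    rewrite /= lte_fin -EFinD; case: ifPn; first by move=> _; congr EFin; ring.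
    by rewrite -leNgt => hh; congr EFin; have := r0 j k; move: hh; rewrite mulr2n; lra.
  by rewrite -!EFinM lee_fin exprSr -/(r j k) mulrnAr mulr_natl.
have sum_h0 j t : 0 <= \sum_(k <oo) h j k t by apply: nneseries_ge0 => k _ _; exact: h0.
have msum_h j : measurable_fun [set: measurableTypeR R] (fun t : measurableTypeR R => \sum_(k <oo) h j k t).
  by apply: ge0_emeasurable_sum => // k t _ _; exact: h0.
pose H t := \sum_(j <oo) \sum_(k <oo) h j k t.
have mH : measurable_fun [set: measurableTypeR R] (H : measurableTypeR R -> \bar R).
  by apply: ge0_emeasurable_sum => // j t _ _; exact: sum_h0.
have intH : \int[lebesgue_measure]_t H t < +oo.
  rewrite integral_nneseries//.
  apply: (@le_lt_trans _ _ (\sum_(j <oo) 2%:E * (1 / (2 ^ j.+1)%:R)%:E)).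
    apply: lee_nneseries => [j _ _|j _]; first by apply: integral_ge0 => t _; exact: sum_h0.
    rewrite integral_nneseries//.
    apply: (@le_trans _ _ (\sum_(k <oo) 2%:E * hausdorff_gauge m.+1 (j.+1%:R^-1) (F j k))).
      by apply: lee_nneseries => [k _ _|k _]; [apply: integral_ge0 => t _; exact: h0|exact: int_h].
    rewrite nneseriesZl; last by move=> k _; exact: hausdorff_gauge_ge0.
    by rewrite lee_pmul2l ?fin_numE ?lte_fin//; exact: (FP j).2.
  rewrite nneseriesZl//.
  have e1 := @epsilon_trick0 R 1%R xpredT ler01.
  apply: (@le_lt_trans _ _ (2%:E * 1%:E)); last by rewrite -EFinM ltry.
  by rewrite lee_pmul2l ?fin_numE ?lte_fin.
have intE : lebesgue_measure.-integrable setT H.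
  apply/integrableP; split => //.
  under eq_integral do rewrite gee0_abs ?nneseries_ge0//.
  exact: intH.
have [Z [mZ Z0 HZ]] := integrable_ae measurableT intE.
have [t tab Zt] : exists2 t, (a < t < b)%R & ~ Z t.
  apply: contrapT => noT.
  have abZ : `]a, b[%classic `<=` Z.
    move=> t /=; rewrite in_itv/= => tab; apply: contrapT => Zt; apply: noT.
    by exists t.
  have lab : lebesgue_measure `]a, b[%classic = (b - a)%:E.
    by rewrite lebesgue_measure_itv/= lte_fin ab -EFinD.
  have := le_measure lebesgue_measure (mem_set (measurable_itv `]a, b[)) (mem_set mZ) abZ.
  rewrite [X in _ <= X]Z0 [X in X <= _]lab lee_fin leNgt.
  by rewrite subr_gt0 ab.
exists t => //.
have Hfin : H t \is a fin_num by apply: contrapT => nf; apply: Zt; apply: HZ => /=; tauto.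
have Hoo : H t < +oo by rewrite ltey_eq Hfin.
have cv := nneseries_tail_cvg (P := xpredT) Hoo (fun k _ => sum_h0 k t).
have Et j : hausdorff_delta m (j.+1%:R^-1) (E `&` [set x | tau x = t]) <= \sum_(k <oo) h j k t.
  apply: le_trans (@hausdorff_delta_cover _ _ _ _ _ (fun k => G j k `&` [set x | tau x = t]) _) _.
    by move=> x [Ex xt]; have [k _ Fx] := (FP j).1 x Ex; exists k.
  apply: lee_nneseries => [k _ _|k _]; first exact: hausdorff_gauge_ge0.
  have [->|/set0P[x [[Fx Ex] xt]]] := eqVneq (G j k `&` [set x | tau x = t]) set0.
    by rewrite hausdorff_gauge0 h0.
  have [fF Fd _] := goodF j k (ex_intro _ x Fx).
  rewrite /h indicE (_ : t \in I j k) ?mule1; last first.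
    by rewrite inE -xt; apply: GI.
  apply: hausdorff_gauge_le; first by rewrite Fd r0.
  by move=> u v [[Fu _] _] [[Fv _] _]; exact: fine_ediam_ge.
apply/eqP; rewrite eq_le hausdorff_ge0 andbT.
apply/lee_addgt0Pr => e e0; rewrite add0e.
have [N _ Ne] : \forall N \near \oo, \sum_(N <= j <oo) \sum_(k <oo) h j k t < e%:E.
  by have := cv (fun x => x < e%:E); apply; apply: open_ereal_lt'; rewrite lte_fin.
apply: hausdorff_le_near => delta d0.
(* At least [N], so that the cost of the slice is below [e], and large enough for the scale
   [j.+1%:R^-1] to be below [delta]. *)
pose j := (N + Num.truncn delta^-1)%N.
exists (j.+1%:R^-1)%R.
  rewrite invr_gt0 ltr0n/= -[leRHS]invrK lef_pV2 ?posrE ?invr_gt0//.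
  by rewrite ltW// (lt_le_trans (truncnS_gt _))// ler_nat ltnS leq_addl.
apply: le_trans (Et j) _; apply: le_trans (ltW (Ne j (leq_addr _ _))).
rewrite (nneseries_split j 1); last by move=> k _; exact: sum_h0.
rewrite addn1 big_nat1 leeDl//; apply: nneseries_ge0 => k _ _; exact: sum_h0.
Qed.

End Slicing.

(** A packing bound makes a largest separated family exist, and maximality turns it into a covering:
    every other point fails to be separated from some member. *)
Lemma maximal_family (T : Type) (P : set T) (sep : T -> T -> Prop) (M : nat) :
  (forall m (p : 'I_m -> T), (forall i, P (p i)) ->
     (forall i j, i != j -> sep (p i) (p j)) -> (m <= M)%N) ->
  (forall x y, sep x y -> sep y x) ->
  exists m (p : 'I_m -> T), [/\ forall i, P (p i),
    forall i j, i != j -> sep (p i) (p j) &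
    forall q, P q -> exists i, ~ sep (p i) q].
Proof.
move=> bnd symsep.
pose good m := exists p : 'I_m -> T, (forall i, P (p i)) /\
  forall i j, i != j -> sep (p i) (p j).
have good0 : exists m, `[< good m >].
  have f0 : 'I_0 -> T by case.
  by exists 0%N; apply/asboolP; exists f0; split=> [|] [].
have goodM m : `[< good m >] -> (m <= M)%N by move=> /asboolP[p []]; exact: bnd.
have [m /asboolP[p [pP ps]] mmax] := ex_maxnP good0 goodM.
exists m, p; split => // q Pq; apply: contrapT => noi.
suff /mmax : `[< good m.+1 >] by rewrite ltnn.
apply/asboolP; exists (fun i => if unlift ord0 i is Some j then p j else q).
split=> [i|i j]; first by case: unliftP => [j _|_].
case: unliftP => [i' ->|->]; case: unliftP => [j' ->|->].
- by move=> ij; apply: ps; apply: contra_neq ij => ->.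
- by move=> _; apply: contrapT => ns; apply: noi; exists i'.
- by move=> _; apply: symsep; apply: contrapT => ns; apply: noi; exists j'.
- by rewrite eqxx.
Qed.

Section Grid.
Context {R : realType}.

(** The label of [u] is its cell in a grid of mesh [k^-1] on the cube of half-side [M]. [inord] only
    makes the label total; inside the cube it changes nothing. *)
Lemma exists_grid (m : nat) (M k : R) : 0 <= M -> 0 < k ->
  exists f : ('I_m -> R) -> {ffun 'I_m -> 'I_(Num.truncn (2 * M * k)).+1},
    forall u v, (forall i, `|u i| <= M) -> (forall i, `|v i| <= M) ->
      f u = f v -> forall i, `|u i - v i| <= k^-1.
Proof.
move=> M0 k0; exists (fun u => [ffun i => inord (Num.truncn ((u i + M) * k))]).
move=> u v uM vM /ffunP uv i; have := uv i; rewrite !ffunE => /(congr1 (@nat_of_ord _)).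
have bnd (w : R) : `|w| <= M -> 0 <= (w + M) * k <= 2 * M * k.
  rewrite ler_norml => /andP[w1 w2]; apply/andP; split; first by rewrite mulr_ge0//; [lra|exact: ltW].
  by rewrite ler_pM2r//; lra.
have /andP[u0 u1] := bnd _ (uM i); have /andP[v0 v1] := bnd _ (vM i).
have tr (w : R) : 0 <= w <= 2 * M * k -> (Num.truncn w < (Num.truncn (2 * M * k)).+1)%N.
  move=> /andP[w0 w1]; rewrite ltnS truncn_ge_nat ?(le_trans w0 w1)//.
  by apply: le_trans w1; have /andP[] := truncn_itv w0.
rewrite !inordK ?tr ?u0 ?v0// => tuv.
have /andP[a1 a2] := truncn_itv u0; have /andP[b1 b2] := truncn_itv v0.
rewrite -(ler_pM2r k0) mulVf ?gt_eqF// -{1}(gtr0_norm k0) -normrM.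
move: a1 a2 b1 b2; rewrite tuv -natr1.
move: (_%:R) => t *; rewrite ler_norml; apply/andP; split; lra.
Qed.

Lemma card_grid (m : nat) (M k : R) : 0 <= M -> 1 <= k ->
  #|{: {ffun 'I_m -> 'I_(Num.truncn (2 * M * k)).+1}}|%:R <=
    (2 * M + 1) ^+ m * k ^+ m.
Proof.
move=> M0 k1; rewrite card_ffun !card_ord natrX -exprMn.
apply: lerXn2r; rewrite ?nnegrE ?mulr_ge0 ?addr_ge0 ?mulr_ge0//; first lra.
rewrite -natr1.
have k0 : 0 <= k by lra.
have := truncn_le (2 * M * k); rewrite !mulr_ge0//; move: (_%:R) => t; nra.
Qed.

End Grid.

(** * Measures of balls and spheres *)

Section HausdorffEuclidean.
Context {R : realType}.

Lemma hausdorff_bounded_fin n (E : set 'rV[R]_n) (M : R) : (0 <= M)%R ->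
  (forall x, E x -> (enorm x <= M)%R) -> (hausdorff n E < +oo)%E.
Proof.
move=> M0 EM.
apply: (@le_lt_trans _ _ (((2 * M + 1) ^+ n * n%:R ^+ n)%R%:E)); last exact: ltry.
apply: hausdorff_finite_pieces => // k k0.
have k1 : (1 <= k%:R :> R)%R by rewrite ler1n.
have [f fP] := @exists_grid R n M k%:R M0 (lt_le_trans ltr01 k1).
exists {ffun 'I_n -> 'I_(Num.truncn (2 * M * k%:R)).+1}, (fun x => f (x 0)).
split; first exact: card_grid.
move=> x y Ex Ey fxy; apply: enorm_le_coord => i; rewrite !mxE.
apply: (fP (x 0) (y 0)) => // j.
  exact: le_trans (ler_coord_enorm _ _) (EM _ Ex).
exact: le_trans (ler_coord_enorm _ _) (EM _ Ey).
Qed.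

(** Positivity by slicing: if [E] were null in dimension [m.+1], some slice of the first coordinate
    would be null in dimension [m], although the remaining coordinates still take all small values
    on it. After [m] slices only a nonempty set is left. *)
Lemma hausdorff_gt0_coords n m (c : R) (E : set 'rV[R]_n) (tau : nat -> 'rV[R]_n -> R) :
  (0 < c)%R ->
  (forall i x y, E x -> E y -> (`|tau i x - tau i y| <= eucl_dist x y)%R) ->
  (forall t : nat -> R, (forall i, (0 < t i < c)%R) ->
     exists2 x, E x & forall i, (i < m)%N -> tau i x = t i) ->
  (0 < hausdorff m E)%E.
Proof.
move=> c0; elim: m E tau => [|m IH] E tau tauL tauE.
  apply: hausdorff_gt0; have [|x Ex _] := tauE (fun=> c / 2)%R; last by exists x.
  by move=> i; apply/andP; split; lra.
rewrite lt0e hausdorff_ge0 andbT; apply/eqP => E0.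
have [s s0c Es] := hausdorff_null_slice (tauL 0%N) E0 c0.
suff : (0 < hausdorff m (E `&` [set x | tau 0%N x = s]))%E by rewrite Es ltxx.
apply: (IH _ (fun i => tau i.+1)) => [i x y [Ex _] [Ey _]|t tc]; first exact: tauL.
have [|x Ex xt] := tauE (fun i => if i is j.+1 then t j else s).
  by case.
by exists x => [|i im]; [split => //; exact: (xt 0%N)|exact: (xt i.+1)].
Qed.

Lemma hausdorff_ball_gt0 n : (0 < hausdorff n [set x : 'rV[R]_n | (enorm x <= 1)%R])%E.
Proof.
pose tau i (x : 'rV[R]_n) := if insub i is Some j then x 0 j else 0%R.
(* Coordinates below [n.+1%:R^-1] keep the point inside the unit ball. *)
apply: (@hausdorff_gt0_coords _ _ (n.+1%:R^-1) _ tau).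
- by rewrite invr_gt0.
- move=> i x y _ _; rewrite /tau; case: insub => [j|]; last by rewrite subrr normr0 eucl_dist_ge0.
  by have := ler_coord_enorm (x - y) j; rewrite !mxE.
- move=> t tc; exists (\row_j t j) => [/=|i im].
    apply: le_trans (@enorm_le_coord R n _ (n.+1%:R^-1) _) _ => [i|].
      by rewrite mxE ger0_norm; have /andP[/ltW ? /ltW ?] := tc i.
    by rewrite -/(_ / _)%R ler_pdivrMr// mul1r ler_nat.
  by rewrite /tau insubT mxE.
Qed.

Lemma hausdorff_ball_scale n (h : 'rV[R]_n) (r : R) : (0 < r)%R ->
  ((r ^+ n)%:E * hausdorff n [set x : 'rV[R]_n | (enorm x <= 1)%R] <=
  hausdorff n [set x | (eucl_dist h x <= r)%R])%E.
Proof.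
move=> r0; rewrite -lee_pdivlMl ?exprn_gt0//.
have -> : [set x : 'rV[R]_n | (enorm x <= 1)%R] =
    (fun x => r^-1 *: (x - h)) @` [set x | (eucl_dist h x <= r)%R].
  apply/seteqP; split => x /=.
    move=> x1; exists (r *: x + h).
      by rewrite eucl_distC /eucl_dist addrK enormZ gtr0_norm// ler_piMr// ltW.
    by rewrite addrK scalerA mulVf ?scale1r// gt_eqF.
  move=> [y hy <-]; rewrite enormZ gtr0_norm ?invr_gt0//.
  by rewrite mulrC ler_pdivrMr// mul1r -/(eucl_dist y h) eucl_distC.
rewrite -exprVn; apply: hausdorff_lipschitz; first by rewrite invr_gt0.
move=> x y _ _; rewrite /eucl_dist -scalerBr enormZ gtr0_norm ?invr_gt0//.
by rewrite opprB addrA subrK.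
Qed.

(** Over a small cube the sphere is a graph: the first [p] coordinates can be prescribed and the
    last one is solved for. *)
Lemma hausdorff_sphere_gt0 p : (0 < hausdorff p (@unit_sphere R p.+1))%E.
Proof.
pose tau i (x : 'rV[R]_p.+1) := if insub i is Some j then x 0 j else 0%R.
apply: (@hausdorff_gt0_coords _ _ (p.+1%:R^-1) _ tau).
- by rewrite invr_gt0.
- move=> i x y _ _; rewrite /tau; case: insub => [j|]; last by rewrite subrr normr0 eucl_dist_ge0.
  by have := ler_coord_enorm (x - y) j; rewrite !mxE.
- move=> t tc.
  pose q := (\sum_(i < p) t i ^+ 2)%R.
  have q1 : (q <= 1)%R.
    apply: (@le_trans _ _ (\sum_(i < p) p.+1%:R^-1)%R).
      apply: ler_sum => i _; have /andP[t0 tp] := tc i.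
      rewrite expr2; apply: (@le_trans _ _ (t i)); last exact: ltW.
      rewrite ler_piMr ?(ltW t0)//; apply: le_trans (ltW tp) _.
      by rewrite invf_le1// ler1n.
    rewrite sumr_const card_ord -[X in (X <= _)%R]mulr_natl ler_pdivrMr// mul1r ler_nat//.
  exists (\row_(j < p.+1) if (j < p)%N then t j else Num.sqrt (1 - q)) => [/=|i im].
    rewrite /unit_sphere/= /enorm /dot big_ord_recr/= !mxE ltnn.
    rewrite -expr2 sqr_sqrtr ?subr_ge0//.
    under eq_bigr do rewrite !mxE /= ltn_ord -expr2.
    by rewrite -/q addrC subrK sqrtr1.
  by rewrite /tau insubT; [exact: leqW|move=> ip; rewrite mxE /= im].
Qed.

(** Some coordinate of a unit vector has modulus at least [n^-1]. Its index, its sign and the grid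
    cell of the other coordinates fix the vector up to [O(1 / k)]: the squares of the large
    coordinates [u], [v] differ by [O(1 / k)], and their sum has modulus at least [2 / n]. *)
Lemma hausdorff_sphere_fin p : (hausdorff p (@unit_sphere R p.+1) < +oo)%E.
Proof.
set n := p.+1.
apply: (@le_lt_trans _ _ (((2 * n%:R * (2 * 1 + 1) ^+ p) * (n%:R ^+ 3) ^+ p)%R%:E)); last exact: ltry.
apply: hausdorff_finite_pieces => [|k k0]; first by rewrite exprn_ge0.
have k1 : (1 <= k%:R :> R)%R by rewrite ler1n.
have n0 : (0 < n%:R :> R)%R by rewrite ltr0n.
have [f fP] := @exists_grid R p 1 k%:R ler01 (lt_le_trans ltr01 k1).
pose i0 (x : 'rV[R]_n) : 'I_n := xget ord0 [set i | (n%:R^-1 <= `|x 0 i|)%R].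
have i0P x : unit_sphere x -> (n%:R^-1 <= `|x 0 (i0 x)|)%R.
  move=> x1; rewrite /i0; case: xgetP => // noi.
  exfalso; have : (dot x x < 1)%R.
    apply: (@lt_le_trans _ _ (\sum_(i < n) n%:R^-1)%R); last first.
      by rewrite sumr_const card_ord -[X in (X <= _)%R]mulr_natl mulfV ?gt_eqF.
    apply: ltr_sum => [|i _]; first by apply/hasP; exists ord0 => //; rewrite mem_index_enum.
    have := noi i; rewrite /= => /negP; rewrite -ltNge => xi.
    rewrite -expr2 -real_normK ?num_real// expr2.
    apply: (@le_lt_trans _ _ `|x 0 i|%R) => //; rewrite ler_piMr//.
    by apply: le_trans (ltW xi) _; rewrite invf_le1// ler1n.
  by rewrite -enorm_sqr x1 expr1n ltxx.
exists ('I_n * bool * {ffun 'I_p -> 'I_(Num.truncn (2 * 1 * k%:R : R)).+1})%type,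
  (fun x => (i0 x, (0 <= x 0 (i0 x))%R, f (fun j => x 0 (lift (i0 x) j)))).
split.
  rewrite !card_prod card_ord card_bool !natrM -mulrA [X in (_ * X)%R]mulrC mulrA [(_ * 2)%R]mulrC.
  have := @card_grid R p 1 k%:R ler01 k1; nra.
move=> x y Sx Sy [] e1; rewrite e1 => e2 e3.
have x1 i : (`|x 0 i| <= 1)%R by rewrite -Sx ler_coord_enorm.
have y1 i : (`|y 0 i| <= 1)%R by rewrite -Sy ler_coord_enorm.
have xy j : (`|x 0 (lift (i0 y) j) - y 0 (lift (i0 y) j)| <= k%:R^-1)%R.
  exact: (fP (fun j => x 0 (lift (i0 y) j)) (fun j => y 0 (lift (i0 y) j))).
have -> : (n%:R ^+ 3 / k%:R = n%:R * (n%:R ^+ 2 / k%:R) :> R)%R by rewrite exprS mulrA.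
have n1 : (1 <= n%:R :> R)%R by rewrite ler1n.
have ki0 : (0 <= k%:R^-1 :> R)%R by rewrite invr_ge0.
apply: enorm_le_coord => i; rewrite !mxE.
have [j ->|->] := unliftP (i0 y) i.
  by apply: le_trans (xy j) _; rewrite ler_peMl// exprn_ege1.
have xP := i0P _ Sx; rewrite e1 in xP; have yP := i0P _ Sy.
set u := x 0 (i0 y) in xP e2 *; set v := y 0 (i0 y) in yP e2 *.
have diff : (u ^+ 2 - v ^+ 2 = \sum_(j < p) (y 0 (lift (i0 y) j) ^+ 2 - x 0 (lift (i0 y) j) ^+ 2))%R.
  have : (dot x x = dot y y)%R by rewrite -!enorm_sqr Sx Sy.
  rewrite /dot !(bigD1_ord (i0 y))//= -!expr2 -/u -/v sumrB.
  under eq_bigr do rewrite -expr2; under [in X in _ = X -> _]eq_bigr do rewrite -expr2.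
  by move: (\sum_(_ < _) _) (\sum_(_ < _) _) => *; lra.
have uv : (`|u ^+ 2 - v ^+ 2| <= n%:R * (2 / k%:R))%R.
  rewrite diff; apply: le_trans (ler_norm_sum _ _ _) _.
  apply: (@le_trans _ _ (\sum_(j < p) 2 / k%:R)%R).
    apply: ler_sum => j _; rewrite subr_sqr normrM mulrC distrC.
    apply: ler_pM => //; apply: le_trans (ler_normD _ _) _.
    by have := x1 (lift (i0 y) j); have := y1 (lift (i0 y) j); lra.
  by rewrite sumr_const card_ord -[X in (X <= _)%R]mulr_natl ler_wpM2r ?divr_ge0// ler_nat.
have suv : (`|u + v| = `|u| + `|v|)%R.
  have [u0|u0] := leP 0%R u; have [v0|v0] := leP 0%R v.
  - by rewrite !ger0_norm// addr_ge0.
  - by move: e2; rewrite u0 leNgt v0.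
  - by move: e2; rewrite v0 leNgt u0.
  - by rewrite !ltr0_norm//; lra.
have := uv; rewrite subr_sqr normrM suv => h.
have : (`|u - v| * (2 * n%:R^-1) <= n%:R * (2 / k%:R))%R.
  by apply: le_trans h; rewrite ler_wpM2l//; lra.
rewrite -ler_pdivlMr ?mulr_gt0 ?invr_gt0// => /le_trans; apply.
rewrite le_eqVlt; apply/orP; left; apply/eqP; field.
by rewrite !gt_eqF// (lt_le_trans ltr01 k1).
Qed.

End HausdorffEuclidean.

(** * Porous sets *)

Section Porous.
Context {R : realType} {n : nat}.
Implicit Types (W E : set 'rV[R]_n).

(* Borel-Cantelli: the holes of size about [8^-k] contain disjoint balls in
   the complement of [W], so that their total volume is summable over [k],
   while each point of [E] lies in comparable neighbourhoods of holes for
   arbitrarily large [k]. *)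
Lemma porous_null_const W E (M c : R) : 0 < c ->
  E `<=` W -> (forall x, E x -> enorm x <= M) ->
  (forall y rho, E y -> 0 < rho -> exists h s, [/\ 0 < s <= rho,
     eucl_dist h y <= s & forall w, W w -> c * s <= eucl_dist h w]) ->
  hausdorff n E = 0%E.
Proof.
move=> c0 EW EM hole.
have [->|/set0P[e0 Ee0]] := eqVneq E set0; first exact: hausdorff0.
have W0 : W !=set0 by exists e0; exact: EW.
have M0 : 0 <= M by apply: le_trans (enorm_ge0 _) (EM _ Ee0).
pose g x := dist_to x W.
have gD x y : g x <= eucl_dist x y + g y by exact: dist_toD.
pose s (k : nat) : R := 8^-1 ^+ k.
have s0 k : 0 < s k by rewrite exprn_gt0.
have sS k : s k = 8 * s k.+1 by rewrite /s exprS mulrA mulfV ?mul1r.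
have s_anti k l : (k <= l)%N -> s l <= s k.
  by move=> kl; apply: ler_wiXn2l => //; lra.
have s_small (x : R) : 0 < x -> exists k, s k < x.
  move=> x0; exists (Num.truncn x^-1).+1.
  rewrite /s exprVn invf_plt ?posrE ?exprn_gt0//.
  apply: lt_le_trans (truncnS_gt _) _; rewrite -natrX ler_nat ltnW// ltn_expl//.
(* [A k] contains the points of depth about [8^-k] in the complement of [W], and [V k] the balls of
   radius [r k] around them. Thanks to the ratio 8, [V k] and [V l] are apart as soon as
   [k.+2 <= l]. *)
pose A k := [set h : 'rV[R]_n | enorm h <= M + 1 /\ s k.+1 < g h <= s k].
pose V k := [set h : 'rV[R]_n | enorm h <= M + 2 /\ s k.+1 / 2 < g h <= 2 * s k].
pose r k := s k.+1 / 4.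
have r0 k : 0 < r k by rewrite divr_gt0.
have sr k : s k = 32 * r k by rewrite sS /r; lra.
pose B1 := [set x : 'rV[R]_n | enorm x <= 1].
have fB1 : hausdorff n B1 \is a fin_num.
  by rewrite ge0_fin_numE ?hausdorff_ge0//; exact: (hausdorff_bounded_fin (M := 1)).
pose v := fine (hausdorff n B1).
have v0 : 0 < v by rewrite fine_gt0// hausdorff_ball_gt0 ltey_eq fB1.
have HM : (hausdorff n [set x : 'rV[R]_n | (enorm x <= M + 2)%R] < +oo)%E.
  by apply: (hausdorff_bounded_fin (M := M + 2)) => //; lra.
have Vfin k : hausdorff n (V k) \is a fin_num.
  rewrite ge0_fin_numE ?hausdorff_ge0//; apply: le_lt_trans HM.
  by apply: le_hausdorff => x [].
have s1 k : s k <= 1 by rewrite exprn_ile1//; lra.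
have gsep k l x y : (k.+2 <= l)%N -> s k.+1 / 2 < g x -> g y <= 2 * s l ->
    s k.+2 <= eucl_dist x y.
  move=> kl gx gy; have := gD x y; have := s_anti _ _ kl; have := sS k.+1.
  have := s0 k.+2; lra.
have Vsum : (\sum_(k <oo) hausdorff n (V k) < +oo)%E.
  apply: le_lt_trans (lte_add_pinfty HM HM).
  apply: nneseries_even_odd_le => [k|p k]; first exact: hausdorff_ge0.
  apply: (@le_trans _ _ (hausdorff n (\bigcup_i V (i.*2 + p)%N))); last first.
    by apply: le_hausdorff => x [i _ []].
  apply: (@hausdorff_separated_sum _ _ n (fun i => V (i.*2 + p)%N)) => i.
  exists (s (i.*2 + p).+2) => // j ij x y [_ /andP[gx _]] [_ /andP[_ gy]].
  apply: gsep gx gy; rewrite -!addSn leq_add2r -doubleS leq_double//.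
pose sep k (x y : 'rV[R]_n) := 3 * r k <= eucl_dist x y.
have pack k m (p : 'I_m -> 'rV[R]_n) : (forall i, A k (p i)) ->
    (forall i j, i != j -> sep k (p i) (p j)) ->
    m%:R * (v * r k ^+ n) <= fine (hausdorff n (V k)).
  move=> pA ps; rewrite -lee_fin fineK//.
  pose B (i : nat) := if insub i is Some j then [set x | eucl_dist (p (j : 'I_m)) x <= r k] else set0.
  have BV : \bigcup_i B i `<=` V k.
    move=> x [i _]; rewrite /B; case: insubP => // j _ _ /= px.
    have [pM /andP[g1 g2]] := pA j.
    have := gD x (p j); have := gD (p j) x; rewrite (eucl_distC x).
    have := sr k; have := s1 k; have := r0 k; have := sS k; have := r0 k.
    rewrite /r in px * => *.
    split; last by apply/andP; split; lra.
    have := ler_enormD (x - p j) (p j); rewrite subrK -/(eucl_dist x (p j)) (eucl_distC x); lra.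
  apply: le_trans (le_hausdorff n BV).
  apply: le_trans (@hausdorff_separated_sum _ _ n B m _); last first.
    move=> i; exists (r k) => // j ij a b; rewrite /B.
    case: insubP => // i' _ i'i /= pa; case: insubP => // j' _ j'j /= pb.
    have i'j' : i' != j' by apply: contraTneq ij => h; rewrite -i'i -j'j h ltnn.
    have := ps _ _ i'j'; rewrite /sep => h.
    have := eucl_distD a (p i') (p j'); have := eucl_distD b a (p j').
    rewrite (eucl_distC b); lra.
  apply: (@le_trans _ _ (\sum_(i < m) (v * r k ^+ n)%:E)%E).
    by rewrite sumEFin lee_fin sumr_const card_ord -[X in _ <= X]mulr_natl.
  apply: lee_sum => i _; rewrite /B valK EFinM muleC /v fineK//.
  exact: hausdorff_ball_scale.
(* The packed balls have measure at least [v * r k ^+ n], and the balls that cover [Ek k] have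
   diameter at most [2 * rho k = 64 * (1 / c + 1) * r k]. [Q] compares the two. *)
pose Q := (64 * (1 / c + 1)) ^+ n / v.
pose Ek k := [set y : 'rV[R]_n | exists2 h, A k h & eucl_dist h y <= s k / c].
pose rho k := s k / c + s k.
have rho0 k : 0 < rho k by rewrite addr_gt0// divr_gt0.
have EkH k delta : 2 * rho k <= delta ->
    (hausdorff_delta n delta (Ek k) <= Q%:E * hausdorff n (V k))%E.
  move=> rd.
  have [|x y|m [p [pA ps pmax]]] := @maximal_family 'rV[R]_n (A k) (sep k)
      (Num.truncn (fine (hausdorff n (V k)) / (v * r k ^+ n))).
  - move=> m p pA ps; rewrite truncn_ge_nat; last first.
      by rewrite divr_ge0 ?fine_ge0 ?hausdorff_ge0// mulr_ge0 ?ltW// exprn_gt0.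
    by rewrite ler_pdivlMr ?mulr_gt0 ?exprn_gt0//; exact: pack pA ps.
  - by rewrite /sep eucl_distC.
  have pk := pack _ _ _ pA ps.
  pose F (i : nat) := if insub i is Some j then [set x | eucl_dist (p (j : 'I_m)) x <= rho k] else set0.
  have EF : Ek k `<=` \big[setU/set0]_(i < m) F i.
    move=> y [h Ah hy]; rewrite -bigcup_mkord.
    have [i /negP] := pmax _ Ah; rewrite -ltNge => pih.
    exists i; first by rewrite /= ltn_ord.
    rewrite /F valK /=; apply: le_trans (eucl_distD h _ _) _.
    have := sr k; have := r0 k; rewrite /rho; lra.
  apply: le_trans (le_hausdorff_delta n delta EF) _.
  apply: le_trans (outer_measure_subadditive _ _ _) _.
  apply: (@le_trans _ _ (\sum_(i < m) ((2 * rho k) ^+ n)%:E)%E).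
    apply: lee_sum => i _; apply: le_trans (hausdorff_delta_le_gauge _ _ _) _.
    apply: hausdorff_gauge_le; first by rewrite rd mulr_ge0 ?ltW.
    rewrite /F valK => x y /= px py; apply: le_trans (eucl_distD (p i) _ _) _.
    by rewrite eucl_distC; lra.
  rewrite sumEFin sumr_const card_ord -[X in (X%:E <= _)%E]mulr_natl.
  rewrite -[hausdorff n (V k)]fineK// -EFinM lee_fin.
  have -> : (2 * rho k) ^+ n = (64 * (1 / c + 1)) ^+ n * r k ^+ n.
    by rewrite -exprMn; congr (_ ^+ n); rewrite /rho sr; field; rewrite gt_eqF.
  have -> : Q * fine (hausdorff n (V k)) =
      (64 * (1 / c + 1)) ^+ n * (fine (hausdorff n (V k)) / v) by rewrite /Q mulrAC -mulrA.
  rewrite mulrCA; apply: ler_wpM2l.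
    by rewrite exprn_ge0// mulr_ge0// addr_ge0// divr_ge0 ?ltW.
  by rewrite ler_pdivlMr// -mulrA [_ * v]mulrC.
have Q0 : 0 <= Q by rewrite divr_ge0 ?exprn_ge0 ?(ltW v0)// mulr_ge0// addr_ge0// divr_ge0 ?ltW.
(* The hole decides [k]: its depth lies between [c * t] and [t], the upper bound because [y] itself
   belongs to [W]. Hence its center is in [A k] for some [k >= k0], and [t <= s k / c]. *)
have Eb k0 : E `<=` \bigcup_(k in ~` `I_k0) Ek k.
  move=> y Ey; have [h [t [/andP[t0 tr] hy hW]]] := hole y (s k0) Ey (s0 _).
  have gh1 : c * t <= g h by exact: le_dist_to.
  have gh2 : g h <= t by apply: le_trans hy; apply: dist_to_le; exact: EW.
  have gh0 : 0 < g h by apply: lt_le_trans gh1; rewrite mulr_gt0.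
  have ex : exists k, s k.+1 < g h.
    by have [k sk] := s_small _ gh0; exists k; apply: le_lt_trans sk; exact: s_anti.
  have [k sk kmin] := ex_minnP ex.
  have ksk : g h <= s k.
    case: k sk kmin => [|k] sk kmin; first by apply: le_trans gh2 _; apply: le_trans tr _; exact: s_anti.
    by rewrite leNgt; apply/negP => /kmin; rewrite ltnn.
  exists k => /=.
    move=> kk0; have := s_anti _ _ kk0; have := le_trans gh2 tr; lra.
  exists h; last by apply: le_trans hy _; rewrite ler_pdivlMr// mulrC; exact: le_trans gh1 ksk.
  split; last by rewrite sk ksk.
  have := ler_enormD (h - y) y; rewrite subrK -/(eucl_dist h y).
  have := EM _ Ey; have := s1 k0; lra.
have cvg0 := nneseries_tail_cvg (P := xpredT) Vsum (fun k _ => hausdorff_ge0 n (V k)).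
apply/eqP; rewrite eq_le hausdorff_ge0 andbT.
apply/lee_addgt0Pr => e e0'; rewrite add0e.
have eQ : 0 < e / (Q + 1) by rewrite divr_gt0//; lra.
have [N _ Ne] : \forall N \near \oo, (\sum_(N <= j <oo) hausdorff n (V j) < (e / (Q + 1))%:E)%E.
  by have := cvg0 (fun x => x < (e / (Q + 1))%:E)%E; apply; apply: open_ereal_lt'; rewrite lte_fin.
apply: hausdorff_le_near => delta d0; exists delta; first by rewrite d0 lexx.
have [K Kd] : exists K, forall k, (K <= k)%N -> 2 * rho k <= delta.
  have c1 : 0 < 2 * (1 / c + 1) by rewrite mulr_gt0// addr_gt0// divr_gt0.
  have [K sK] := s_small (delta / (2 * (1 / c + 1))) (divr_gt0 d0 c1).
  exists K => k Kk; rewrite ltr_pdivlMr// in sK; apply: le_trans (ltW sK).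
  apply: (@le_trans _ _ (s k * (2 * (1 / c + 1)))); last by rewrite ler_pM2r// s_anti.
  by rewrite /rho; lra.
pose k0 := (N + K)%N.
apply: le_trans (le_hausdorff_delta n delta (Eb k0)) _.
apply: le_trans (outer_measure_sigma_subadditive_tail _ _ _) _.
apply: (@le_trans _ _ (\sum_(k0 <= k <oo) (Q%:E * hausdorff n (V k)))%E).
  rewrite eseries_cond [leRHS]eseries_cond.
  apply: lee_nneseries => [k _ _|k /andP[_ k0k]]; first exact: hausdorff_delta_ge0.
  by apply: EkH; apply: Kd; apply: leq_trans k0k; rewrite leq_addl.
rewrite nneseriesZl; last by move=> k _; exact: hausdorff_ge0.
apply: (@le_trans _ _ (Q%:E * (e / (Q + 1))%:E)%E).
  by rewrite lee_wpmul2l ?lee_fin// ltW// Ne//= leq_addr.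
rewrite -EFinM lee_fin mulrCA ler_piMr ?(ltW e0')// ler_pdivrMr; lra.
Qed.

(** The constant of porosity may vary with the point: [E] is the countable union of its subsets with
    constant [j.+1%:R^-1], the holes still being holes of all of [W]. *)
Lemma porous_null W E (M : R) : E `<=` W -> (forall x, E x -> enorm x <= M) ->
  (forall y, E y -> exists2 c : R, 0 < c & forall rho : R, 0 < rho -> exists h s,
     [/\ 0 < s <= rho, eucl_dist h y <= s & forall w, W w -> c * s <= eucl_dist h w]) ->
  hausdorff n E = 0%E.
Proof.
move=> EW EM hole.
pose F (j : nat) := [set y | E y /\ forall rho : R, 0 < rho -> exists h s,
  [/\ 0 < s <= rho, eucl_dist h y <= s & forall w, W w -> j.+1%:R^-1 * s <= eucl_dist h w]].
have EF : E `<=` \bigcup_j F j.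
  move=> y Ey; have [c c0 yc] := hole y Ey; exists (Num.truncn c^-1) => //; split => // rho rho0.
  have [h [s [/andP[s0 sr] hy hW]]] := yc _ rho0.
  exists h, s; split => //; first by rewrite s0.
  move=> w Ww; apply: le_trans (hW _ Ww); rewrite ler_pM2r// invf_ple ?posrE//.
  by rewrite ltW// truncnS_gt.
apply/eqP; rewrite eq_le hausdorff_ge0 andbT.
apply: le_trans (le_hausdorff n EF) _.
apply: le_trans (hausdorff_sigma_subadditive n _) _.
rewrite eseries0// => j _ _.
apply: (@porous_null_const W (F j) M (j.+1%:R^-1)).
- by rewrite invr_gt0.
- by move=> x [/EW].
- by move=> x [/EM].
- by move=> y rho [_]; apply.
Qed.

End Porous.

(** * Chains in totally disconnected self-similar sets *)

Section Linked.
Context {R : realType} {n : nat}.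
Implicit Types (A B E K U V : set 'rV[R]_n) (x y z p q : 'rV[R]_n) (eta delta rho : R).

Definition linked E eta x y := exists m (u : nat -> 'rV[R]_n),
  [/\ u 0%N = x, u m = y, forall i, (i <= m)%N -> E (u i) &
      forall i, (i < m)%N -> eucl_dist (u i) (u i.+1) <= eta].

Lemma linked_refl E eta x : E x -> linked E eta x x.
Proof. by move=> Ex; exists 0%N, (fun=> x); split => // -[]. Qed.

Lemma linked_l E eta x y : linked E eta x y -> E x.
Proof. by move=> [m [u [<- _ + _]]]; apply. Qed.

Lemma linked_r E eta x y : linked E eta x y -> E y.
Proof. by move=> [m [u [_ <- + _]]]; apply. Qed.

Lemma linked_step E eta x y z : linked E eta x y -> E z -> eucl_dist y z <= eta ->
  linked E eta x z.
Proof.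
move=> [m [u [u0 um uE us]]] Ez yz.
exists m.+1, (fun i => if (i <= m)%N then u i else z); split => //=.
- by rewrite ltnn.
- by move=> i _; case: leqP => // im; exact: uE.
- move=> i; rewrite ltnS => im; rewrite im; case: ltnP => [|mi]; first exact: us.
  by have -> : i = m by [apply/eqP; rewrite eqn_leq im mi]; rewrite um.
Qed.

Lemma linked_sym E eta x y : linked E eta x y -> linked E eta y x.
Proof.
move=> [m [u [u0 um uE us]]]; exists m, (fun i => u (m - i)%N); split.
- by rewrite subn0.
- by rewrite subnn.
- by move=> i _; apply: uE; exact: leq_subr.
- move=> i im; rewrite eucl_distC -(subnSK im); apply: us.
  by lia.
Qed.

Lemma linked_trans E eta x y z : linked E eta x y -> linked E eta y z -> linked E eta x z.
Proof.
move=> xy [m [u [u0 um uE us]]]; rewrite -um.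
suff H i : (i <= m)%N -> linked E eta x (u i) by exact: H.
elim: i => [_|i IH im]; first by rewrite u0.
by apply: (linked_step (IH (ltnW im))); [exact: uE|exact: us].
Qed.

Lemma linked_le E eta eta' x y : eta <= eta' -> linked E eta x y -> linked E eta' x y.
Proof.
move=> ee [m [u [u0 um uE us]]]; exists m, u; split => // i im.
exact: le_trans (us i im) ee.
Qed.

Definition chain_small E delta eta := forall x y, linked E eta x y -> eucl_dist x y <= delta.

Lemma chain_small_le E delta delta' eta eta' : delta <= delta' -> eta' <= eta ->
  chain_small E delta eta -> chain_small E delta' eta'.
Proof. by move=> dd ee Es x y /(linked_le ee)/Es/le_trans; apply. Qed.

(* Runs of the chain inside [B] are shorter than [eta]: dropping them leaves an
   [eta]-chain in [A]. *)
Lemma chain_smallU A B delta eta eta' : 0 <= delta -> 0 < eta' <= eta / 3 ->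
  chain_small A delta eta -> chain_small B (eta / 3) eta' ->
  chain_small (A `|` B) (delta + 2 * eta) eta'.
Proof.
move=> d0 /andP[e0 ee] As Bs x y [m [u [u0 um uE us]]].
(* Invariant: either the chain has stayed in [B] so far, or [a] and [a'] are the first and the last
   point met in [A], and since [a'] the chain has run inside [B], starting from [b]. A return to [A]
   is a step of at most [eta' + eta / 3 + eta' <= eta]. *)
have P i : (i <= m)%N -> linked B eta' x (u i) \/ exists a a',
    [/\ eucl_dist x a <= 2 * eta / 3, linked A eta a a' &
        u i = a' \/ exists2 b, eucl_dist a' b <= eta' & linked B eta' b (u i)].
  elim: i => [_|i IH im].
    have := uE 0%N (leq0n _); rewrite u0 => -[Ax|Bx]; last by left; exact: linked_refl.
    right; exists x, x; split; [|exact: linked_refl|by left].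
    by rewrite eucl_distxx; lra.
  have uS := us i im; have := uE i.+1 im; set w := u i.+1 => wAB.
  have [xu|[a [a' [xa aa' ua']]]] := IH (ltnW im).
    case: wAB => [Aw|Bw]; last by left; exact: linked_step xu Bw uS.
    right; exists w, w; split; [|exact: linked_refl|by left].
    apply: le_trans (eucl_distD (u i) _ _) _; have := Bs _ _ xu; lra.
  case: wAB => [Aw|Bw]; right.
    exists a, w; split => //; last by left.
    apply: linked_step aa' Aw _; case: ua' => [<-|[b ab bu]]; first lra.
    have := eucl_distD b a' w; have := eucl_distD (u i) b w; have := Bs _ _ bu; lra.
  exists a, a'; split => //; right; case: ua' => [<-|[b ab bu]].
    by exists w => //; exact: linked_refl.
  by exists b => //; exact: linked_step bu Bw uS.
have := P m (leqnn _); rewrite um => -[xy|[a [a' [xa aa' ya']]]].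
  by have := Bs _ _ xy; lra.
have ad := As _ _ aa'.
have := eucl_distD a x y; have := eucl_distD a' a y.
move: ad; case: ya' => [<-|[b ab bu]]; first by rewrite eucl_distxx; lra.
have := eucl_distD b a' y; have := Bs _ _ bu; lra.
Qed.

Lemma compact_closed_gap A B : compact A -> closed B -> A `&` B = set0 ->
  exists2 s : R, 0 < s & forall a b, A a -> B b -> s <= eucl_dist a b.
Proof.
move=> cA cB AB0; apply: contrapT => nos.
have [|||p Ap pF] := @compact_cluster R n A
    (fun s => [set a | A a /\ exists2 b, B b & eucl_dist a b < s]) cA.
- move=> s s' _ ss' a [Aa [b Bb ab]]; split => //; exists b => //.
  exact: lt_le_trans ab ss'.
- move=> s s0; apply: contrapT => F0; apply: nos; exists s => // a b Aa Bb.
  rewrite leNgt; apply/negP => ab; apply: F0; exists a; split => //.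
  by exists b.
- by move=> s _ a [].
suff : (A `&` B) p by rewrite AB0.
split => //; move/closed_euclP : cB; apply => r r0.
have r2 : 0 < r / 2 by rewrite divr_gt0.
have [x [Ax [b Bb xb]] px] := pF _ _ r2 r2; exists b => //.
have := eucl_distD x p b; lra.
Qed.

Lemma closed_dist_to_ge A s : closed [set x : 'rV[R]_n | s <= dist_to x A].
Proof.
have [->|/set0P A0] := eqVneq A set0.
  have -> : [set x : 'rV[R]_n | s <= dist_to x set0] = [set x | s <= 0].
    by apply/seteqP; split => x /=; rewrite /dist_to image_set0 inf0.
  apply/closed_euclP => x /(_ 1 ltr01)[y //].
apply/closed_euclP => x xc /=; rewrite leNgt; apply/negP => xs.
have [|y /= ys xy] := xc (s - dist_to x A); first by rewrite subr_gt0.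
by have := dist_toD y x A0; rewrite eucl_distC in xy; lra.
Qed.

(** The set [C] of points joined to [p] by chains of every step is connected, hence reduced to [p].
    Were it split into [B] and [V] at distance [s], ever finer chains from [B] to [V] would have
    points in the region [M] between them; a limit of such points is again in [C], but in neither
    part. *)
Lemma linked_all_eq K p q : compact K -> totally_disconnected K -> K p ->
  (forall eta, 0 < eta -> linked K eta p q) -> p = q.
Proof.
move=> cK tdK Kp pq.
have [closedK _] := (compact_closed_bounded K).1 cK.
pose C := [set x | forall eta, 0 < eta -> linked K eta p x].
have Cp : C p by move=> eta _; exact: linked_refl.
have CK : C `<=` K by move=> x /(_ 1 ltr01)/linked_r.
have closedC : closed C.
  apply/closed_euclP => x xC.
  have Kx : K x.
    move/closed_euclP : closedK; apply => r /xC[y Cy xy]; exists y => //; exact: CK.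
  move=> eta e0; have [y Cy xy] := xC eta e0.
  by apply: linked_step (Cy _ e0) Kx _; rewrite eucl_distC ltW.
have connC : connected C.
  move=> B [b Bb] [G oG BG] [F cF BF].
  apply: contrapT => BC.
  pose V := C `\` B.
  have [v Vv] : V !=set0.
    apply: contrapT => V0; apply: BC; apply/seteqP; split => x.
      by rewrite BG => -[].
    by move=> Cx; apply: contrapT => Bx; apply: V0; exists x.
  have cB : compact B.
    have -> : B = B `&` K by apply/esym/setIidl => x; rewrite BG => -[/CK].
    by rewrite setIC; apply: compact_closedI => //; rewrite BF; exact: closedI.
  have cV : closed V.
    have -> : V = C `&` ~` G.
      rewrite /V BG; apply/seteqP; split => x /=; first by move=> [Cx nCO]; split => // Gx; exact: nCO.
      by move=> [Cx nO]; split => // -[].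
    by apply: closedI => //; exact: open_closedC.
  have [s s0 BV] : exists2 s : R, 0 < s & forall a b, B a -> V b -> s <= eucl_dist a b.
    by apply: compact_closed_gap => //; apply/seteqP; split => // x [Bx [_]].
  have B0 : B !=set0 by exists b.
  have V0 : V !=set0 by exists v.
  pose s3 := s / 3.
  have s30 : 0 < s3 by rewrite divr_gt0.
  pose M := [set x | s3 <= dist_to x B] `&` [set x | s3 <= dist_to x V].
  have cM : closed M by apply: closedI; exact: closed_dist_to_ge.
  have [||||w [Kw Mw] wF] := @compact_cluster R n (K `&` M)
     (fun eta => [set x | M x /\ linked K eta p x]).
  - exact: compact_closedI.
  - by move=> e e' e0 ee' x [Mx px]; split => //; exact: linked_le px.
  - move=> eta e0.
    pose e := Num.min eta s3.
    have e0' : 0 < e by rewrite lt_min e0.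
    have Cb : C b by move: Bb; rewrite BG => -[].
    have [m [u [u0 um uK us]]] := linked_trans (linked_sym (Cb _ e0')) (Vv.1 _ e0').
    (* The first point at distance at least [s / 3] from [B]. Its predecessor is nearer than that
       and one step is at most [s / 3], so it is also at distance [s / 3] from [V]. *)
    have far : exists i, (i <= m)%N && (s3 <= dist_to (u i) B).
      exists m; rewrite leqnn um /=; apply: le_trans (_ : s <= _); first by rewrite /s3; lra.
      by apply: le_dist_to => // a Ba; rewrite eucl_distC; exact: BV.
    have [i /andP[im iB] imin] := ex_minnP far.
    case: i im iB imin => [|i] im iB imin.
      by have := dist_to_le b Bb; rewrite eucl_distxx; move: iB; rewrite u0; lra.
    have uiB : dist_to (u i) B < s3.
      rewrite ltNge; apply/negP => h; have := imin i; rewrite h (ltnW im) => /(_ isT).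
      by rewrite ltnn.
    exists (u i.+1); split.
      split => //=; apply: le_dist_to => // y Vy.
      have usi : eucl_dist (u i) (u i.+1) <= s3.
        by apply: le_trans (us i im) _; rewrite /e ge_min lexx orbT.
      have [a ua] := compact_nearest (u i) cB B0.
      have := dist_to_nearest ua; have := BV _ _ ua.1 Vy.
      have := eucl_distD (u i) a y; have := eucl_distD (u i.+1) (u i) y.
      rewrite (eucl_distC a (u i)) /s3 in uiB usi *; lra.
    have pb : linked K eta p b by exact: Cb.
    apply: linked_trans pb _; exists i.+1, u; split => //.
      by move=> j ji; apply: uK; exact: leq_trans ji im.
    move=> j ji; apply: le_trans (us j (leq_trans ji im)) _.
    by rewrite /e ge_min lexx.
  - by move=> eta _ x [Mx /linked_r].
  have Cw : C w.
    move=> eta e0; have [x [_ px] wx] := wF _ _ e0 e0.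
    by apply: linked_step px Kw _; rewrite eucl_distC ltW.
  have [Bw|Bw] := pselect (B w).
    by case: Mw => /= + _; have := dist_to_le w Bw; rewrite eucl_distxx; lra.
  have Vw : V w by [].
  by case: Mw => /= _; have := dist_to_le w Vw; rewrite eucl_distxx; lra.
have Cq : C q by [].
have : connected_component K p q by exists C.
by rewrite (tdK _ Kp) => ->.
Qed.

(** Compactness is used twice: for a fixed origin [p], where a limit of far endpoints would be
    joined to [p] by chains of every step, and then over the origins. *)
Lemma compact_chain_small K delta : compact K -> totally_disconnected K -> 0 < delta ->
  exists2 eta : R, 0 < eta & chain_small K delta eta.
Proof.
move=> cK tdK d0.
have [closedK _] := (compact_closed_bounded K).1 cK.
have loc p : K p -> exists2 eta : R, 0 < eta & forall q, linked K eta p q -> eucl_dist p q < delta / 2.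
  move=> Kp; apply: contrapT => noe.
  have [|||q Kq qF] := @compact_cluster R n K
    (fun eta => [set q | linked K eta p q /\ delta / 2 <= eucl_dist p q]) cK.
  - by move=> e e' _ ee' q [pq qd]; split => //; exact: linked_le pq.
  - move=> e e0; apply: contrapT => F0; apply: noe; exists e => // q pq.
    by rewrite ltNge; apply/negP => qd; apply: F0; exists q.
  - by move=> e _ q [/linked_r].
  have pq : p = q.
    apply: (linked_all_eq cK) => // eta e0.
    have [x [px _] qx] := qF _ _ e0 e0.
    by apply: linked_step px Kq _; rewrite eucl_distC ltW.
  have d2 : 0 < delta / 2 by rewrite divr_gt0.
  by have [x [_ xd] qx] := qF _ _ ltr01 d2; move: xd; rewrite pq; lra.
apply: contrapT => noe.
have [|||p Kp pF] := @compact_cluster R n K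
  (fun eta => [set x | exists2 y, linked K eta x y & delta < eucl_dist x y]) cK.
- by move=> e e' _ ee' x [y xy yd]; exists y => //; exact: linked_le xy.
- move=> e e0; apply: contrapT => F0; apply: noe; exists e => // x y xy.
  by rewrite leNgt; apply/negP => yd; apply: F0; exists x, y.
- by move=> e _ x [y /linked_l].
have [eta e0 pe] := loc p Kp.
have [x [y xy yd] px] := pF _ _ e0 e0.
have px' : linked K eta p x.
  by apply: linked_step (linked_refl _ Kp) (linked_l xy) (ltW px).
have := pe _ px'; have := pe _ (linked_trans px' xy).
have := eucl_distD p x y; rewrite (eucl_distC x p); lra.
Qed.

End Linked.

(** * Similarities and unions of rescaled copies *)

Section Similarities.
Context {R : realType} {n : nat}.
Implicit Types (x y z : 'rV[R]_n) (T : 'rV[R]_n -> 'rV[R]_n).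

Lemma similarity_inj r T : 0 < r -> similarity r T -> injective T.
Proof.
move=> r0 Ts x y Txy; apply/eqP; rewrite -eucl_dist_eq0.
have := Ts x y; rewrite Txy eucl_distxx => /esym/eqP.
by rewrite mulf_eq0 gt_eqF.
Qed.

(** Once translated and rescaled, [T] preserves dot products. The images of the standard basis then
    form an orthogonal matrix [M], and a vector is determined by its products with the rows of
    [M]. *)
Lemma similarity_surj r T y : 0 < r -> similarity r T -> exists x, T x = y.
Proof.
move=> r0 Ts.
pose f x := r^-1 *: (T x - T 0).
have f_dist u v : dot (f u - f v) (f u - f v) = dot (u - v) (u - v).
  rewrite -!enorm_sqr -scalerBr enormZ opprB addrA subrK.
  rewrite -/(eucl_dist (T u) (T v)) Ts gtr0_norm ?invr_gt0// mulrA mulVf ?mul1r//.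
  by rewrite gt_eqF.
have f0 : f 0 = 0 by rewrite /f subrr scaler0.
have f_sqr u : dot (f u) (f u) = dot u u.
  by have := f_dist u 0; rewrite f0 !subr0.
have f_dot u v : dot (f u) (f v) = dot u v.
  have := f_dist u v; have := f_sqr u; have := f_sqr v.
  move: (f u) (f v) => a b ea eb; rewrite !dotE ea eb (dotC b) (dotC v); lra.
pose e i : 'rV[R]_n := \row_j (i == j)%:R.
have dot_e (u : 'rV[R]_n) i : dot u (e i) = u 0 i.
  rewrite /dot (bigD1 i)//= mxE eqxx mulr1 big1 ?addr0// => j ji.
  by rewrite mxE eq_sym (negbTE ji) mulr0.
pose M : 'M[R]_n := \matrix_(i, j) f (e i) 0 j.
have mulM (u : 'rV[R]_n) i : (u *m M^T) 0 i = dot u (f (e i)).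
  by rewrite mxE; apply: eq_bigr => j _; rewrite !mxE.
have rowM i : row i M = f (e i) by apply/rowP => j; rewrite !mxE.
have MMT : M *m M^T = 1%:M.
  apply/matrixP => i j; rewrite -[M]/(M) mxE.
  transitivity (dot (f (e i)) (f (e j))).
    by apply: eq_bigr => k _; rewrite !mxE.
  by rewrite f_dot dot_e !mxE.
have MTM := mulmx1C MMT.
pose w := r^-1 *: (y - T 0).
pose x := w *m M^T.
exists x; suff fx : f x = w.
  have := congr1 (fun v => r *: v) fx.
  by rewrite /w /f !scalerA mulfV ?gt_eqF// !scale1r => /(congr1 (+%R^~ (T 0))); rewrite !subrK.
have : (f x - w) *m M^T = 0.
  by apply/rowP => i; rewrite mulM dotBl f_dot dot_e [RHS]mxE -mulM subrr.
move=> /(congr1 (mulmx^~ M)); rewrite -mulmxA MTM mulmx1 mul0mx => /eqP.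
by rewrite subr_eq0 => /eqP.
Qed.

Lemma chain_small_similarity r T (K : set 'rV[R]_n) delta eta : 0 < r ->
  similarity r T -> chain_small K delta eta ->
  chain_small (T @` K) (r * delta) (r * eta).
Proof.
move=> r0 Ts Ks x y [m [u [u0 um uE us]]].
have [v vP] : {v : nat -> 'rV[R]_n & forall i, (i <= m)%N -> K (v i) /\ T (v i) = u i}.
  apply: (@choice _ _ (fun i w => (i <= m)%N -> K w /\ T w = u i)) => i.
  have [im|im] := leqP i m; last by exists 0.
  by have [w Kw Tw] := uE i im; exists w.
rewrite -u0 -um -(vP _ (leq0n _)).2 -(vP _ (leqnn _)).2 Ts ler_pM2l//.
apply: Ks; exists m, v; split => // i im; first exact: (vP i im).1.
by have := us i im; rewrite -(vP _ im).2 -(vP _ (ltnW im)).2 Ts ler_pM2l.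
Qed.

Definition rescaled_copy (rmin rho : R) (K E : set 'rV[R]_n) := E = set0 \/
  exists r T, [/\ similarity r T, rmin * rho <= r <= rho & E = T @` K].

(** The step [eta] depends on the number of copies but neither on their scale nor on their position,
    which makes the bound usable at every scale. Copies are added one at a time by
    [chain_smallU]. *)
Lemma chain_small_copies (rmin : R) (K : set 'rV[R]_n) (g : nat) (delta : R) :
  0 < rmin -> compact K -> totally_disconnected K -> 0 < delta ->
  exists2 eta : R, 0 < eta & forall rho (F : nat -> set 'rV[R]_n), 0 < rho ->
    (forall i, rescaled_copy rmin rho K (F i)) ->
    chain_small (\big[setU/set0]_(i < g) F i) (rho * delta) (rho * eta).
Proof.
move=> rmin0 cK tdK; elim: g delta => [|g IH] delta d0.
  exists 1 => // rho F rho0 _; rewrite big_ord0 => x y /linked_l [].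
have d3 : 0 < delta / 3 by rewrite divr_gt0.
have [eta1 e1 K1] := compact_chain_small cK tdK d3.
(* The first bound makes chains inside the smallest admissible copy short; the second absorbs the
   loss [2 * eta] of [chain_smallU] into [delta]. *)
pose eta2 := Num.min (rmin * eta1) (delta / 3).
have e2 : 0 < eta2 by rewrite lt_min mulr_gt0.
have [eta3 e3 F3] := IH (eta2 / 3) (divr_gt0 e2 (ltr0n _ 3)).
exists (Num.min eta3 (eta2 / 3)); first by rewrite lt_min e3 divr_gt0.
move=> rho F rho0 Fc; rewrite big_ord_recr/= setUC.
have Fg : chain_small (F g) (rho * (delta / 3)) (rho * eta2).
  case: (Fc g) => [->|[r [T [Ts /andP[r1 r2] ->]]]]; first by move=> x y /linked_l [].
  have r0 : 0 < r by apply: lt_le_trans r1; rewrite mulr_gt0.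
  apply: chain_small_le (chain_small_similarity r0 Ts K1).
    by rewrite ler_pM2r.
  apply: (@le_trans _ _ (rho * (rmin * eta1))).
    by rewrite ler_pM2l// /eta2 ge_min lexx.
  by rewrite mulrA [rho * _]mulrC ler_pM2r.
have Fr : chain_small (\big[setU/set0]_(i < g) F i) (rho * eta2 / 3) (rho * Num.min eta3 (eta2 / 3)).
  rewrite -mulrA; apply: chain_small_le (F3 rho F rho0 Fc) => //.
  by rewrite ler_pM2l// ge_min lexx.
have m0 : 0 < Num.min eta3 (eta2 / 3) by rewrite lt_min e3 divr_gt0.
apply: chain_small_le (chain_smallU _ _ Fg Fr) => //.
- have : eta2 <= delta / 3 by rewrite /eta2 ge_min lexx orbT.
  move=> h; have : rho * eta2 <= rho * (delta / 3) by rewrite ler_pM2l.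
  by move: (rho * eta2) => t; lra.
- by rewrite mulr_ge0 ?ltW.
- by rewrite mulr_gt0//= -mulrA ler_pM2l// ge_min lexx orbT.
Qed.

End Similarities.

(** * Pieces of a self-similar set and the open set condition *)

Section Words.
Context {R : realType} {d N : nat}.
Variables (S : 'I_N -> 'rV[R]_d -> 'rV[R]_d) (r : 'I_N -> R) (K : set 'rV[R]_d).
Hypotheses (r_bounds : forall i, 0 < r i < 1)
  (S_similarity : forall i, similarity (r i) (S i))
  (K_self_similar : self_similar_set S K).
Implicit Types (u v w : seq 'I_N) (rho : R).

Definition word_map u : 'rV[R]_d -> 'rV[R]_d := foldr (fun i f => S i \o f) id u.
Definition word_ratio u : R := \prod_(i <- u) r i.

Lemma word_map_cat u v x : word_map (u ++ v) x = word_map u (word_map v x).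
Proof. by elim: u => //= i u ->. Qed.

Lemma word_ratio_gt0 u : 0 < word_ratio u.
Proof. by apply: prodr_gt0 => i _; have /andP[] := r_bounds i. Qed.

Lemma word_similarity u : similarity (word_ratio u) (word_map u).
Proof.
elim: u => [|i u IH] x y /=; first by rewrite /word_ratio big_nil mul1r.
by rewrite S_similarity IH /word_ratio big_cons mulrA.
Qed.

Lemma self_similar_image i x : K x -> K (S i x).
Proof. by case: K_self_similar => _ _ KE Kx; rewrite KE; exists i => //; exists x. Qed.

Lemma word_map_sub u x : K x -> K (word_map u x).
Proof. by elim: u => //= i u IH /IH; exact: self_similar_image. Qed.

Lemma exists_word (m : nat) x : K x -> exists u, size u = m /\ (word_map u @` K) x.
Proof.
elim: m x => [|m IH] x Kx; first by exists [::]; split => //; exists x.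
case: (K_self_similar) => _ _ KE; move: (Kx); rewrite {1}KE => -[i _ [y Ky <-]].
have [u [um [z Kz <-]]] := IH _ Ky.
by exists (i :: u); split; [rewrite /= um|exists z].
Qed.

Lemma exists_ratio_bounds : exists rmin rmax : R, [/\ 0 < rmin <= 1, 0 < rmax < 1 & forall i, rmin <= r i <= rmax].
Proof.
exists (\big[Num.min/1]_i r i), (\big[Num.max/2^-1]_i r i); split.
- by rewrite bigmin_le_id andbT; apply: lt_bigmin => // i _; have /andP[] := r_bounds i.
- apply/andP; split; first by apply: lt_le_trans (bigmax_ge_id _ _ _ _); lra.
  by apply: bigmax_lt => [|i _]; [lra|have /andP[] := r_bounds i].
- by move=> i; apply/andP; split; [exact: bigmin_inf|exact: le_bigmax].
Qed.

Lemma word_ratio_le_exp rmax u : (forall i, r i <= rmax) -> word_ratio u <= rmax ^+ size u.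
Proof.
move=> rm; elim: u => [|i u IH]; first by rewrite /word_ratio big_nil expr0.
rewrite /word_ratio big_cons exprS; apply: ler_pM => //.
  by have /andP[/ltW] := r_bounds i.
exact/ltW/word_ratio_gt0.
Qed.

(** The cut set of scale [rho]: words whose ratio has just dropped to [rho], so that their pieces
    have comparable sizes although the ratios of the maps differ. *)
Definition stopping rho u := word_ratio u <= rho /\
  forall k, (k < size u)%N -> rho < word_ratio (take k u).

Lemma exists_stopping rho x : 0 < rho -> K x -> exists2 u, stopping rho u & (word_map u @` K) x.
Proof.
move=> rho0 Kx.
have [rmin [rmax [/andP[rmin0 _] /andP[rmax0 rmax1] rb]]] := exists_ratio_bounds.
have [m rm] : exists m, rmax ^+ m <= rho.
  have /cvgrPdist_le/(_ rho rho0)[m _ /(_ m (leqnn m))] : rmax ^+ n @[n --> \oo] --> (0 : R).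
    by apply: cvg_expr; rewrite ger0_norm ?ltW.
  by rewrite sub0r normrN ger0_norm ?exprn_ge0 ?(ltW rmax0)// => h; exists m.
have [u [um ux]] := exists_word m Kx.
have ex : exists k, word_ratio (take k u) <= rho.
  exists m; rewrite take_oversize ?um//; apply: le_trans rm; rewrite -um.
  by apply: word_ratio_le_exp => i; have /andP[] := rb i.
have [k ku kmin] := ex_minnP ex.
exists (take k u).
  split => // j; rewrite size_take_min leq_min => /andP[jk ju].
  rewrite take_takel ?(ltnW jk)// ltNge; apply/negP => /kmin.
  by rewrite leqNgt jk.
case: ux => y Ky <-; exists (word_map (drop k u) y); first exact: word_map_sub.
by rewrite -word_map_cat cat_take_drop.
Qed.

(** Without its last letter the word has ratio above [rho], and that letter costs at most the factor
    [rmin]. The empty word, of ratio 1, is where [rho <= 1] enters. *)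
Lemma stopping_ratio_ge rho rmin u : rho <= 1 -> 0 <= rmin <= 1 -> (forall i, rmin <= r i) ->
  stopping rho u -> rmin * rho <= word_ratio u.
Proof.
move=> rho1 /andP[rmin0 rmin1] rm [ur us]; elim/last_ind: u ur us => [_ _|u i _ _ us].
  rewrite /word_ratio big_nil -[leRHS]mulr1; have [rho0|rho0] := leP 0 rho.
    exact: ler_pM.
  by apply: (@le_trans _ _ 0); rewrite ?mulr1// mulr_ge0_le0// ltW.
have := us (size u); rewrite size_rcons ltnSn -cats1 take_size_cat// => /(_ isT) ru.
rewrite /word_ratio big_cat/= big_seq1 mulrC -/(word_ratio u).
have := word_ratio_gt0 u; have := rm i.
move: (word_ratio u) ru => t; nra.
Qed.

Lemma stopping_prefix rho u v : stopping rho u -> stopping rho v -> prefix u v -> u = v.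
Proof.
move=> [ur us] [vr vs]; rewrite prefixE => /eqP uv.
have [uv'|uv'] := ltnP (size u) (size v).
  by have := vs _ uv'; rewrite uv ltNge ur.
by rewrite -uv take_oversize.
Qed.

Lemma word_disjoint (O : set 'rV[R]_d) u v :
  \bigcup_i (S i @` O) `<=` O ->
  (forall i j, i != j -> (S i @` O) `&` (S j @` O) = set0) ->
  ~~ prefix u v -> ~~ prefix v u ->
  (word_map u @` O) `&` (word_map v @` O) = set0.
Proof.
move=> SO Odisj.
have sub w x : O x -> O (word_map w x).
  by elim: w => //= i w IH /IH Ow; apply: SO; exists i => //; exists (word_map w x).
elim: u v => [|i u IH] [|j v]; rewrite ?prefix0s//= ?eqxx/=.
have [<- uv vu|ij _ _] := eqVneq i j.
  apply/seteqP; split => // x [[a Oa <-] [b Ob]] /(similarity_inj _ (S_similarity i)).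
  move=> /(_ (proj1 (andP (r_bounds i)))) ba.
  suff : ((word_map u @` O) `&` (word_map v @` O)) (word_map u a) by rewrite IH.
  by split; [exists a|exists b].
apply/seteqP; split => // x [[a Oa <-] [b Ob ba]].
suff : ((S i @` O) `&` (S j @` O)) (S i (word_map u a)) by rewrite Odisj.
split; first by exists (word_map u a) => //; exact: sub.
by exists (word_map v b) => //; exact: sub.
Qed.

(* The open set condition keeps the points [S_u z], for stopping words [u] of
   scale [rho], at distance at least [c rho]. *)
Lemma open_set_condition_bound : open_set_condition S ->
  exists (g : nat) (rmin : R), 0 < rmin /\
    forall x rho, 0 < rho <= 1 ->
    exists F : nat -> set 'rV[R]_d, (forall i, rescaled_copy rmin rho K (F i)) /\
      K `&` [set y | eucl_dist x y <= rho] `<=` \big[setU/set0]_(i < g) F i.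
Proof.
move=> [G [[z Gz] oG SG Gdisj]].
have [K0 cK _] := K_self_similar.
have [rmin [rmax [/andP[rmin0 rmin1] _ rb]]] := exists_ratio_bounds.
have [beta b0 bG] := (open_euclP G).1 oG z Gz.
have [closedK [M KM]] := (compact_closed_bounded K).1 cK.
pose D := M + enorm z.
have zK y : K y -> eucl_dist z y <= D.
  move=> Ky; rewrite /eucl_dist; apply: le_trans (ler_enormD _ _) _.
  by rewrite enormN addrC lerD2r KM.
have D0 : 0 <= D by case: K0 => k Kk; apply: le_trans (zK k Kk); exact: eucl_dist_ge0.
have sepz rho u v : stopping rho u -> stopping rho v -> u != v ->
    beta * word_ratio u <= eucl_dist (word_map u z) (word_map v z).
  move=> us vs uv; rewrite leNgt; apply/negP => near.
  (* Being onto, [word_map u] carries the ball of radius [beta] about [z] onto a full ball of radius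
     [beta * word_ratio u]. A closer [word_map v z] would lie in the images of [G] under both
     words. *)
  have [y uy] := similarity_surj (word_map v z) (word_ratio_gt0 u) (word_similarity u).
  have Gy : G y.
    apply: bG; rewrite -(ltr_pM2l (word_ratio_gt0 u)) -(word_similarity u) uy.
    by rewrite [ltRHS]mulrC.
  suff : ((word_map u @` G) `&` (word_map v @` G)) (word_map v z).
    rewrite word_disjoint//.
      by apply: contraNN uv => /(stopping_prefix us vs) ->.
    by apply: contraNN uv => /(stopping_prefix vs us) ->.
  by split; [exists y|exists z].
(* A mesh at which two points of one cell are at distance less than [beta * rmin]. Rescaled by
   [rho], the points [word_map u z] thus have distinct cells, and the number of cells bounds the
   number of words near [x]. *)
pose k := d.+1%:R / (beta * rmin).
have k0 : 0 < k by rewrite divr_gt0 ?mulr_gt0.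
have [f fP] := @exists_grid R d (1 + D) k (addr_ge0 ler01 D0) k0.
pose I := {ffun 'I_d -> 'I_(Num.truncn (2 * (1 + D) * k)).+1}.
exists #|{: I}|, rmin; split => // x rho /andP[rho0 rho1].
pose P := [set u | stopping rho u /\ exists2 y, K y & eucl_dist x (word_map u y) <= rho].
have pack m (p : 'I_m -> seq 'I_N) : (forall i, P (p i)) ->
    (forall i j, i != j -> p i != p j) -> (m <= #|{: I}|)%N.
  move=> pP pneq.
  pose q i := rho^-1 *: (word_map (p i) z - x).
  have qM i j : `|q i 0 j| <= 1 + D.
    have [[pr ps] [y Ky xy]] := pP i.
    apply: le_trans (ler_coord_enorm _ _) _.
    rewrite enormZ gtr0_norm ?invr_gt0// mulrC ler_pdivrMr//.
    apply: le_trans (eucl_distD (word_map (p i) y) _ _) _.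
    rewrite (word_similarity (p i)) (eucl_distC _ x) mulrDl mul1r addrC lerD//.
    rewrite mulrC; apply: ler_pM => //; [exact: eucl_dist_ge0|exact/ltW/word_ratio_gt0|exact: zK].
  have inj : injective (fun i => f (q i 0)).
    move=> i j fij; apply/eqP; apply: contraT => ij.
    have := sepz rho _ _ (pP i).1 (pP j).1 (pneq _ _ ij).
    have e : word_map (p i) z - word_map (p j) z = rho *: (q i - q j).
      by rewrite /q -scalerBr scalerA mulfV ?gt_eqF// scale1r opprB addrA subrK.
    rewrite /eucl_dist e enormZ gtr0_norm//.
    have qij : enorm (q i - q j) <= d%:R * k^-1.
      apply: enorm_le_coord => l; rewrite (_ : (q i - q j) 0 l = q i 0 l - q j 0 l); last by rewrite !mxE.
      exact: (fP (q i 0) (q j 0)).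
    have rr : rmin * rho <= word_ratio (p i).
      apply: stopping_ratio_ge (pP i).1 => //; first by rewrite ltW.
      by move=> l; have /andP[] := rb l.
    move=> h; have : beta * (rmin * rho) <= rho * (d%:R * k^-1).
      apply: (le_trans (y := beta * word_ratio (p i))); first by rewrite ler_pM2l.
      by apply: le_trans h _; rewrite ler_pM2l.
    have kE : beta * rmin = k^-1 * d.+1%:R by rewrite /k invf_div mulfVK.
    have : 0 < rho * k^-1 by rewrite mulr_gt0// invr_gt0.
    by rewrite mulrA kE -natr1; move: (d%:R) => D'; lra.
  by rewrite -[m]card_ord; apply: leq_card inj.
have [m p pP pneq|u v|m [p [pP pneq pmax]]] := @maximal_family (seq 'I_N) P (fun u v => u != v) #|{: I}|.
- exact: pack pP pneq.
- by rewrite eq_sym.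
have mI := pack _ _ pP pneq.
pose F (i : nat) := if insub i is Some j then word_map (p (j : 'I_m)) @` K else set0.
exists F; split.
  move=> i; rewrite /F; case: insub => [j|]; last by left.
  right; exists (word_ratio (p j)), (word_map (p j)); split => //; first exact: word_similarity.
  have [ps _] := pP j; case: (ps) => -> _; rewrite andbT.
  apply: stopping_ratio_ge ps => //; first by rewrite ltW.
  by move=> l; have /andP[] := rb l.
move=> y [Ky /= xy]; have [u us [y' Ky' uy]] := exists_stopping rho0 Ky.
have [|i /negP] := pmax u; first by split => //; exists y' => //; rewrite uy.
rewrite negbK => /eqP pi; rewrite -bigcup_mkord; exists i => /=.
  exact: leq_trans (ltn_ord i) mI.
by rewrite /F valK pi -uy; exists y'.
Qed.

(* Chains in [K] of step [tau] stay at distance [O(tau)] from their origin: at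
   scale [rho = tau / eta], [K] is a bounded union of copies of itself. *)
Lemma linked_diameter : totally_disconnected K -> open_set_condition S ->
  exists2 C : R, 0 < C & forall tau x y, 0 < tau -> linked K tau x y -> eucl_dist x y <= C * tau.
Proof.
move=> tdK osc.
have [K0 cK _] := K_self_similar.
have [g [rmin [rmin0 cover]]] := open_set_condition_bound osc.
have q0 : 0 < 4^-1 :> R by [].
have [eta0 e0 small] := chain_small_copies g rmin0 cK tdK q0.
have [closedK [M KM]] := (compact_closed_bounded K).1 cK.
have M0 : 0 <= M by case: K0 => k Kk; apply: le_trans (KM k Kk); exact: enorm_ge0.
pose eta := Num.min eta0 4^-1.
have e1 : 0 < eta by rewrite lt_min e0/=.
have e4 : eta <= 4^-1 by rewrite /eta ge_min lexx orbT.
have ei0 : 0 < eta^-1 by rewrite invr_gt0.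
exists ((1 + 2 * M) / eta); first by rewrite divr_gt0//; lra.
move=> tau x y tau0 xy.
have [taue|taue] := leP eta tau.
  apply: (@le_trans _ _ (2 * M)).
    rewrite /eucl_dist; apply: le_trans (ler_enormD _ _) _; rewrite enormN.
    by have := KM _ (linked_l xy); have := KM _ (linked_r xy); lra.
  rewrite mulrAC ler_pdivlMr//; apply: ler_pM => //; rewrite ?(ltW e1)//; lra.
pose rho := tau / eta.
have rho0 : 0 < rho by rewrite divr_gt0.
have rho1 : rho <= 1 by rewrite ler_pdivrMr// mul1r ltW.
have tauE : tau = rho * eta by rewrite /rho mulfVK// gt_eqF.
have [|F [FK KF]] := cover x rho; first by rewrite rho0.
have [m [u [u0 um uK us]]] := xy.
(* Bootstrap: while the chain is within [rho / 2] of [x], its next point is within [rho], where the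
   copies cover [K]; the chain up to that point then ends within [rho / 4] of [x]. *)
have H i : (i <= m)%N -> forall j, (j <= i)%N -> eucl_dist x (u j) <= rho / 2.
  elim: i => [_ j|i IH im j].
    by rewrite leqn0 => /eqP ->; rewrite u0 eucl_distxx divr_ge0 ?ltW.
  rewrite leq_eqVlt => /predU1P[->|]; last by rewrite ltnS; apply: IH; exact: ltnW.
  have rho4 : rho * eta <= rho / 4 by rewrite ler_pM2l.
  have B j' : (j' <= i.+1)%N -> eucl_dist x (u j') <= rho.
    rewrite leq_eqVlt => /predU1P[->|].
      have := IH (ltnW im) i (leqnn i); have := us _ im; have := eucl_distD (u i) x (u i.+1).
      rewrite tauE; lra.
    by rewrite ltnS => /(IH (ltnW im)); lra.
  have : linked (\big[setU/set0]_(i < g) F i) (rho * eta0) x (u i.+1).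
    exists i.+1, u; split => //.
      by move=> j' ji; apply: KF; split; [apply: uK; exact: leq_trans ji im|exact: B].
    move=> j' ji; apply: le_trans (us _ (leq_trans ji im)) _.
    by rewrite tauE ler_pM2l// /eta ge_min lexx.
  by move=> /(small _ _ rho0 FK); lra.
rewrite -um; apply: le_trans (H m (leqnn m) m (leqnn m)) _.
apply: (@le_trans _ _ rho); first lra.
rewrite /rho mulrAC ler_pM2r// ler_peMl ?(ltW tau0)//; lra.
Qed.

End Words.

(** * Normal bundle of the complement of a parallel set *)

Section RowPairs.
Context {R : realType} {d : nat}.
Implicit Types (u v : 'rV[R]_d) (z : 'rV[R]_(d + d)).

Lemma dot_row_mx u v u' v' : dot (row_mx u v) (row_mx u' v') = dot u u' + dot v v'.
Proof.
rewrite /dot big_split_ord/=; congr (_ + _); apply: eq_bigr => i _.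
  by rewrite !row_mxEl.
by rewrite !row_mxEr.
Qed.

Lemma enorm_row_sqr z : enorm z ^+ 2 = enorm (lsubmx z) ^+ 2 + enorm (rsubmx z) ^+ 2.
Proof. by rewrite !enorm_sqr -dot_row_mx hsubmxK. Qed.

Lemma enorm_lsubmx z : enorm (lsubmx z) <= enorm z.
Proof.
rewrite -(ler_pXn2r (_ : 0 < 2)%N) ?nnegrE ?enorm_ge0//.
by rewrite [leRHS]enorm_row_sqr lerDl sqr_ge0.
Qed.

Lemma enorm_rsubmx z : enorm (rsubmx z) <= enorm z.
Proof.
rewrite -(ler_pXn2r (_ : 0 < 2)%N) ?nnegrE ?enorm_ge0//.
by rewrite [leRHS]enorm_row_sqr lerDr sqr_ge0.
Qed.

Lemma enorm_row_le z : enorm z <= enorm (lsubmx z) + enorm (rsubmx z).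
Proof.
rewrite -(ler_pXn2r (_ : 0 < 2)%N) ?nnegrE ?addr_ge0 ?enorm_ge0//.
rewrite enorm_row_sqr; have := enorm_ge0 (lsubmx z); have := enorm_ge0 (rsubmx z); nra.
Qed.

Lemma lsubmxB z z' : lsubmx (z - z') = lsubmx z - lsubmx z'.
Proof. by apply/rowP => i; rewrite !mxE. Qed.

Lemma rsubmxB z z' : rsubmx (z - z') = rsubmx z - rsubmx z'.
Proof. by apply/rowP => i; rewrite !mxE. Qed.

Lemma dist_lsubmx z z' : eucl_dist (lsubmx z) (lsubmx z') <= eucl_dist z z'.
Proof. by rewrite /eucl_dist -lsubmxB enorm_lsubmx. Qed.

Lemma dist_rsubmx z z' : eucl_dist (rsubmx z) (rsubmx z') <= eucl_dist z z'.
Proof. by rewrite /eucl_dist -rsubmxB enorm_rsubmx. Qed.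

Lemma dist_row_le z z' : eucl_dist z z' <=
  eucl_dist (lsubmx z) (lsubmx z') + eucl_dist (rsubmx z) (rsubmx z').
Proof. by rewrite /eucl_dist -lsubmxB -rsubmxB enorm_row_le. Qed.

Definition ray_point (t : R) z : 'rV[R]_d := lsubmx z + t *: rsubmx z.

Lemma dist_ray_point t z z' : 0 <= t ->
  eucl_dist (ray_point t z) (ray_point t z') <= (1 + t) * eucl_dist z z'.
Proof.
move=> t0; rewrite /eucl_dist /ray_point.
have -> : lsubmx z + t *: rsubmx z - (lsubmx z' + t *: rsubmx z') =
    lsubmx (z - z') + t *: rsubmx (z - z').
  by rewrite lsubmxB rsubmxB scalerBr opprD addrACA.
apply: le_trans (ler_enormD _ _) _; rewrite enormZ ger0_norm// mulrDl mul1r.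
by rewrite lerD ?enorm_lsubmx// ler_wpM2l// enorm_rsubmx.
Qed.

End RowPairs.

(** * Proximal normals and their rays *)

Section Proximal.
Context {R : realType} {d : nat}.
Implicit Types (X : set 'rV[R]_d) (x y u v : 'rV[R]_d) (z : 'rV[R]_(d + d)).

(** Federer's quantitative form of normality: for [c > 0] and a unit vector [rsubmx z], the open
    ball of radius [(2 * c)^-1] that touches at [lsubmx z] on the side of [rsubmx z] misses [X]. *)
Definition proximal (c : R) X z := forall x, X x ->
  dot (x - lsubmx z) (rsubmx z) <= c * eucl_dist x (lsubmx z) ^+ 2.

Lemma proximal_le c c' X z : c <= c' -> proximal c X z -> proximal c' X z.
Proof. by move=> cc Xz x /Xz/le_trans; apply; rewrite ler_wpM2r ?sqr_ge0. Qed.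

Lemma proximal_normal_cone c X z : proximal c X z -> normal_cone X (lsubmx z) (rsubmx z).
Proof.
move=> Xz u [->|uT]; first by rewrite dot0l.
have [->|u0] := eqVneq u 0; first by rewrite dot0l.
set v := rsubmx z in Xz *.
rewrite leNgt; apply/negP => uv.
have un : 0 < enorm u by rewrite enorm_gt0.
pose b := (enorm u)^-1 * dot u v.
have b0 : 0 < b by rewrite mulr_gt0// invr_gt0.
pose D := `|c| + enorm v + 1.
have D0 : 0 < D by rewrite ltr_wpDl ?addr_ge0 ?enorm_ge0.
have [x [Xx /andP[x0 xe] xu]] := uT (b / D) (divr_gt0 b0 D0).
set y := x - lsubmx z in xu; have := Xz x Xx.
rewrite -/y /eucl_dist -/y => h.
have y0 : 0 < enorm y := x0.
have h1 : (enorm y)^-1 * dot y v <= `|c| * (b / D).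
  apply: (@le_trans _ _ (`|c| * enorm y)); last by rewrite ler_wpM2l// ltW.
  rewrite mulrC ler_pdivrMr// -mulrA -expr2; apply: le_trans h _.
  by rewrite ler_wpM2r ?sqr_ge0// ler_norm.
have h2 : b <= (enorm y)^-1 * dot y v + enorm v * (b / D).
  have := cauchy_schwarz ((enorm u)^-1 *: u - (enorm y)^-1 *: y) v.
  rewrite dotBl !dotZl -/b.
  have : enorm ((enorm u)^-1 *: u - (enorm y)^-1 *: y) * enorm v <= enorm v * (b / D).
    rewrite mulrC ler_wpM2l ?enorm_ge0//.
    by rewrite -/(eucl_dist _ _) eucl_distC ltW.
  lra.
have : b <= (D - 1) * (b / D) by rewrite /D in h1 h2 *; lra.
have bE : b = D * (b / D) by rewrite mulrCA mulfV ?mulr1// gt_eqF.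
have q0 : 0 < b / D by rewrite divr_gt0.
by rewrite {1}bE; lra.
Qed.

(** The difference of the ray points is multiplied by the difference of the feet, and each proximal
    inequality is applied at the foot of the other pair. *)
Lemma proximal_pair c c' X z z' t t' : 0 <= t -> 0 <= t' ->
  X (lsubmx z) -> X (lsubmx z') -> proximal c X z -> proximal c' X z' ->
  (1 - c * t - c' * t') * eucl_dist (lsubmx z) (lsubmx z') <=
    eucl_dist (ray_point t z) (ray_point t' z').
Proof.
move=> t0 t'0 Xz Xz' pz pz'.
have := pz _ Xz'; have := pz' _ Xz; rewrite /ray_point.
move: (lsubmx z) (lsubmx z') (rsubmx z) (rsubmx z') => x x' n n'.
have [->|xx'] := eqVneq x x'; first by rewrite eucl_distxx mulr0 eucl_dist_ge0.
have D0 : 0 < eucl_dist x x' by rewrite lt0r eucl_dist_eq0 xx' eucl_dist_ge0.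
rewrite (eucl_distC x') => h' h.
rewrite -(ler_pM2r D0); apply: le_trans (cauchy_schwarz _ _) => //.
have -> : x + t *: n - (x' + t' *: n') = (x - x') + (t *: n - t' *: n').
  by rewrite opprD addrACA.
rewrite dotDl [dot (t *: n - _) _]dotBl !dotZl -mulrA -expr2 -eucl_dist_sqr.
have e1 : dot n (x - x') = - dot (x' - x) n by rewrite dotC -dotNl opprB.
rewrite e1 (dotC n'); have := ler_wpM2l t0 h; have := ler_wpM2l t'0 h'; lra.
Qed.

(** The feet come from [proximal_pair]. Then [t *: n] and [t' *: n'] differ by at most 3 times the
    distance of the ray points, hence so do their lengths [t] and [t']; together this gives 6 for
    the normals. *)
Lemma proximal_lipschitz c c' X z z' t t' : 0 < t -> 0 <= t' -> c * t + c' * t' <= 2^-1 ->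
  X (lsubmx z) -> X (lsubmx z') -> proximal c X z -> proximal c' X z' ->
  enorm (rsubmx z) = 1 -> enorm (rsubmx z') = 1 ->
  eucl_dist (lsubmx z) (lsubmx z') <= 2 * eucl_dist (ray_point t z) (ray_point t' z') /\
  t * eucl_dist (rsubmx z) (rsubmx z') <= 6 * eucl_dist (ray_point t z) (ray_point t' z').
Proof.
move=> t0 t'0 ct Xz Xz' pz pz' n1 n1'.
have h := proximal_pair (ltW t0) t'0 Xz Xz' pz pz'.
have hx : eucl_dist (lsubmx z) (lsubmx z') <= 2 * eucl_dist (ray_point t z) (ray_point t' z').
  have := eucl_dist_ge0 (lsubmx z) (lsubmx z').
  by move: (eucl_dist _ _) (eucl_dist _ _) h => a b; nra.
split => //; move: hx n1 n1'; rewrite /ray_point /eucl_dist.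
move: (lsubmx z) (lsubmx z') (rsubmx z) (rsubmx z') => x x' n n' hx n1 n1'.
set y := x + t *: n - _ in hx *.
have e1 : enorm (t *: n - t' *: n') <= 3 * enorm y.
  have -> : t *: n - t' *: n' = y - (x - x').
    by apply/rowP => i; rewrite !mxE; ring.
  by apply: le_trans (ler_enormD _ _) _; rewrite enormN; lra.
have e2 : `|t - t'| <= 3 * enorm y.
  apply: le_trans e1; have := ler_dist_enorm (t *: n) (t' *: n').
  by rewrite !enormZ n1 n1' !mulr1 (gtr0_norm t0) (ger0_norm t'0).
have -> : t * enorm (n - n') = enorm (t *: (n - n')) by rewrite enormZ gtr0_norm.
have -> : t *: (n - n') = (t *: n - t' *: n') - (t - t') *: n'.
  by apply/rowP => i; rewrite !mxE; ring.
apply: le_trans (ler_enormD _ _) _; rewrite enormN enormZ n1' mulr1; lra.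
Qed.

Lemma nearest_normal_bundle X y x : closed X -> nearest X y x -> y != x ->
  let z := row_mx x ((eucl_dist y x)^-1 *: (y - x)) in
  normal_bundle X z /\ proximal ((2 * eucl_dist y x)^-1) X z.
Proof.
move=> cX [Xx xn] yx z.
have t0 : 0 < eucl_dist y x by rewrite lt0r eucl_dist_eq0 yx eucl_dist_ge0.
have pz : proximal ((2 * eucl_dist y x)^-1) X z.
  move=> x' Xx'; rewrite /z row_mxKl row_mxKr dotZr invfM -mulrA mulrCA.
  rewrite ler_pM2l ?invr_gt0//.
  have : eucl_dist y x ^+ 2 <= eucl_dist y x' ^+ 2.
    by rewrite ler_pXn2r ?nnegrE ?eucl_dist_ge0// xn.
  rewrite !eucl_dist_sqr (_ : y - x' = (y - x) - (x' - x)); last first.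
    by apply/rowP => i; rewrite !mxE; ring.
  move: (y - x) (x' - x) => a b; rewrite !dotE (dotC a b); lra.
split => //; split; last exact: proximal_normal_cone pz.
- rewrite /z row_mxKl; split; first exact: subset_closure.
  move=> /interior_euclP[r r0 rX].
  pose s := Num.min (2^-1) (r / 2 / eucl_dist y x).
  have s0 : 0 < s by rewrite lt_min invr_gt0 ltr0n/= !divr_gt0.
  have s2 : s <= 2^-1 by rewrite /s ge_min lexx.
  have Xs : X (x + s *: (y - x)).
    apply: rX; rewrite /eucl_dist opprD addrA subrr sub0r enormN enormZ gtr0_norm//.
    apply: (@le_lt_trans _ _ (r / 2)); last lra.
    by rewrite -ler_pdivlMr// /s ge_min lexx orbT.
  have := xn _ Xs; rewrite {2}/eucl_dist (_ : y - _ = (1 - s) *: (y - x)); last first.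
    by apply/rowP => i; rewrite !mxE; ring.
  rewrite enormZ ger0_norm; last by lra.
  by rewrite -/(eucl_dist y x); nra.
- by rewrite /z row_mxKr /unit_sphere/= enormZ gtr0_norm ?invr_gt0// mulVf// gt_eqF.
Qed.

End Proximal.

(** * The complement of the parallel set near a cluster *)

Section SupportBundle.
Context {R : realType} {d : nat}.
Variables (K A : set 'rV[R]_d) (e : R).
Hypotheses (e_gt0 : 0 < e) (cK : compact K) (cA : compact A) (A_nonempty : A !=set0)
  (AK : A `<=` K) (gap : forall a k, A a -> K k -> ~ A k -> 3 * e <= eucl_dist a k).
Implicit Types (x y k n a : 'rV[R]_d) (z : 'rV[R]_(d + d)) (t : R).

Local Notation X := (closed_complement K e).

(* Outer unit normals of the convex hull of [A], attached at the points of
   [A + e n], with the orientation of the complement. *)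
Definition support_bundle : set 'rV[R]_(d + d) :=
  [set z | exists a n, [/\ A a, enorm n = 1, forall b, A b -> dot n b <= dot n a &
    z = row_mx (a + e *: n) (- n)]].

Let K_nonempty : K !=set0.
Proof. by case: A_nonempty => a /AK; exists a. Qed.

Lemma closed_complement_dist x k : X x -> K k -> e <= eucl_dist x k.
Proof.
move=> /closure_euclP Xx Kk; rewrite leNgt; apply/negP => xk.
have [|y] := Xx (e - eucl_dist x k); first by rewrite subr_gt0.
rewrite /parallel_set /= => /negP; rewrite -ltNge => ey xy.
have := dist_to_le y Kk; have := eucl_distD x y k; rewrite (eucl_distC y x); lra.
Qed.

Lemma closed_complement_in x : e < dist_to x K -> X x.
Proof. by move=> ex; apply: subset_closure => /=; apply/negP; rewrite -ltNge. Qed.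

Lemma closed_closed_complement : closed X.
Proof. exact: closed_closure. Qed.

Lemma boundary_nearest x : boundary X x ->
  X x /\ exists k, [/\ K k, eucl_dist x k = e & nearest K x k].
Proof.
move=> [cX nX]; have Xx : X x.
  by have := closed_closed_complement; rewrite /closed => /(_ _ cX).
split => //; have [k xk] := compact_nearest x cK K_nonempty.
exists k; split => //; first exact: (proj1 xk).
apply/eqP; rewrite eq_le (closed_complement_dist Xx (proj1 xk)) andbT.
rewrite leNgt; apply/negP => ek; apply: nX; apply/interior_euclP.
exists (eucl_dist x k - e); first by rewrite subr_gt0.
move=> y xy; apply: closed_complement_in.
by have := dist_toD x y K_nonempty; rewrite (dist_to_nearest xk); lra.
Qed.

(** The supporting half-space keeps the points of [A] away, the gap all other points of [K]:
    [3 * e - (e + s) >= e + s] because [s <= e / 2]. The factor 3 leaves this room beyond distance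
    [e]. *)
Lemma support_far a n s k : A a -> enorm n = 1 -> (forall b, A b -> dot n b <= dot n a) ->
  0 <= s <= e / 2 -> K k -> e + s <= eucl_dist (a + (e + s) *: n) k.
Proof.
move=> Aa n1 nA /andP[s0 se] Kk; have [Ak|Ak] := pselect (A k).
  have := cauchy_schwarz n (a + (e + s) *: n - k); rewrite n1 mul1r; apply: le_trans.
  by rewrite !dotE -enorm_sqr n1 expr1n mulr1; have := nA _ Ak; lra.
have := gap Aa Kk Ak; have := eucl_distD (a + (e + s) *: n) a k.
have -> : eucl_dist a (a + (e + s) *: n) = e + s; last by lra.
by rewrite /eucl_dist opprD addrA subrr sub0r enormN enormZ n1 mulr1 ger0_norm//; lra.
Qed.

(** The foot is a limit of the points of [support_far]. The constant belongs to the ball of radius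
    [e] about the center, whose interior [X] does not meet. *)
Lemma support_bundle_proximal z : support_bundle z ->
  X (lsubmx z) /\ proximal ((2 * e)^-1) X z.
Proof.
move=> [a [n [Aa n1 nA ->]]]; split.
  rewrite row_mxKl; apply/closure_euclP => r r0.
  pose s := Num.min (r / 2) (e / 2).
  have s0 : 0 < s by rewrite lt_min !divr_gt0.
  have sr : s <= r / 2 by rewrite /s ge_min lexx.
  have se : s <= e / 2 by rewrite /s ge_min lexx orbT.
  exists (a + (e + s) *: n).
    apply/negP; rewrite -ltNge; apply: (@lt_le_trans _ _ (e + s)); first lra.
    by apply: le_dist_to => // k Kk; apply: support_far; rewrite ?(ltW s0).
  rewrite /eucl_dist (_ : _ - _ = - (s *: n)); last by apply/rowP => i; rewrite !mxE; ring.
  by rewrite enormN enormZ n1 mulr1 gtr0_norm//; lra.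
move=> x Xx; rewrite row_mxKl row_mxKr dotNr.
have := closed_complement_dist Xx (AK Aa); rewrite ge_enorm ?(ltW e_gt0)// eucl_dist_sqr.
have -> : x - a = (x - (a + e *: n)) + e *: n by apply/rowP => i; rewrite !mxE; ring.
move: (x - _) => w; rewrite !dotE -(enorm_sqr n) n1 expr1n mulr1 (dotC n w) => h.
by rewrite ler_pdivlMl ?mulr_gt0//; lra.
Qed.

Lemma support_bundle_normal z : support_bundle z -> normal_bundle X z.
Proof.
move=> Pz; have [Xz pz] := support_bundle_proximal Pz.
split; last exact: proximal_normal_cone pz.
- split; first exact: subset_closure.
  move=> /interior_euclP[r r0 rX]; move: Pz rX => [a [n [Aa n1 nA ->]]]; rewrite row_mxKl => rX.
  pose s := Num.min (r / 2) (e / 2).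
  have s0 : 0 < s by rewrite lt_min !divr_gt0.
  have sr : s <= r / 2 by rewrite /s ge_min lexx.
  have se : s <= e / 2 by rewrite /s ge_min lexx orbT.
  have Xs : X (a + (e - s) *: n).
    apply: rX; rewrite /eucl_dist (_ : _ - _ = s *: n); last by apply/rowP => i; rewrite !mxE; ring.
    by rewrite enormZ n1 mulr1 gtr0_norm//; lra.
  have := closed_complement_dist Xs (AK Aa).
  rewrite /eucl_dist (_ : _ - _ = (e - s) *: n); last by apply/rowP => i; rewrite !mxE; ring.
  by rewrite enormZ n1 mulr1 ger0_norm; lra.
- by move: Pz => [a [n [_ n1 _ ->]]]; rewrite row_mxKr /unit_sphere/= enormN.
Qed.

Lemma support_bundle_center z : support_bundle z -> A (ray_point e z).
Proof.
move=> [a [n [Aa _ _ ->]]]; rewrite /ray_point row_mxKl row_mxKr.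
by rewrite scalerN addrK.
Qed.

(** Moving along [u] increases the distance to every nearest point of [K]. The points of [K] with
    [dot u (x - k) <= 0] form a compact set, hence are farther than [e] by a fixed [eta] and stay so
    during a short move. *)
Lemma tangent_cone_far x u : (exists2 k, K k & eucl_dist x k = e) ->
  (forall k, K k -> e <= eucl_dist x k) ->
  (forall k, K k -> eucl_dist x k = e -> 0 < dot u (x - k)) -> tangent_cone X x u.
Proof.
move=> [k0 Kk0 xk0] xK uk.
have [->|u0] := eqVneq u 0; first by left.
right => r r0.
have un : 0 < enorm u by rewrite enorm_gt0.
pose F := K `&` [set k | dot u (x - k) <= 0].
have cF : compact F.
  apply: compact_closedI => //; apply/closed_euclP => k kc /=.
  rewrite leNgt; apply/negP => p.
  have [|k' /= k'p kk'] := kc (dot u (x - k) / enorm u); first by rewrite divr_gt0.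
  have := cauchy_schwarz u (k' - k); move: kk' k'p p.
  rewrite ltr_pdivlMr// eucl_distC !dotBr -/(eucl_dist k' k); lra.
have [eta eta0 Feta] : exists2 eta, 0 < eta & forall k, F k -> e + eta <= eucl_dist x k.
  have [->|/set0P F0] := eqVneq F set0; first by exists 1.
  have [k [[Kk ku] kn]] := compact_nearest x cF F0.
  exists (eucl_dist x k - e).
    rewrite subr_gt0 lt_neqAle eq_sym xK// andbT; apply/eqP => /esym h.
    by have := uk _ Kk (esym h); rewrite ltNge ku.
  by move=> k' /kn; rewrite addrC subrK.
pose s := Num.min (r / 2 / enorm u) (eta / 2 / enorm u).
have s0 : 0 < s by rewrite lt_min !divr_gt0.
have su1 : s * enorm u <= r / 2 by rewrite -ler_pdivlMr// /s ge_min lexx.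
have su2 : s * enorm u <= eta / 2 by rewrite -ler_pdivlMr// /s ge_min lexx orbT.
exists (x + s *: u); have xsE : x + s *: u - x = s *: u by rewrite addrC addKr.
have xsn : eucl_dist (x + s *: u) x = s * enorm u.
  by rewrite /eucl_dist xsE enormZ gtr0_norm.
split.
- apply: closed_complement_in.
  have [k kn] := compact_nearest (x + s *: u) cK K_nonempty.
  rewrite (dist_to_nearest kn); have [Kk _] := kn.
  have [ku|ku] := leP (dot u (x - k)) 0.
    by have := Feta k (conj Kk ku); have := eucl_distD (x + s *: u) x k; rewrite (eucl_distC x (x + s *: u)) xsn; lra.
  rewrite -(ltr_pXn2r (_ : 0 < 2)%N) ?nnegrE ?eucl_dist_ge0 ?(ltW e_gt0)// eucl_dist_sqr.
  have := xK _ Kk; rewrite ge_enorm ?(ltW e_gt0)//.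
  have -> : x + s *: u - k = (x - k) + s *: u by rewrite addrAC.
  move: (x - k) ku => w ku h; rewrite !dotE (dotC w u).
  have := dot_ge0 u; have : 0 < s * dot u w by rewrite mulr_gt0.
  have : 0 <= s * (s * dot u u) by rewrite !mulr_ge0 ?dot_ge0 ?(ltW s0).
  lra.
- by rewrite xsn mulr_gt0//=; lra.
- rewrite xsE enormZ gtr0_norm// scalerA invfM mulrAC mulVf ?gt_eqF// mul1r.
  by rewrite eucl_distxx.
Qed.

(* Near [z] the complement stays proximally smooth: moving from [x'] towards
   another point of [X], corrected by the direction [n], increases the distance
   to every nearest point of [K], so it is a tangent direction. *)
Lemma normal_bundle_proximal z z' : support_bundle z -> normal_bundle X z' ->
  eucl_dist (lsubmx z) (lsubmx z') < e / 64 -> proximal (e^-1) X z'.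
Proof.
move=> [a [n [Aa n1 nA ->]]] [bx' n'1 nc]; rewrite row_mxKl.
rewrite /proximal; move: (lsubmx z') (rsubmx z') bx' n'1 nc => x' n' bx' n'1 nc xx'.
have [Xx' [k0 [Kk0 xk0 _]]] := boundary_nearest bx'.
(* By the gap, all nearest points of [x'] belong to [A] and so lie behind the supporting hyperplane.
   One direction [n] therefore leads away from all of them at a definite rate. *)
have kn k : K k -> eucl_dist x' k = e -> e / 2 <= dot n (x' - k).
  move=> Kk x'k; have [Ak|Ak] := pselect (A k); last first.
    exfalso; have := gap Aa Kk Ak.
    have := eucl_distD x' a k; have := eucl_distD (a + e *: n) a x'; rewrite x'k.
    have -> : eucl_dist a (a + e *: n) = e.
      by rewrite /eucl_dist opprD addrA subrr sub0r enormN enormZ n1 mulr1 gtr0_norm.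
    by have := e_gt0; lra.
  have -> : x' - k = (x' - (a + e *: n)) + (a - k) + e *: n.
    by apply/rowP => i; rewrite !mxE; ring.
  rewrite dotDr [dot n (_ + _)]dotDr [dot n (a - k)]dotBr dotZr -enorm_sqr n1 expr1n mulr1.
  have := nA _ Ak; have := cauchy_schwarz (- n) (x' - (a + e *: n)).
  rewrite dotNl enormN n1 mul1r -/(eucl_dist x' (a + e *: n)) (eucl_distC x').
  by have := e_gt0; lra.
move=> x'' Xx''; set w := x'' - x'.
(* Since [x''] too is at distance at least [e] from [k], the product of [w] with [x' - k] is at
   least [- eucl_dist x'' x' ^+ 2 / 2]. Adding [beta *: n], which contributes at least
   [beta * e / 2], makes it positive, at a cost of at most [beta] in the product with [n']. *)
have key beta : eucl_dist x'' x' ^+ 2 / e < beta -> dot w n' <= beta.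
  move=> wb.
  have b0 : 0 < beta by apply: le_lt_trans wb; rewrite divr_ge0 ?sqr_ge0 ?ltW.
  have Tu : tangent_cone X x' (w + beta *: n).
    apply: tangent_cone_far.
    - by exists k0.
    - by move=> k; exact: closed_complement_dist.
    - move=> k Kk x'k; rewrite dotDl dotZl.
      have := closed_complement_dist Xx'' Kk; rewrite ge_enorm ?(ltW e_gt0)//.
      rewrite (_ : x'' - k = w + (x' - k)); last by rewrite /w addrA subrK.
      have := kn _ Kk x'k; have : dot (x' - k) (x' - k) = e ^+ 2.
        by rewrite -eucl_dist_sqr x'k.
      move: wb; rewrite eucl_dist_sqr -/w ltr_pdivrMr//.
      move: (x' - k) => v h1 h2 h3; clearbody w; rewrite !dotE (dotC v w) h2 => h4.
      have : beta * (e / 2) <= beta * dot n v by rewrite ler_pM2l.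
      lra.
  have := nc _ Tu; rewrite dotDl dotZl.
  have := cauchy_schwarz (- n) n'; rewrite enormN n1 n'1 mulr1 dotNl => h.
  have : beta * - dot n n' <= beta * 1 by rewrite ler_pM2l.
  lra.
rewrite mulrC leNgt; apply/negP => wn.
have h : eucl_dist x'' x' ^+ 2 / e < (eucl_dist x'' x' ^+ 2 / e + dot w n') / 2 by lra.
by have := key _ h; lra.
Qed.

End SupportBundle.

(** * Nullity of the pairs with a moving center *)

Section IrregularCenters.
Context {R : realType} {d : nat}.
Variables (K A : set 'rV[R]_d) (e C : R).
Hypotheses (e_gt0 : 0 < e) (cK : compact K) (cA : compact A) (A_nonempty : A !=set0)
  (AK : A `<=` K) (gap : forall a k, A a -> K k -> ~ A k -> 3 * e <= eucl_dist a k)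
  (C_gt0 : 0 < C)
  (K_linked : forall tau x y, 0 < tau -> linked K tau x y -> eucl_dist x y <= C * tau).
Implicit Types (x y k n a : 'rV[R]_d) (z : 'rV[R]_(d + d)) (t : R).

Local Notation X := (closed_complement K e).
Local Notation P := (support_bundle A e).

Let PX z : P z -> X (lsubmx z). Proof. by move=> /(support_bundle_proximal e_gt0 A_nonempty AK gap)[]. Qed.

Let Pprox z : P z -> proximal e^-1 X z.
Proof.
move=> /(support_bundle_proximal e_gt0 A_nonempty AK gap)[_]; apply: proximal_le.
by rewrite lef_pV2 ?posrE ?mulr_gt0//; have := e_gt0; lra.
Qed.

Lemma support_bundle_unit z : P z -> enorm (rsubmx z) = 1.
Proof. by move=> [a [n [_ n1 _ ->]]]; rewrite row_mxKr enormN. Qed.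

Lemma normal_bundle_unit z : normal_bundle X z -> enorm (rsubmx z) = 1.
Proof. by case. Qed.

Lemma normal_bundle_in z : normal_bundle X z -> X (lsubmx z).
Proof. by move=> [/(boundary_nearest cK A_nonempty AK)[]]. Qed.

(** A ray point determines its pair. With [t >= e / 32] the factor 6 of [proximal_lipschitz] becomes
    [32 * 6 = 192] for [e] times the normals; the factor 2 of the feet still fits below 200. *)
Lemma center_lipschitz z z' t t' : e / 32 <= t -> 0 <= t' -> t + t' <= e / 2 ->
  X (lsubmx z) -> X (lsubmx z') -> proximal e^-1 X z -> proximal e^-1 X z' ->
  enorm (rsubmx z) = 1 -> enorm (rsubmx z') = 1 ->
  eucl_dist (ray_point e z) (ray_point e z') <=
    200 * eucl_dist (ray_point t z) (ray_point t' z') /\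
  eucl_dist z z' <= (2 + 200 / e) * eucl_dist (ray_point t z) (ray_point t' z').
Proof.
move=> te t'0 tt' Xz Xz' pz pz' n1 n1'.
have t0 : 0 < t by apply: lt_le_trans te; rewrite divr_gt0.
have h : e^-1 * t + e^-1 * t' <= 2^-1.
  by rewrite -mulrDr ler_pdivrMl//; lra.
have [h1 h2] := proximal_lipschitz t0 t'0 h Xz Xz' pz pz' n1 n1'.
have := eucl_dist_ge0 (rsubmx z) (rsubmx z').
have := eucl_dist_ge0 (ray_point t z) (ray_point t' z').
set Y := eucl_dist (ray_point t z) _ in h1 h2 *; set B := eucl_dist (rsubmx z) _ in h2 * => Y0 B0.
have eB : e * B <= 192 * Y.
  apply: (@le_trans _ _ (32 * (t * B))); last lra.
  by rewrite mulrA ler_wpM2r//; lra.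
split.
  apply: (@le_trans _ _ (eucl_dist (lsubmx z) (lsubmx z') + e * B)); last lra.
  rewrite {1}/eucl_dist /ray_point.
  have -> : lsubmx z + e *: rsubmx z - (lsubmx z' + e *: rsubmx z') =
      (lsubmx z - lsubmx z') + e *: (rsubmx z - rsubmx z').
    by rewrite scalerBr opprD addrACA.
  by apply: le_trans (ler_enormD _ _) _; rewrite enormZ gtr0_norm.
apply: le_trans (dist_row_le _ _) _; rewrite -/B mulrDl; apply: lerD => //.
have -> : 200 / e * Y = 200 * Y / e by rewrite mulrAC.
by rewrite ler_pdivlMr// mulrC; lra.
Qed.

(* The center map [z |-> ray_point e z] of the normal bundle does not have
   derivative 0 at [z]; elsewhere on [P] all the curvatures are [- e^-1]. *)
Definition irregular_center z := exists2 eps : R, 0 < eps & forall rho : R, 0 < rho ->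
  exists z', [/\ normal_bundle X z', eucl_dist z z' < rho &
    eps * eucl_dist z z' < eucl_dist (ray_point e z) (ray_point e z')].

(** The parameter stays away from 0, so that ray points control the normals, and small enough for
    two rays together to meet the bound [e / 2] of [center_lipschitz]. *)
Definition tube : set 'rV[R]_d :=
  [set y | exists z t, [/\ P z, e / 16 <= t <= e / 8 & y = ray_point t z]].

(* If [tube] were nearly dense on the segment joining [ray_point t z] to
   [ray_point t z'], the centers, which lie in [K], would form a fine chain. *)
Lemma irregular_center_hole z t : P z -> irregular_center z -> e / 16 <= t <= e / 8 ->
  exists2 c : R, 0 < c & forall rho : R, 0 < rho -> exists h s,
    [/\ 0 < s <= rho, eucl_dist h (ray_point t z) <= s &
        forall w, tube w -> c * s <= eucl_dist h w].
Proof.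
move=> Pz [eps eps0 irr] /andP[te1 te2].
have t0 : 0 < t by apply: lt_le_trans te1; rewrite divr_gt0.
(* Read off from the final estimate: a chain of step [600 * (c * s)] has diameter at most
   [600 * C * (c * s)], its ends are within [200 * (c * s)] of the two centers, and
   [s <= (1 + e) * eucl_dist z z']. With [c = eps / D] the centers would be too close. *)
pose D := (600 * C + 400) * (1 + e).
have e0 := e_gt0.
have D1 : 0 < 600 * C + 400 by have := C_gt0; lra.
have e1 : 0 < 1 + e by lra.
have D0 : 0 < D by exact: mulr_gt0 D1 e1.
have z200 : 0 < 200 :> R by rewrite ltr0n.
have z600 : 0 < 600 :> R by rewrite ltr0n.
have e32 : e / 32 <= e / 16 by lra.
have e16 : 0 <= e / 16 by lra.
have e8 : e / 8 + e / 8 <= e / 2 by lra.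
pose c := eps / D.
have c0 : 0 < c by rewrite divr_gt0.
exists c => // rho rho0.
(* The first bound yields [s <= rho], the second makes [z'] proximal. *)
have [|z' [Nz' zz' far]] := irr (Num.min (rho / (1 + e)) (e / 64)).
  by rewrite lt_min (divr_gt0 rho0 e1)/= divr_gt0// ltr0n.
move: zz'; rewrite lt_min => /andP[zz'1 zz'2].
have pz' : proximal e^-1 X z'.
  apply: (normal_bundle_proximal e_gt0 cK A_nonempty AK gap Pz Nz').
  exact: le_lt_trans (dist_lsubmx _ _) zz'2.
have Xz' := normal_bundle_in Nz'; have n1' := normal_bundle_unit Nz'.
pose y := ray_point t z; pose y' := ray_point t z'; pose s := eucl_dist y y'.
have sz : s <= (1 + e) * eucl_dist z z'.
  apply: le_trans (dist_ray_point z z' (ltW t0)) _.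
  by rewrite ler_wpM2r ?eucl_dist_ge0//; lra.
have te32 := le_trans e32 te1.
have tte := le_trans (lerD te2 te2) e8.
have [lip _] := center_lipschitz te32 (ltW t0) tte
  (PX Pz) Xz' (Pprox Pz) pz' (support_bundle_unit Pz) n1'.
have far0 : 0 < eucl_dist (ray_point e z) (ray_point e z').
  by apply: le_lt_trans far; rewrite mulr_ge0 ?eucl_dist_ge0 ?ltW.
have s0 : 0 < s by rewrite -(pmulr_rgt0 _ z200); exact: lt_le_trans far0 lip.
have srho : s <= rho.
  apply: le_trans sz _; by rewrite mulrC -(ler_pdivlMr _ _ e1) ltW.
apply: contrapT => nohole.
pose N := (Num.truncn c^-1).+1.
have N0 : 0 < N%:R :> R by rewrite ltr0n.
have Nc : N%:R^-1 <= c.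
  by rewrite invf_ple ?posrE// ltW// truncnS_gt.
(* The segment is divided into steps of at most [c * s]. As no [yi i] is the center of a hole of
   size [s], each has a point of [tube] within [c * s]. *)
pose yi (i : nat) := y + (i%:R / N%:R) *: (y' - y).
have near i : (i <= N)%N -> exists zt, [/\ P zt.1, e / 16 <= zt.2 <= e / 8 &
    eucl_dist (yi i) (ray_point zt.2 zt.1) < c * s].
  move=> iN; apply: contrapT => no; apply: nohole; exists (yi i), s; split.
  - by rewrite s0.
  - rewrite eucl_distC /eucl_dist /yi opprD addrA subrr sub0r enormN enormZ.
    rewrite ger0_norm ?divr_ge0// -/(eucl_dist y' y) eucl_distC -/s.
    by rewrite ler_piMl ?(ltW s0)// ler_pdivrMr// mul1r ler_nat.
  - move=> w [zw [tw [Pw tw1 ->]]]; rewrite leNgt; apply/negP => lt.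
    by apply: no; exists (zw, tw).
have [f fP] : {f : nat -> 'rV[R]_(d + d) * R & forall i, (i <= N)%N -> [/\ P (f i).1,
    e / 16 <= (f i).2 <= e / 8 & eucl_dist (yi i) (ray_point (f i).2 (f i).1) < c * s]}.
  apply: (@choice _ _ (fun i (zt : 'rV[R]_(d + d) * R) => (i <= N)%N -> [/\ P zt.1,
    e / 16 <= zt.2 <= e / 8 & eucl_dist (yi i) (ray_point zt.2 zt.1) < c * s])) => i.
  by have [/near[zt ztP]|_] := leqP i N; [exists zt|exists (0, 0)].
(* Consecutive tube points are within [3 * (c * s)] of each other, so by [center_lipschitz] their
   centers form a chain of step [600 * (c * s)]. *)
pose q i := ray_point e (f i).1.
have qK i : (i <= N)%N -> K (q i).
  by move=> iN; have [Pf _ _] := fP i iN; apply: AK; exact: support_bundle_center Pf.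
have lipW z1 t1 i : X (lsubmx z1) -> proximal e^-1 X z1 -> enorm (rsubmx z1) = 1 ->
    e / 16 <= t1 <= e / 8 -> (i <= N)%N ->
    eucl_dist (ray_point e z1) (q i) <= 200 * (eucl_dist (ray_point t1 z1) (yi i) + c * s).
  move=> Xz1 pz1 n1 /andP[t1a t1b] iN; have [Pf /andP[ta tb] near_i] := fP i iN.
  have t132 := le_trans e32 t1a; have f0 := le_trans e16 ta.
  have tf2 := le_trans (lerD t1b tb) e8.
  have [h _] := center_lipschitz t132 f0 tf2 Xz1 (PX Pf) pz1 (Pprox Pf) n1 (support_bundle_unit Pf).
  apply: le_trans h _; rewrite (ler_pM2l z200).
  by apply: le_trans (eucl_distD (yi i) _ _) _; rewrite lerD2l ltW.
have step i : (i < N)%N -> eucl_dist (q i) (q i.+1) <= 600 * (c * s).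
  move=> iN; have [Pf tf near_i] := fP i (ltnW iN).
  apply: le_trans (lipW (f i).1 (f i).2 i.+1 (PX Pf) (Pprox Pf) (support_bundle_unit Pf) tf iN) _.
  have y1 : eucl_dist (yi i) (yi i.+1) <= c * s.
    have -> : eucl_dist (yi i) (yi i.+1) = N%:R^-1 * s; last by rewrite ler_pM2r.
    rewrite eucl_distC /eucl_dist (_ : _ - _ = N%:R^-1 *: (y' - y)); last first.
      by apply/rowP => j; rewrite !mxE -natr1; field; rewrite gt_eqF.
    by rewrite enormZ gtr0_norm ?invr_gt0// /s eucl_distC.
  have y2 := eucl_distD (yi i) (ray_point (f i).2 (f i).1) (yi i.+1).
  have -> : 600 * (c * s) = 200 * (c * s + c * s + c * s) by ring.
  rewrite (ler_pM2l z200) lerD2r; apply: le_trans y2 _; apply: lerD => //.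
  by rewrite eucl_distC ltW.
have chain : linked K (600 * (c * s)) (q 0%N) (q N) by exists N, q.
have cs0 : 0 < c * s by rewrite mulr_gt0.
have cs600 := mulr_gt0 z600 cs0.
have d1 := K_linked cs600 chain.
have tt : e / 16 <= t <= e / 8 by rewrite te1.
have d2 : eucl_dist (ray_point e z) (q 0%N) <= 200 * (c * s).
  apply: le_trans (lipW z t 0%N (PX Pz) (Pprox Pz) (support_bundle_unit Pz) tt (leq0n N)) _.
  by rewrite /yi mul0r scale0r addr0 eucl_distxx add0r.
have d3 : eucl_dist (ray_point e z') (q N) <= 200 * (c * s).
  apply: le_trans (lipW z' t N Xz' pz' n1' tt (leqnn N)) _.
  have -> : yi N = y' by rewrite /yi mulfV ?gt_eqF// scale1r [LHS]addrC subrK.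
  by rewrite eucl_distxx add0r.
have := eucl_distD (q 0%N) (ray_point e z) (ray_point e z').
have := eucl_distD (q N) (q 0%N) (ray_point e z'); rewrite (eucl_distC (q N)).
have fin : (600 * C + 400) * (c * s) <= eps * eucl_dist z z'.
  rewrite mulrCA; apply: (@le_trans _ _ (c * (D * eucl_dist z z'))).
    by rewrite (ler_pM2l c0) /D -mulrA (ler_pM2l D1).
  by rewrite /c mulrA mulfVK// gt_eqF.
move: far fin d1 d2 d3; clear; move: (c * s) => cs; lra.
Qed.

(** [X] stays at distance [e] from the center, so the distance to [X] is exactly the parameter along
    the ray. Its level sets therefore cut all the rays of [P] at the same [t]. *)
Lemma dist_to_ray_point z t : P z -> 0 <= t <= e -> dist_to (ray_point t z) X = t.
Proof.
move=> Pz /andP[t0 te]; have n1 := support_bundle_unit Pz.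
have yx : eucl_dist (ray_point t z) (lsubmx z) = t.
  by rewrite /eucl_dist /ray_point addrC addKr enormZ n1 mulr1 ger0_norm.
rewrite -[RHS]yx; apply: dist_to_nearest; split; first exact: PX.
move=> x Xx; rewrite yx.
have Aa := support_bundle_center Pz.
have := closed_complement_dist Xx (AK Aa).
have := eucl_distD (ray_point t z) x (ray_point e z).
have -> : eucl_dist (ray_point t z) (ray_point e z) = e - t.
  rewrite eucl_distC /eucl_dist /ray_point opprD addrACA subrr add0r -scalerBl.
  by rewrite enormZ n1 mulr1 ger0_norm// subr_ge0.
rewrite (eucl_distC x (ray_point t z)); lra.
Qed.

Lemma irregular_center_null : (0 < d)%N ->
  hausdorff d.-1 (P `&` irregular_center) = 0%E.
Proof.
move=> d0; have e0 := e_gt0.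
have [->|/set0P[z0 [Pz0 _]]] := eqVneq (P `&` irregular_center) set0; first exact: hausdorff0.
have Xne : X !=set0 by exists (lsubmx z0); exact: PX.
pose E := [set y | exists z t, [/\ P z, irregular_center z, e / 16 <= t <= e / 8 & y = ray_point t z]].
have [closedA [M AM]] := (compact_closed_bounded A).1 cA.
have E0 : hausdorff d E = 0%E.
  apply: (@porous_null _ _ tube E (M + 2 * e)).
  - by move=> y [z [t [Pz _ te ->]]]; exists z, t.
  - move=> y [z [t [Pz _ /andP[t1 t2] ->]]]; move: Pz => [a [n [Aa n1 _ ->]]].
    rewrite /ray_point row_mxKl row_mxKr scalerN -addrA -scalerBl.
    apply: le_trans (ler_enormD _ _) _; rewrite enormZ n1 mulr1 ger0_norm; last lra.
    by have := AM _ Aa; lra.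
  - by move=> y [z [t [Pz Iz te ->]]]; exact: irregular_center_hole.
have {}E0 : hausdorff d.-1.+1 E = 0%E by rewrite prednK.
have tauL x y : E x -> E y -> `|dist_to x X - dist_to y X| <= eucl_dist x y.
  move=> _ _; rewrite ler_norml; have := dist_toD x y Xne; have := dist_toD y x Xne.
  by rewrite (eucl_distC y); move=> *; apply/andP; split; lra.
have lt16 : e / 16 < e / 8 by lra.
have [t /andP[t1 t2] Et] := hausdorff_null_slice tauL E0 lt16.
pose G := E `&` [set y | dist_to y X = t].
(* The inverse of [ray_point t] on the slice; it is Lipschitz by [center_lipschitz], both parameters
   being [t]. *)
pose g y := xget 0 [set z | (P `&` irregular_center) z /\ ray_point t z = y].
have te : 0 <= t <= e by apply/andP; split; lra.
have gP y : G y -> (P `&` irregular_center) (g y) /\ ray_point t (g y) = y.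
  move=> [[z [t' [Pz Iz /andP[ta tb] yE]]] yt].
  apply: (xgetPex 0 (P := [set z | (P `&` irregular_center) z /\ ray_point t z = y])).
  exists z; split => //; rewrite -yt yE dist_to_ray_point//; apply/andP; split; lra.
have te32 : e / 32 <= t by lra.
have t0 : 0 <= t by lra.
have tte : t + t <= e / 2 by lra.
have lip z z' : P z -> P z' -> eucl_dist z z' <= (2 + 200 / e) * eucl_dist (ray_point t z) (ray_point t z').
  move=> Pz Pz'; have [_] := center_lipschitz te32 t0 tte (PX Pz) (PX Pz') (Pprox Pz) (Pprox Pz')
    (support_bundle_unit Pz) (support_bundle_unit Pz'); exact.
have BG : P `&` irregular_center `<=` g @` G.
  move=> z [Pz Iz].
  have Gy : G (ray_point t z).
    split; last exact: dist_to_ray_point.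
    by exists z, t; split => //; apply/andP; split; lra.
  exists (ray_point t z) => //; apply/eqP; rewrite -eucl_dist_eq0 eq_le eucl_dist_ge0 andbT.
  have [[Pg _] gy] := gP _ Gy; apply: le_trans (lip _ _ Pg Pz) _.
  by rewrite gy eucl_distxx mulr0.
apply/eqP; rewrite eq_le hausdorff_ge0 andbT.
apply: le_trans (le_hausdorff d.-1 BG) _.
have L0 : 0 < 2 + 200 / e by rewrite addr_gt0 ?divr_gt0 ?ltr0n ?e_gt0.
apply: le_trans (hausdorff_lipschitz d.-1 L0 _) _.
  move=> y y' Gy Gy'; have [[Pg _] gy] := gP _ Gy; have [[Pg' _] gy'] := gP _ Gy'.
  by rewrite -{2}gy -{2}gy'; exact: lip.
by rewrite Et mule0.
Qed.

End IrregularCenters.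

(** * Curvature of the support bundle of a cluster *)

Section OrthonormalComplement.
Context {R : realType} {p : nat}.
Implicit Types (u v w nu : 'rV[R]_p.+1).

Lemma dot_delta w j : dot w (delta_mx 0 j) = w 0 j.
Proof.
rewrite /dot (bigD1 j)//= mxE !eqxx mulr1 big1 ?addr0// => i ij.
by rewrite mxE (negbTE ij) andbF mulr0.
Qed.

Lemma dot_suml (I : finType) (c : I -> R) (a : I -> 'rV[R]_p.+1) w :
  dot (\sum_i c i *: a i) w = \sum_i c i * dot (a i) w.
Proof.
elim/big_rec2: _ => [|i x y _ <-]; first by rewrite dot0l.
by rewrite dotDl dotZl.
Qed.

(** Provides principal directions at a point where all curvatures agree: any orthonormal basis of
    the hyperplane orthogonal to the normal will do. *)
Lemma orthonormal_complement nu : enorm nu = 1 ->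
  exists a : 'I_p -> 'rV[R]_p.+1, [/\ Defs.orthonormal a, forall i, dot (a i) nu = 0 &
    forall w, dot w nu = 0 -> w = \sum_i dot w (a i) *: a i].
Proof.
move=> nu1; pose e0 : 'rV[R]_p.+1 := delta_mx 0 ord0.
have ee : dot e0 e0 = 1 by rewrite dot_delta mxE !eqxx.
have nn : dot nu nu = 1 by rewrite -enorm_sqr nu1 expr1n.
(* A Householder reflection exchanging [e0] and [nu]. *)
have [H [Hdot HK He0 HD]] : exists H : 'rV[R]_p.+1 -> 'rV[R]_p.+1,
    [/\ forall x y, dot (H x) (H y) = dot x y, forall x, H (H x) = x, H e0 = nu &
        forall (c : 'I_p.+1 -> R) (f : 'I_p.+1 -> 'rV[R]_p.+1),
          H (\sum_i c i *: f i) = \sum_i c i *: H (f i)].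
  have [->|ne] := eqVneq nu e0; first by exists id.
  have [v vE] : exists v, v = nu - e0 by exists (nu - e0).
  have q0 : dot v v != 0 by rewrite dot_eq0 vE subr_eq0.
  have qE : dot v v = 2 - 2 * dot nu e0.
    by rewrite vE dotDl !dotDr !dotNl !dotNr nn ee (dotC e0); lra.
  have ev : dot e0 v = dot nu e0 - 1 by rewrite vE dotDr dotNr ee dotC.
  exists (fun x => x - (2 * dot x v / dot v v) *: v); split.
  - move=> x y; rewrite dotDl !dotDr !dotNl !dotNr !dotZl !dotZr (dotC v y).
    by field.
  - move=> x; rewrite dotBl dotZl -addrA -opprD -scalerDl.
    rewrite (_ : 2 * dot x v / dot v v +
      2 * (dot x v - 2 * dot x v / dot v v * dot v v) / dot v v = 0); last by field.
    by rewrite scale0r subr0.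
  - rewrite ev (_ : _ / _ = -1); last first.
      by apply: (mulIf q0); rewrite divfK// qE; ring.
    by rewrite scaleN1r opprK vE addrC subrK.
  - move=> c f; rewrite dot_suml.
    rewrite [RHS](eq_bigr (fun i => c i *: f i - (2 * (c i * dot (f i) v) / dot v v) *: v)); last first.
      by move=> i _; rewrite scalerBr scalerA; congr (_ - _ *: _); ring.
    by rewrite sumrB -scaler_suml -mulr_suml -mulr_sumr.
pose a i := H (delta_mx 0 (lift ord0 i)).
have Hw w : dot w nu = 0 -> H w = \sum_i dot w (a i) *: delta_mx 0 (lift ord0 i).
  move=> w0; rewrite {1}[H w]row_sum_delta big_ord_recl.
  have -> : H w 0 ord0 = 0 by rewrite -dot_delta -/e0 -[e0]HK Hdot He0.
  rewrite scale0r add0r; apply: eq_bigr => i _.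
  by rewrite -dot_delta -[delta_mx _ _]HK Hdot.
exists a; split.
- move=> i j; rewrite /a Hdot dot_delta mxE /=.
  by rewrite eq_sym (inj_eq (@lift_inj _ ord0)).
- by move=> i; rewrite /a -He0 Hdot dot_delta mxE.
- move=> w /Hw w0; rewrite -[LHS]HK w0.
  pose c (i : 'I_p.+1) := if unlift ord0 i is Some j then dot w (a j) else 0.
  have -> : \sum_i dot w (a i) *: delta_mx 0 (lift ord0 i) = \sum_i c i *: delta_mx 0 i :> 'rV[R]_p.+1.
    rewrite big_ord_recl /c unlift_none scale0r add0r.
    by apply: eq_bigr => i _; rewrite liftK.
  rewrite HD big_ord_recl /c unlift_none scale0r add0r.
  by apply: eq_bigr => i _; rewrite liftK.
Qed.

End OrthonormalComplement.

Lemma sum_row_mx (R : realType) d m (c : 'I_m -> R) (f g : 'I_m -> 'rV[R]_d) :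
  \sum_i c i *: row_mx (f i) (g i) = row_mx (\sum_i c i *: f i) (\sum_i c i *: g i).
Proof.
elim/big_rec3: _ => [|i x y z _ ->]; first by rewrite row_mx0.
by rewrite scale_row_mx add_row_mx.
Qed.

Lemma dist_normalized (R : realType) n (a b : 'rV[R]_n) : a != 0 -> b != 0 ->
  eucl_dist ((enorm a)^-1 *: a) ((enorm b)^-1 *: b) <= 2 * enorm (a - b) / enorm b.
Proof.
rewrite -!enorm_gt0 => a0 b0.
have -> : eucl_dist ((enorm a)^-1 *: a) ((enorm b)^-1 *: b) =
    enorm ((enorm b)^-1 *: (a - b) + ((enorm a)^-1 - (enorm b)^-1) *: a).
  by rewrite /eucl_dist; congr enorm; apply/rowP => i; rewrite !mxE; ring.
apply: le_trans (ler_enormD _ _) _; rewrite !enormZ gtr0_norm ?invr_gt0//.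
have -> : `|(enorm a)^-1 - (enorm b)^-1| * enorm a = (enorm b)^-1 * `|enorm a - enorm b|.
  transitivity `|((enorm a)^-1 - (enorm b)^-1) * enorm a|; first by rewrite normrM (gtr0_norm a0).
  rewrite (_ : _ * _ = (enorm b)^-1 * (enorm b - enorm a)); last by field; rewrite !gt_eqF.
  by rewrite normrM gtr0_norm ?invr_gt0// distrC.
have := ler_dist_enorm a b; move=> /(ler_wpM2l (_ : 0 <= (enorm b)^-1)).
rewrite invr_ge0 enorm_ge0 => /(_ isT); rewrite [_ / enorm b]mulrC; lra.
Qed.

(** * Tangent cone and curvatures at the pairs with a stationary center *)

Section RegularCenters.
Context {R : realType} {p : nat}.
Let d := p.+1.
Variables (K A : set 'rV[R]_d) (e : R).
Hypotheses (e_gt0 : 0 < e) (cK : compact K) (cA : compact A) (A_nonempty : A !=set0)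
  (AK : A `<=` K) (gap : forall a k, A a -> K k -> ~ A k -> 3 * e <= eucl_dist a k).
Implicit Types (x y k n a w : 'rV[R]_d) (z : 'rV[R]_(d + d)) (t : R).

Local Notation X := (closed_complement K e).
Local Notation P := (support_bundle A e).

Let regular_center z (eps : R) : ~ irregular_center K e z -> 0 < eps ->
  exists2 rho : R, 0 < rho & forall z', normal_bundle X z' -> eucl_dist z z' < rho ->
    eucl_dist (ray_point e z) (ray_point e z') <= eps * eucl_dist z z'.
Proof.
move=> reg eps0; apply: contrapT => no; apply: reg; exists eps => // rho rho0.
apply: contrapT => no'; apply: no; exists rho => // z' Nz' zz'.
rewrite leNgt; apply/negP => far; apply: no'; by exists z'.
Qed.

Lemma ray_pointB t z z' : ray_point t (z - z') = ray_point t z - ray_point t z'.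
Proof. by rewrite /ray_point lsubmxB rsubmxB scalerBr opprD addrACA. Qed.

Lemma ray_pointZ t c z : ray_point t (c *: z) = c *: ray_point t z.
Proof. by apply/rowP => i; rewrite !mxE; ring. Qed.

Lemma enorm_ray_point t z : 0 <= t -> enorm (ray_point t z) <= (1 + t) * enorm z.
Proof.
move=> t0; have := dist_ray_point z 0 t0; rewrite /eucl_dist !subr0.
by rewrite [ray_point t 0](_ : _ = 0) ?subr0//; apply/rowP => i; rewrite !mxE; ring.
Qed.

(** Unit normals vary orthogonally to themselves up to a term of second order. *)
Lemma unit_dot_diff (nu nu' : 'rV[R]_d) : enorm nu = 1 -> enorm nu' = 1 ->
  dot (nu' - nu) nu = - (eucl_dist nu nu' ^+ 2 / 2).
Proof.
move=> n1 n1'; rewrite eucl_dist_sqr !dotE (dotC nu' nu) -!enorm_sqr n1 n1'; lra.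
Qed.

(** A secant direction [W] of the normal bundle close to the unit vector [V] of [U] moves the center
    by a small multiple of its length, and its second half is nearly orthogonal to the normal. In
    the limit [ray_point e V = 0], which says that the first half is [- e] times the second. *)
Lemma regular_tangent_cone_sub z U : P z -> ~ irregular_center K e z ->
  tangent_cone (normal_bundle X) z U ->
  exists2 w, dot w (rsubmx z) = 0 & U = row_mx (- e *: w) w.
Proof.
move=> Pz reg UT.
have [->|U0] := eqVneq U 0.
  exists 0; first by rewrite dot0l.
  by rewrite scaler0 row_mx0.
case: UT => [/eqP|UT]; first by rewrite (negbTE U0).
have Un : 0 < enorm U by rewrite enorm_gt0.
pose V := (enorm U)^-1 *: U.
have n1 := support_bundle_unit Pz.
have key eps : 0 < eps -> enorm (ray_point e V) <= (2 + e) * eps /\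
    `|dot (rsubmx V) (rsubmx z)| <= 2 * eps.
  move=> eps0; have [rho rho0 reg'] := regular_center reg eps0.
  have [|z' [Nz' /andP[zz0 zz'] dir]] := UT (Num.min rho eps); first by rewrite lt_min rho0.
  move: zz' dir; rewrite !lt_min => /andP[zz1 zz2] /andP[_ dir].
  set D := z' - z in dir; set W := (enorm D)^-1 *: D in dir.
  have D0 : 0 < enorm D := zz0.
  have VW : enorm (V - W) <= eps by rewrite -/(eucl_dist V W) eucl_distC ltW.
  have Wc : enorm (ray_point e W) <= eps.
    rewrite ray_pointZ enormZ gtr0_norm ?invr_gt0// mulrC ler_pdivrMr// ray_pointB.
    have := reg' z' Nz'; rewrite (eucl_distC z) => /(_ zz1).
    by rewrite (eucl_distC (ray_point e z)).
  have Wn : `|dot (rsubmx W) (rsubmx z)| <= eps.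
    have -> : rsubmx W = (enorm D)^-1 *: (rsubmx z' - rsubmx z).
      by apply/rowP => i; rewrite !mxE.
    rewrite dotZl unit_dot_diff ?(normal_bundle_unit Nz')// normrM gtr0_norm ?invr_gt0//.
    rewrite normrN ger0_norm ?divr_ge0 ?sqr_ge0// mulrC ler_pdivrMr//.
    have := dist_rsubmx z z'; have := eucl_dist_ge0 (rsubmx z) (rsubmx z').
    rewrite (eucl_distC z) -/(enorm D) /eucl_dist -/D in zz2 *.
    by nra.
  have VE : V = (V - W) + W by rewrite subrK.
  split.
    rewrite -[V](subrK W) -[_ - W + W]opprK -[X in ray_point e X]opprK !opprK.
    have -> : ray_point e (V - W + W) = ray_point e (V - W) + ray_point e W.
      by rewrite ray_pointB subrK subrK.
    apply: le_trans (ler_enormD _ _) _.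
    have := enorm_ray_point (V - W) (ltW e_gt0).
    have : (1 + e) * enorm (V - W) <= (1 + e) * eps by rewrite ler_pM2l// addr_gt0.
    lra.
  have -> : dot (rsubmx V) (rsubmx z) = dot (rsubmx (V - W)) (rsubmx z) + dot (rsubmx W) (rsubmx z).
    by rewrite rsubmxB -dotDl subrK.
  apply: le_trans (ler_normD _ _) _.
  suff : `|dot (rsubmx (V - W)) (rsubmx z)| <= eps by lra.
  apply: le_trans VW; apply: le_trans (enorm_rsubmx _).
  rewrite ler_norml; have := cauchy_schwarz (rsubmx (V - W)) (rsubmx z).
  have := cauchy_schwarz (- rsubmx (V - W)) (rsubmx z).
  by rewrite enormN dotNl n1 mulr1 => *; apply/andP; split; lra.
have small (c x : R) : 0 < c -> (forall eps, 0 < eps -> x <= c * eps) -> x <= 0.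
  move=> c0 h; rewrite leNgt; apply/negP => x0.
  have := h (x / (2 * c)); rewrite divr_gt0 ?mulr_gt0// => /(_ isT).
  have -> : c * (x / (2 * c)) = x / 2 by field; rewrite gt_eqF.
  by lra.
have V1 : ray_point e V = 0.
  apply/eqP; rewrite -enorm_eq0 eq_le enorm_ge0 andbT.
  by apply: (small (2 + e)) => [|eps /key[]//]; have := e_gt0; lra.
have V2 : dot (rsubmx V) (rsubmx z) = 0.
  apply/eqP; rewrite -normr_eq0 eq_le normr_ge0 andbT.
  by apply: (small 2) => // eps /key[].
exists (rsubmx U).
  move: V2; rewrite (_ : rsubmx V = (enorm U)^-1 *: rsubmx U); last first.
    by apply/rowP => i; rewrite !mxE.
  by rewrite dotZl => /eqP; rewrite mulf_eq0 invr_eq0 (gt_eqF Un) => /eqP.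
rewrite -[LHS]hsubmxK; congr row_mx.
move: V1; rewrite ray_pointZ => /eqP; rewrite scaler_eq0 invr_eq0 (gt_eqF Un)/=.
by rewrite /ray_point addr_eq0 => /eqP ->; rewrite scaleNr.
Qed.

(** Tangency has to be witnessed by actual pairs. The ray point [y] is moved by [- s *: w], and the
    nearest point of [X] gives a pair [zs] with ray point [ys]. As the center hardly moves, this
    displacement is almost entirely due to the normal, which changes by about [la *: w]. *)
Lemma regular_tangent_cone_sup z w : P z -> ~ irregular_center K e z ->
  dot w (rsubmx z) = 0 -> tangent_cone (normal_bundle X) z (row_mx (- e *: w) w).
Proof.
move=> Pz reg wz; have e0 := e_gt0.
have [->|w0] := eqVneq w 0; first by left; rewrite scaler0 row_mx0.
right => r r0.
have [Xz pz2] := support_bundle_proximal e_gt0 A_nonempty AK gap Pz.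
have pz : proximal e^-1 X z.
  by apply: proximal_le pz2; rewrite lef_pV2 ?posrE ?mulr_gt0//; lra.
have n1 := support_bundle_unit Pz.
pose om := enorm w; have om0 : 0 < om by rewrite enorm_gt0.
pose L := 2 + 200 / e.
have L0 : 0 < L by rewrite addr_gt0 ?divr_gt0 ?ltr0n ?e0.
pose Q := 1 + 4 * (1 + e) / e.
have Q0 : 0 < Q by rewrite ltr_pwDl// divr_ge0 ?(ltW e0)//; lra.
pose r1 := Num.min r 1.
have r10 : 0 < r1 by rewrite lt_min r0/=.
have r1r : r1 <= r by rewrite /r1 ge_min lexx.
have r11 : r1 <= 1 by rewrite /r1 ge_min lexx orbT.
pose eps := r1 / (8 * e * L * Q).
have eps0 : 0 < eps by rewrite divr_gt0// !mulr_gt0.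
have [rho rho0 reg'] := regular_center reg eps0.
(* The length of the displacement. In order, the bounds keep [ts] between [e / 32] and [e / 8] and
   [zs] close enough to be proximal, bring [zs] within [rho] of [z], bring it within [r], and make
   the quadratic error at most the other half. *)
pose m := Num.min (Num.min (e / 256) (rho / (2 * L))) (Num.min (r1 / (2 * L)) (r1 / (8 * e * (1 + e) * L ^+ 2))).
have m0 : 0 < m.
  have e1 : 0 < 1 + e by rewrite addr_gt0.
  rewrite !lt_min; apply/andP; split; apply/andP; split.
  - by rewrite divr_gt0 ?ltr0n ?e0.
  - by rewrite divr_gt0 ?mulr_gt0.
  - by rewrite divr_gt0 ?mulr_gt0.
  - by rewrite divr_gt0 ?mulr_gt0 ?exprn_gt0.
pose s := m / om; have s0 : 0 < s by rewrite divr_gt0.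
have so : s * om = m by rewrite /s divfK// gt_eqF.
have m1 : m <= e / 256 by rewrite /m !ge_min lexx.
have m2 : L * m < rho.
  apply: (@le_lt_trans _ _ (rho / 2)); last lra.
  rewrite mulrC -ler_pdivlMr// -mulrA -invfM; by rewrite /m !ge_min lexx ?orbT.
have m3 : L * m < r1.
  apply: (@le_lt_trans _ _ (r1 / 2)); last lra.
  rewrite mulrC -ler_pdivlMr// -mulrA -invfM; by rewrite /m !ge_min lexx ?orbT.
have m4 : (1 + e) * L ^+ 2 * m <= r1 / (8 * e).
  rewrite mulrC -ler_pdivlMr ?mulr_gt0 ?exprn_gt0//; last lra.
  by rewrite -mulrA -invfM mulrA /m !ge_min lexx ?orbT.
pose t := e / 16.
have te : 0 <= t <= e by rewrite /t; apply/andP; split; lra.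
pose y := ray_point t z; pose ys := y - s *: w.
have yys : eucl_dist y ys = m.
  by rewrite /eucl_dist /ys opprB addrC subrK enormZ gtr0_norm// so.
have Xne : X !=set0 by exists (lsubmx z).
have cX : closed X by exact: closed_closed_complement.
have [xs xsn] := closed_nearest ys cX Xne.
pose ts := eucl_dist ys xs.
have tst : `|ts - t| <= m.
  have <- : dist_to y X = t by exact: (dist_to_ray_point e_gt0 A_nonempty AK gap Pz te).
  rewrite /ts -(dist_to_nearest xsn) ler_norml.
  have := dist_toD y ys Xne; have := dist_toD ys y Xne; rewrite (eucl_distC ys) yys.
  by clear=> *; apply/andP; split; lra.
move: (tst); rewrite ler_norml => /andP[ts1 ts2].
have ts32 : e / 32 <= ts by move: ts1 m1; rewrite /t; lra.
have ts8 : ts <= e / 8 by move: ts2 m1; rewrite /t; lra.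
have ts0 : 0 < ts by apply: lt_le_trans ts32; rewrite divr_gt0.
have ysx : ys != xs by rewrite -eucl_dist_eq0 gt_eqF.
have [] := nearest_normal_bundle cX xsn ysx; rewrite -/ts.
set zs := row_mx xs _ => Nzs pzs2.
have ysE : ys = ray_point ts zs.
  by rewrite /ray_point row_mxKl row_mxKr scalerA mulfV ?gt_eqF// scale1r addrC subrK.
have Xzs : X (lsubmx zs) by rewrite row_mxKl; case: xsn.
have xx : eucl_dist (lsubmx z) (lsubmx zs) < e / 64.
  have := proximal_pair (proj1 (andP te)) (ltW ts0) Xz Xzs pz2 pzs2.
  have -> : (2 * e)^-1 * t = 32^-1 by rewrite /t; field; rewrite gt_eqF.
  have -> : (2 * ts)^-1 * ts = 2^-1 by field; rewrite gt_eqF.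
  rewrite -/y -ysE yys.
  by move: (eucl_dist _ _) => D; lra.
have pzs := normal_bundle_proximal e_gt0 cK A_nonempty AK gap Pz Nzs xx.
have ns1 := normal_bundle_unit Nzs.
have t32 : e / 32 <= t by rewrite /t; lra.
have tts : t + ts <= e / 2 by rewrite /t; lra.
have [_] := center_lipschitz e_gt0 t32 (ltW ts0) tts Xz Xzs pz pzs n1 ns1.
rewrite -/y -ysE yys -/L => zzs.
have kap := reg' _ Nzs (le_lt_trans zzs m2).
pose D := zs - z; pose dn := rsubmx zs - rsubmx z; pose ka := ray_point e zs - ray_point e z.
have D1 : enorm D <= L * m by rewrite -/(eucl_dist zs z) eucl_distC.
have ka1 : enorm ka <= eps * (L * m).
  rewrite -/(eucl_dist (ray_point e zs) _) eucl_distC; apply: le_trans kap _.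
  by rewrite ler_pM2l.
have dn1 : enorm dn <= L * m by apply: le_trans D1; rewrite /dn -rsubmxB enorm_rsubmx.
(* A ray point is the center minus [e - ts] times the normal. Comparing the two ray points expresses
   the change [dn] of the normal by [w], the small motion [ka] of the center and the change of
   parameter. *)
have eq1 : (e - ts) *: dn = s *: w + ka + (ts - t) *: rsubmx z.
  have : ray_point ts zs = ray_point t z - s *: w by rewrite -ysE.
  rewrite /dn /ka /ray_point => /eqP; rewrite -subr_eq0 => /eqP h.
  apply/eqP; rewrite -subr_eq0; apply/eqP; rewrite -[RHS]oppr0 -h.
  by apply/rowP => i; rewrite !mxE; ring.
have dnn : dot dn (rsubmx z) = - (enorm dn ^+ 2 / 2).
  by rewrite /dn unit_dot_diff// eucl_distC.
(* Product of [eq1] with the normal: [w] is orthogonal to it and [dn] is so up to second order,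
   which bounds the change of parameter. *)
have tsB : `|ts - t| <= enorm ka + e * ((L * m) ^+ 2 / 2).
  have : ts - t = - dot ka (rsubmx z) - (e - ts) * (enorm dn ^+ 2 / 2).
    have := congr1 (fun v => dot v (rsubmx z)) eq1.
    by rewrite !dotDl !dotZl wz dnn -[dot (rsubmx z) _]enorm_sqr n1 expr1n; clear=> *; lra.
  move=> ->; apply: le_trans (ler_normB _ _) _; rewrite normrN; apply: lerD.
    rewrite ler_norml; have := cauchy_schwarz ka (rsubmx z).
    have := cauchy_schwarz (- ka) (rsubmx z); rewrite enormN dotNl n1 mulr1.
    by clear=> *; apply/andP; split; lra.
  rewrite ger0_norm; last by rewrite mulr_ge0 ?divr_ge0 ?sqr_ge0//; clear -ts8 e0; lra.
  apply: ler_pM; rewrite ?divr_ge0 ?sqr_ge0//; [clear -ts8 e0; lra|clear -ts0; lra|].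
  by rewrite ler_pM2r ?invr_gt0// lerXn2r ?nnegrE ?enorm_ge0 ?mulr_ge0 ?(ltW L0) ?(ltW m0).
have ets : e / 2 <= e - ts by clear -ts8 e0; lra.
have ets0 : 0 < e - ts by clear -ts8 e0; lra.
pose la := s / (e - ts); have la0 : 0 < la by rewrite divr_gt0.
pose rn := dn - la *: w.
have rn1 : enorm rn <= 4 / e * enorm ka + (L * m) ^+ 2.
  have e2 : enorm ((e - ts) *: rn) <= 2 * enorm ka + e * ((L * m) ^+ 2 / 2).
    rewrite /rn scalerBr eq1 scalerA /la mulrCA mulfV ?gt_eqF// mulr1.
    rewrite (_ : _ - _ = ka + (ts - t) *: rsubmx z); last by apply/rowP => i; rewrite !mxE; ring.
    apply: le_trans (ler_enormD _ _) _; rewrite enormZ n1 mulr1; clear -tsB; lra.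
  rewrite enormZ gtr0_norm// in e2.
  have e3 : e / 2 * enorm rn <= 2 * enorm ka + e * ((L * m) ^+ 2 / 2).
    by apply: le_trans e2; rewrite ler_wpM2r ?enorm_ge0.
  rewrite -(ler_pM2l (_ : 0 < e / 2)); last by rewrite divr_gt0.
  apply: le_trans e3 _.
  have -> : e / 2 * (4 / e * enorm ka + (L * m) ^+ 2) = 2 * enorm ka + e / 2 * (L * m) ^+ 2.
    by field; rewrite gt_eqF.
  by rewrite lerD2l mulrA [X in _ <= X]mulrAC.
pose U := row_mx (- e *: w) w.
have DU : D - la *: U = row_mx (ka - e *: rn) rn.
  rewrite -[LHS]hsubmxK lsubmxB rsubmxB /U scale_row_mx row_mxKl row_mxKr.
  rewrite /rn /ka /dn /ray_point /D lsubmxB rsubmxB.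
  move: (lsubmx zs) (rsubmx zs) (lsubmx z) (rsubmx z) => a b a' b'.
  by congr row_mx; apply/rowP => i; rewrite !mxE; ring.
have DU1 : enorm (D - la *: U) <= Q * enorm ka + (1 + e) * (L * m) ^+ 2.
  rewrite DU; apply: le_trans (enorm_row_le _) _; rewrite row_mxKl row_mxKr.
  have := ler_enormD ka (- (e *: rn)); rewrite enormN enormZ gtr0_norm// => h.
  have h2 : (1 + e) * enorm rn <= (1 + e) * (4 / e * enorm ka + (L * m) ^+ 2).
    by rewrite ler_pM2l// addr_gt0.
  rewrite /Q; have -> : (1 + 4 * (1 + e) / e) * enorm ka = enorm ka + (1 + e) * (4 / e * enorm ka).
    by field; rewrite gt_eqF.
  move: h h2; rewrite mulrDr; clear=> *; lra.
have laU : m / e <= enorm (la *: U).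
  rewrite enormZ gtr0_norm//.
  apply: (@le_trans _ _ (la * om)); last first.
    by rewrite ler_pM2l//; apply: le_trans (enorm_rsubmx U); rewrite row_mxKr.
  by rewrite /la mulrAC so (ler_pM2l m0) lef_pV2 ?posrE// gerBl ltW.
have DU2 : enorm (D - la *: U) <= r1 / 4 * (m / e).
  apply: le_trans DU1 _.
  have h1 : Q * enorm ka <= r1 / (8 * e) * m.
    apply: (@le_trans _ _ (Q * (eps * (L * m)))); first by rewrite ler_pM2l.
    rewrite /eps le_eqVlt; apply/orP; left; apply/eqP; field.
    by rewrite !gt_eqF.
  have h2 : (1 + e) * (L * m) ^+ 2 <= r1 / (8 * e) * m.
    rewrite exprMn mulrA [m ^+ 2]expr2 mulrA ler_pM2r//.
  have -> : r1 / 4 * (m / e) = r1 / (8 * e) * m + r1 / (8 * e) * m by field; rewrite gt_eqF.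
  exact: lerD.
have laU0 : 0 < enorm (la *: U) by apply: lt_le_trans laU; rewrite divr_gt0.
have D0 : D != 0.
  apply/eqP => DD; move: DU2; rewrite DD sub0r enormN => h.
  have : m / e <= r1 / 4 * (m / e) by exact: le_trans laU h.
  have : 0 < m / e by rewrite divr_gt0.
  move: (m / e) => q *; nra.
exists zs; split => //.
  rewrite /eucl_dist -/D enorm_gt0 D0/=; apply: le_lt_trans D1 _.
  exact: lt_le_trans m3 r1r.
rewrite -/D -/U.
have -> : (enorm U)^-1 *: U = (enorm (la *: U))^-1 *: (la *: U).
  by rewrite enormZ gtr0_norm// scalerA invfM mulrAC mulVf ?gt_eqF// mul1r.
have laUn : la *: U != 0 by rewrite -enorm_gt0.
apply: le_lt_trans (dist_normalized D0 laUn) _.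
rewrite ltr_pdivrMr//; apply: (@le_lt_trans _ _ (2 * (r1 / 4 * (m / e)))).
  by rewrite ler_pM2l.
apply: (@lt_le_trans _ _ (r1 * (m / e))).
  have : 0 < r1 * (m / e) by rewrite mulr_gt0// divr_gt0.
  lra.
by apply: ler_pM; rewrite ?(ltW r10)// divr_ge0 ?(ltW m0) ?(ltW e0).
Qed.

Lemma regular_tangent_cone z : P z -> ~ irregular_center K e z ->
  tangent_cone (normal_bundle X) z =
  [set U | exists2 w, dot w (rsubmx z) = 0 & U = row_mx (- e *: w) w].
Proof.
move=> Pz reg; apply/seteqP; split => U; first exact: regular_tangent_cone_sub.
by move=> [w wz ->]; exact: regular_tangent_cone_sup.
Qed.

(** The tangent cone forces each curvature of every frame to be [- e^-1], so the chosen product is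
    determined. A frame has to be exhibited as well, for otherwise [xget] would return its default
    0. *)
Lemma regular_curvature_product z : P z -> ~ irregular_center K e z ->
  curvature_product X z = curv_sin (- e^-1)%:E ^+ p.
Proof.
move=> Pz reg; have e0 := e_gt0.
have TE := regular_tangent_cone Pz reg.
have n1 := support_bundle_unit Pz.
set k0 : R := - e^-1.
pose sn := curv_sin k0%:E.
have q0 : 0 < Num.sqrt (1 + k0 ^+ 2) by rewrite sqrtr_gt0 ltr_wpDr// sqr_ge0.
have csn : curv_cos k0%:E = - e * sn.
  by rewrite /sn /= /k0 mulrA mulrNN mulfV ?gt_eqF// mul1r.
have sn0 : sn != 0.
  have k00 : k0 != 0 by rewrite /k0 oppr_eq0 invr_eq0 gt_eqF.
  by rewrite /sn/= mulf_neq0// invr_neq0// gt_eqF.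
have csq : curv_cos k0%:E ^+ 2 + sn ^+ 2 = 1.
  rewrite /sn /= expr_div_n exprVn sqr_sqrtr; last by rewrite addr_ge0 ?sqr_ge0.
  by field; rewrite gt_eqF// ltr_wpDr ?sqr_ge0.
have frameE a : frame_vector k0%:E a = row_mx (- e *: (sn *: a)) (sn *: a).
  by rewrite /frame_vector csn scalerA.
have uniq kappa b : principal_frame X z kappa b -> forall i, kappa i = k0%:E.
  move=> [kn orth _ span] i.
  have : tangent_cone (normal_bundle X) z (frame_vector (kappa i) (b i)).
    rewrite span; exists (fun j => (j == i)%:R) => //.
    rewrite (bigD1 i)//= eqxx scale1r big1 ?addr0// => j /negbTE ->.
    by rewrite scale0r.
  rewrite TE => -[w _ /eq_row_mx[h1 h2]].
  have aa : dot (b i) (b i) = 1 by rewrite orth eqxx.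
  have h : curv_cos (kappa i) = - e * curv_sin (kappa i).
    have := congr1 (fun v => dot v (b i)) h1.
    by rewrite -h2 !dotZl aa !mulr1.
  move: h (kn i); case: (kappa i) => [r h _|h _|_ /eqP//].
    have r0 : 0 < Num.sqrt (1 + r ^+ 2) by rewrite sqrtr_gt0 ltr_wpDr// sqr_ge0.
    move: h; rewrite /= mulrA => /(congr1 (fun x : R => x * Num.sqrt (1 + r ^+ 2))).
    rewrite mulVf ?gt_eqF// mulfVK ?gt_eqF// => er; congr EFin.
    apply: (mulfI (_ : - e != 0)); first by rewrite oppr_eq0 gt_eqF.
    by rewrite -er /k0 mulrNN mulfV// gt_eqF.
  have h0 : 0 = - e * 1 :> R := h.
  by exfalso; move: h0; rewrite mulr1 => /eqP; rewrite eq_sym oppr_eq0 gt_eqF.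
have [a [orth an span]] := orthonormal_complement n1.
have frame : principal_frame X z (fun=> k0%:E) (a : 'I_d.-1 -> 'rV[R]_d).
  split => //.
  - by move=> i j; rewrite /frame_vector dot_row_mx !dotZl !dotZr orth -[RHS]mul1r -csq -/sn; ring.
  - rewrite TE; apply/seteqP; split => U.
      move=> [w /span wE ->]; exists (fun i => dot w (a i) / sn) => //.
      under eq_bigr do rewrite frameE; rewrite sum_row_mx; congr row_mx.
        rewrite {2}wE scaler_sumr; apply: eq_bigr => i _.
        by rewrite !scalerA; congr (_ *: _); field.
      rewrite {2}wE; apply: eq_bigr => i _.
      by rewrite !scalerA divfK.
    move=> [c _ <-]; exists (\sum_i c i *: (sn *: a i)).
      by rewrite dot_suml big1// => i _; rewrite dotZl an !mulr0.
    under eq_bigr do rewrite frameE; rewrite sum_row_mx; congr row_mx.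
    by rewrite scaler_sumr; apply: eq_bigr => i _; rewrite !scalerA; congr (_ *: _); ring.
rewrite /curvature_product; case: xgetP => [p' _ [kappa [a' [fr ->]]]|no].
  rewrite (eq_bigr (fun=> sn)); last by move=> i _; rewrite (uniq _ _ fr).
  by rewrite prodr_const card_ord.
exfalso; apply: (no (\prod_(i < d.-1) sn)); exists (fun=> k0%:E), a; split => //.
Qed.

End RegularCenters.

(** * Integrals of functions constant almost everywhere *)

Section NullSets.
Context {R : realType} {n : nat}.
Local Open Scope ereal_scope.

Lemma hausdorff_null_measurable m (N : set 'rV[R]_n) : hausdorff m N = 0 ->
  (@hausdorff R n m).-caratheodory N.
Proof.
move=> N0; apply: le_caratheodory_measurable => Y /=.
rewrite [X in X + _](_ : _ = 0) ?add0e; first by apply: le_hausdorff => x [].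
by apply/eqP; rewrite eq_le hausdorff_ge0 andbT -N0; apply: le_hausdorff => x [].
Qed.

(** All null sets are Caratheodory measurable, so the preimages under [f] differ from [P] or from
    the empty set by measurable sets. Measurability of [f] on [P] is thus a consequence of its being
    constant off [N]. *)
Lemma integral_ae_cst m (P N : set 'rV[R]_n) (f : 'rV[R]_n -> R) (c : R) :
  closed P -> hausdorff m (P `&` N) = 0 -> (forall z, P z -> ~ N z -> f z = c) ->
  \int[caratheodory_measure (@hausdorff R n m)]_(z in P) (f z)%:E = c%:E * hausdorff m P.
Proof.
move=> cP PN0 fc.
set mu := caratheodory_measure _.
have mP : measurable (P : set (caratheodory_type (@hausdorff R n m))).
  exact: hausdorff_closed_measurable.
have null V : V `<=` P `&` N -> measurable (V : set (caratheodory_type (@hausdorff R n m))).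
  move=> VN; apply: hausdorff_null_measurable.
  by apply/eqP; rewrite eq_le hausdorff_ge0 andbT -PN0 le_hausdorff.
transitivity (\int[mu]_(z in P) (cst c%:E z)); last first.
  exact: (integral_cst mu mP).
apply: (@ae_eq_integral _ _ R mu P _ _ mP).
- move=> _ Y mY; have [cY|cY] := pselect (Y c%:E).
    have -> : P `&` (fun z => (f z)%:E) @^-1` Y = P `\` (P `&` [set z | ~ Y (f z)%:E]).
      apply/seteqP; split => z /=; first by move=> [Pz Yz]; split => // -[].
      by move=> [Pz nn]; split => //; apply: contrapT => nY; exact: nn.
    apply: measurableD => //; apply: null => z [Pz nY]; split => //.
    by apply: contrapT => Nz; apply: nY; rewrite fc.
  by apply: null => z [Pz Yz]; split => //; apply: contrapT => Nz; apply: cY; rewrite -(fc z).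
- exact: measurable_cst.
- exists (P `&` N); split; first exact: null.
    exact: PN0.
  move=> z /= /not_implyP[Pz fz]; split => //; apply: contrapT => Nz.
  by apply: fz; rewrite fc.
Qed.

End NullSets.

(** * Contribution of one cluster and total variation *)

Section CurvatureLowerBound.
Context {R : realType} {p : nat}.
Let d := p.+1.
Variables (K A : set 'rV[R]_d) (e C : R).
Hypotheses (e_gt0 : 0 < e) (cK : compact K) (cA : compact A) (A_nonempty : A !=set0)
  (AK : A `<=` K) (gap : forall a k, A a -> K k -> ~ A k -> 3 * e <= eucl_dist a k)
  (C_gt0 : 0 < C)
  (K_linked : forall tau x y, 0 < tau -> linked K tau x y -> eucl_dist x y <= C * tau).

Local Notation X := (closed_complement K e).
Local Notation P := (support_bundle A e).

(** The center and the normal can be read off from the pair, which rewrites membership in [P] as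
    three closed conditions, [PE]. Closedness makes [P] measurable for the Hausdorff measure and its
    flipped image Borel. *)
Lemma support_bundle_closed : closed P.
Proof.
have [closedA [M AM]] := (compact_closed_bounded A).1 cA.
have e0 := e_gt0.
have PE z : P z <-> [/\ A (ray_point e z), enorm (rsubmx z) = 1 &
    forall b, A b -> dot (- rsubmx z) b <= dot (- rsubmx z) (ray_point e z)].
  split.
    move=> Pz; split; [exact: support_bundle_center Pz|exact: support_bundle_unit Pz|].
    move: Pz => [a [n [Aa n1 nA ->]]] b Ab.
    by rewrite /ray_point row_mxKl row_mxKr scalerN addrK opprK; exact: nA.
  move=> [Az n1 nA]; exists (ray_point e z), (- rsubmx z); split => //.
    by rewrite enormN.
  by rewrite opprK scalerN /ray_point addrK hsubmxK.
apply/closed_euclP => z zP; apply/PE; split.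
- move/closed_euclP : closedA; apply => r r0.
  have e1 : 0 < 1 + e by lra.
  have [z' /PE[Az' _ _] zz'] := zP (r / (1 + e)) (divr_gt0 r0 e1).
  exists (ray_point e z') => //; apply: le_lt_trans (dist_ray_point z z' (ltW e0)) _.
  by rewrite mulrC -ltr_pdivlMr.
- apply/eqP; rewrite -subr_eq0 -normr_eq0 eq_le normr_ge0 andbT leNgt; apply/negP => h.
  have [z' /PE[_ n1' _] zz'] := zP _ h.
  have := ler_dist_enorm (rsubmx z) (rsubmx z'); have := dist_rsubmx z z'.
  by rewrite n1' /eucl_dist in zz' *; lra.
- move=> b Ab; rewrite leNgt; apply/negP => h.
  pose D := 2 * M + (enorm (rsubmx z) + 1) * (1 + e) + 1.
  have M0 : 0 <= M by case: A_nonempty => a /AM; apply: le_trans; exact: enorm_ge0.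
  have nz := enorm_ge0 (rsubmx z).
  have D0 : 0 < D by rewrite /D; nra.
  pose g := dot (- rsubmx z) b - dot (- rsubmx z) (ray_point e z).
  have g0 : 0 < g by rewrite subr_gt0.
  have [z' /PE[Az' n1' nA'] zz'] := zP (g / D) (divr_gt0 g0 D0).
  have gE : g = dot (- rsubmx z') (b - ray_point e z') +
      (dot (rsubmx z' - rsubmx z) (b - ray_point e z') + dot (rsubmx z) (ray_point e z - ray_point e z')).
    by rewrite /g; move: (ray_point e z) (ray_point e z') => a a'; rewrite !dotE; ring.
  have t1 : dot (- rsubmx z') (b - ray_point e z') <= 0.
    by rewrite dotBr subr_le0; exact: nA'.
  have t2 : dot (rsubmx z' - rsubmx z) (b - ray_point e z') <= eucl_dist z z' * (2 * M).
    apply: le_trans (cauchy_schwarz _ _) _; apply: ler_pM; rewrite ?enorm_ge0//.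
      by rewrite -/(eucl_dist _ _) eucl_distC dist_rsubmx.
    apply: le_trans (ler_enormD _ _) _; rewrite enormN.
    by have := AM _ Ab; have := AM _ Az'; lra.
  have t3 : dot (rsubmx z) (ray_point e z - ray_point e z') <= enorm (rsubmx z) * ((1 + e) * eucl_dist z z').
    apply: le_trans (cauchy_schwarz _ _) _; rewrite ler_wpM2l//.
    exact: dist_ray_point (ltW e0).
  have zz0 := eucl_dist_ge0 z z'.
  have : g <= eucl_dist z z' * D.
    rewrite gE /D; have : 0 <= eucl_dist z z' * (1 + e) by rewrite mulr_ge0//; lra.
    move: t1 t2 t3 zz0; move: (eucl_dist z z') (enorm _) => u v; lra.
  by rewrite leNgt -ltr_pdivlMr// zz'.
Qed.

Lemma support_bundle_hausdorff : (hausdorff p (@unit_sphere R d) <= hausdorff p P)%E.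
Proof.
have SP : @unit_sphere R d `<=` rsubmx @` P.
  move=> u u1; have [a Aa au] := compact_argmax_dot (- u) cA A_nonempty.
  exists (row_mx (a + e *: - u) u); last by rewrite row_mxKr.
  by exists a, (- u); split => //; rewrite ?enormN ?opprK.
apply: le_trans (le_hausdorff p SP) _.
have := @hausdorff_lipschitz R (d + d) d p rsubmx 1 P ltr01 _.
rewrite expr1n mul1e; apply => x y _ _; rewrite mul1r; exact: dist_rsubmx.
Qed.

Lemma flip_involutive : involutive (@flip R d).
Proof. by move=> z; rewrite /flip row_mxKl row_mxKr opprK hsubmxK. Qed.

Lemma flip_image (B : set 'rV[R]_(d + d)) : flip @` (flip @` B) = B.
Proof.
apply/seteqP; split => z; first by move=> [_ [y By <-] <-]; rewrite flip_involutive.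
by move=> Bz; exists (flip z); [exists z|exact: flip_involutive].
Qed.

Lemma curv_sin_ge : e <= 1 -> 2^-1 <= `|curv_sin (- e^-1)%:E|.
Proof.
move=> e1 /=; have e0 := e_gt0.
have ei : 1 <= e^-1 by rewrite invf_ge1.
rewrite sqrrN mulNr normrN; move: (e^-1) ei => x x1.
have x0 : 0 <= x by exact: le_trans x1.
have s0 : 0 < Num.sqrt (1 + x ^+ 2) by rewrite sqrtr_gt0 ltr_wpDr// sqr_ge0.
rewrite ger0_norm ?divr_ge0 ?sqrtr_ge0// ler_pdivlMr// mulrC ler_pdivrMr//.
rewrite -[x * 2]ger0_norm ?mulr_ge0// -sqrtr_sqr ler_sqrt ?sqr_ge0//.
nra.
Qed.

(** The indicator restricts the integral to [P], where it equals a constant times the measure of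
    [P]. That measure is at least the measure of the sphere, by which [C0] is divided; [curv_sin_ge]
    bounds the constant. *)
Lemma C0_parallel_support : e <= 1 ->
  ((2^-1 ^+ p)%:E <= `|C0_parallel K e (flip @` P)|)%E.
Proof.
move=> e1; rewrite /C0_parallel /C0 flip_image.
set s := curv_sin (- e^-1)%:E.
have int_eq : (\int[caratheodory_measure (@hausdorff R (d + d) p)]_(z in normal_bundle X)
    (\1_P z * curvature_product X z)%:E = (s ^+ p)%:E * hausdorff p P)%E.
  transitivity (\int[caratheodory_measure (@hausdorff R (d + d) p)]_(z in P)
     (curvature_product X z)%:E)%E.
    rewrite integral_mkcond [RHS]integral_mkcond; congr (integral _ _ _).
    apply/funext => z; rewrite !patchE indicE.
    have [Pz|Pz] := boolP (z \in P); last by rewrite mul0r if_same.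
    rewrite mul1r ifT// inE; apply: (support_bundle_normal e_gt0 A_nonempty AK gap).
    by move: Pz; rewrite inE.
  apply: (@integral_ae_cst _ _ p P (irregular_center K e)).
  - exact: support_bundle_closed.
  - exact: (irregular_center_null e_gt0 cK cA A_nonempty AK gap C_gt0 K_linked).
  - move=> z Pz reg; exact: (regular_curvature_product e_gt0 cK A_nonempty AK gap).
rewrite [X in (_ * (_ * X))%E]int_eq.
have S0 := @hausdorff_sphere_gt0 R p; have Soo := @hausdorff_sphere_fin R p.
have Sfin : hausdorff p (@unit_sphere R d) \is a fin_num by rewrite ge0_fin_numE ?hausdorff_ge0.
set h := fine _; have h0 : 0 < h by rewrite fine_gt0// S0 Soo.
rewrite !abseM !abse_EFin normrX normrN1 expr1n mul1e gtr0_norm ?invr_gt0//.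
rewrite muleA -EFinM (gee0_abs (hausdorff_ge0 p P)).
apply: (@le_trans _ _ ((h^-1 * `|s ^+ p|)%:E * h%:E)%E).
  rewrite -EFinM lee_fin mulrAC mulVf ?gt_eqF// mul1r normrX.
  by apply: lerXn2r; rewrite ?nnegrE ?invr_ge0// curv_sin_ge.
apply: lee_wpmul2l; first by rewrite lee_fin mulr_ge0// invr_ge0 ltW.
rewrite /h fineK//; exact: support_bundle_hausdorff.
Qed.

End CurvatureLowerBound.

(** The flipped support bundles are disjoint because a pair determines its center, which lies in its
    own cluster. *)
Lemma C0_var_ge (R : realType) (p m : nat) (K : set 'rV[R]_p.+1)
    (A : 'I_m -> set 'rV[R]_p.+1) (e C : R) :
  0 < e <= 1 -> compact K -> (forall i, compact (A i)) -> (forall i, A i !=set0) ->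
  (forall i, A i `<=` K) ->
  (forall i a k, A i a -> K k -> ~ A i k -> 3 * e <= eucl_dist a k) ->
  (forall i j, i != j -> A i `&` A j = set0) ->
  0 < C -> (forall tau x y, 0 < tau -> linked K tau x y -> eucl_dist x y <= C * tau) ->
  ((m%:R * 2^-1 ^+ p)%:E <= C0_var K e)%E.
Proof.
move=> /andP[e0 e1] cK cA A0 AK gap Adisj C0 lk.
pose Q i := flip @` support_bundle (A i) e.
have QE i : Q i = flip @^-1` support_bundle (A i) e.
  apply/seteqP; split => z; first by move=> [y Py <-]; rewrite /= flip_involutive.
  by move=> Pz; exists (flip z) => //; rewrite flip_involutive.
have cQ i : closed (Q i).
  rewrite QE; apply/closed_euclP => z zQ /=.
  have /closed_euclP := support_bundle_closed e0 (cA i) (A0 i); apply => r r0.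
  have [y Qy zy] := zQ r r0; exists (flip y) => //.
  rewrite /eucl_dist; have -> : enorm (flip z - flip y) = enorm (z - y); last exact: zy.
  apply/eqP; rewrite -(eqrXn2 (_ : 0 < 2)%N) ?enorm_ge0//; apply/eqP.
  rewrite !enorm_row_sqr !lsubmxB !rsubmxB /flip !row_mxKl !row_mxKr.
  by rewrite -opprD enormN.
have Qunit i z : Q i z -> unit_sphere (rsubmx z).
  by move=> [y Py <-]; rewrite /unit_sphere/= /flip row_mxKr enormN; exact: support_bundle_unit Py.
have Qdisj i j : i != j -> Q i `&` Q j = set0.
  move=> ij; apply/seteqP; split => // z; rewrite !QE => -[/= Pi Pj].
  have : (A i `&` A j) (ray_point e (flip z)).
    by split; [exact: support_bundle_center Pi|exact: support_bundle_center Pj].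
  by rewrite Adisj.
pose U := [set z : 'rV[R]_(p.+1 + p.+1) | unit_sphere (rsubmx z)].
pose F (k : nat) := if insub k is Some i then Q (i : 'I_m) else set0.
(* The index [m] receives the rest of the unit bundle, which completes the pieces to a partition. *)
pose B (k : nat) := if (k < m)%N then F k else if k == m then U `\` \bigcup_j F j else set0.
have borel_closed V : closed V -> @borel_sets R (p.+1 + p.+1) V.
  move=> cV; rewrite -[V]setCK; apply: sigma_algebraC; apply: sub_sigma_algebra.
  exact: closed_openC.
have borelF k : borel_sets (F k).
  by rewrite /F; case: insub => [i|]; [exact: borel_closed|exact: sigma_algebra0].
have cU : closed U.
  apply/closed_euclP => z zU; rewrite /U/= /unit_sphere/=.
  apply/eqP; rewrite -subr_eq0 -normr_eq0 eq_le normr_ge0 andbT leNgt; apply/negP => h.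
  have [z' z'1 zz'] := zU _ h.
  have := ler_dist_enorm (rsubmx z) (rsubmx z'); have := dist_rsubmx z z'.
  by rewrite z'1 /eucl_dist in zz' *; lra.
have part : borel_partition B.
  split.
  - move=> k; rewrite /B; case: ifP => // _; case: ifP => _; last exact: sigma_algebra0.
    rewrite setDE -[_ `&` _]setCK setCI setCK; apply: sigma_algebraC.
    rewrite -bigcup2E; apply: sigma_algebra_bigcup => -[|[|k']] /=.
    + by apply: sigma_algebraC; exact: borel_closed.
    + exact: sigma_algebra_bigcup.
    + exact: sigma_algebra0.
  - apply/trivIsetP => i j _ _ ij; apply/seteqP; split => // z; rewrite /B.
    have FF k l : k != l -> F k z -> F l z -> False.
      rewrite /F; case: insubP => // k' _ k'k; case: insubP => // l' _ l'l kl Fk Fl.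
      have : (Q k' `&` Q l') z by [].
      by rewrite Qdisj//; apply: contra_neq kl => kl'; rewrite -k'k -l'l kl'.
    case: (ltnP i m) => im; case: (ltnP j m) => jm /=.
    + by move=> [Fi Fj]; exact: (FF i j).
    + by move=> [Fi]; case: ifP => _ // [_]; apply; exists i.
    + by move=> [+ Fj]; case: ifP => _ // [_]; apply; exists j.
    + case: ifP => [/eqP im'|_ []//]; case: ifP => [/eqP jm' _|_ []//].
      by rewrite im' jm' eqxx in ij.
  - apply/seteqP; split => z.
      move=> [k _]; rewrite /B; case: ifP => _.
        by rewrite /F; case: insub => // i /Qunit.
      by case: ifP => // _ [].
    move=> Uz; have [[k _ Fk]|nF] := pselect ((\bigcup_j F j) z); last first.
      by exists m => //; rewrite /B ltnn eqxx.
    exists k => //; rewrite /B; case: ifP => // /negbT km.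
    by move: Fk; rewrite /F insubN.
apply: le_trans (ereal_sup_ubound _); last by exists B.
apply: le_trans (nneseries_lim_ge m _); last by move=> k _ _; exact: abse_ge0.
rewrite big_mkord.
apply: (@le_trans _ _ (\sum_(i < m) (2^-1 ^+ p)%:E)%E).
  by rewrite sumEFin lee_fin sumr_const card_ord -[X in _ <= X]mulr_natl.
apply: lee_sum => i _; rewrite /B ltn_ord /F valK.
exact: (C0_parallel_support e0 cK (cA i) (A0 i) (AK i) (gap i) C0 lk).
Qed.

(** * Number of clusters and box dimension *)

Section Clusters.
Context {R : realType} {n : nat}.
Implicit Types (K : set 'rV[R]_n) (p q : 'rV[R]_n).

Definition cluster K tau p := [set q | linked K tau p q].

(** A limit point of a cluster is within one more step of it, so clusters are closed in [K]. *)
Lemma compact_cluster_linked K tau p : 0 < tau -> compact K -> compact (cluster K tau p).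
Proof.
move=> tau0 cK; have [clK _] := (compact_closed_bounded K).1 cK.
apply: (subclosed_compact _ cK); last by move=> q; exact: linked_r.
apply/closed_euclP => q qcl; have [y py qy] := qcl _ tau0.
apply: (linked_step py); last by rewrite eucl_distC ltW.
apply: ((closed_euclP K).1 clK) => r r0.
by have [z /linked_r Kz qz] := qcl _ r0; exists z.
Qed.

(** By contradiction, which also settles finiteness: if no separated family were as large as the
    covering number, all of them would be bounded in size. The clusters of a maximal one then cover
    [K] by balls of radius [C], so the family was large enough. *)
Lemma many_clusters K (tau C : R) : 0 < tau ->
  (forall x y, linked K tau x y -> eucl_dist x y <= C) ->
  exists m (p : 'I_m -> 'rV[R]_n), [/\ forall i, K (p i),
    forall i j, i != j -> ~ linked K tau (p i) (p j) &
    covering_number K C <= m%:R].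
Proof.
move=> tau0 lkC; apply: contrapT => none.
have bnd m (p : 'I_m -> 'rV[R]_n) : (forall i, K (p i)) ->
    (forall i j, i != j -> ~ linked K tau (p i) (p j)) ->
    (m <= Num.Def.archi_bound (`|covering_number K C|))%N.
  move=> Kp sep; rewrite -(ler_nat R); apply: ltW.
  apply: le_lt_trans (archi_boundP (normr_ge0 _)).
  apply: le_trans (ler_norm _); rewrite leNgt; apply/negP => cm.
  by apply: none; exists m, p; split => //; rewrite ltW.
have sym x y : ~ linked K tau x y -> ~ linked K tau y x.
  by move=> nxy /linked_sym.
have [m [p [Kp sep cov]]] := maximal_family bnd sym.
apply: none; exists m, p; split => //.
apply: ge_inf; first by exists 0 => _ [k _ <-].
exists m => //; exists p => q Kq; have [i /contrapT piq] := cov q Kq.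
by exists i => //; exact: lkC.
Qed.

End Clusters.

(** Chains of step [3 * e] are used because a point of [K] at distance at most [3 * e] from a
    cluster then belongs to it, which is the required gap. *)
Lemma covering_number_C0_var (R : realType) (p : nat) (K : set 'rV[R]_p.+1) (C : R) :
  compact K -> 0 < C ->
  (forall tau x y, 0 < tau -> linked K tau x y -> eucl_dist x y <= C * tau) ->
  forall e, 0 < e <= 1 ->
  ((covering_number K (C * (3 * e)) * 2^-1 ^+ p)%:E <= C0_var K e)%E.
Proof.
move=> cK C0 lk e e01; have /andP[e0 _] := e01.
have tau0 : 0 < 3 * e by rewrite mulr_gt0.
have [m [q [Kq sep cov]]] := many_clusters tau0 (fun x y => lk (3 * e) x y tau0).
apply: (@le_trans _ _ (m%:R * 2^-1 ^+ p)%:E).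
  by rewrite lee_fin ler_wpM2r// exprn_ge0.
apply: (C0_var_ge (A := fun i => cluster K (3 * e) (q i)) e01 cK _ _ _ _ _ C0 lk).
- by move=> i; exact: compact_cluster_linked.
- by move=> i; exists (q i); exact: linked_refl.
- by move=> i x; exact: linked_r.
- move=> i a k qa Kk nk; rewrite leNgt; apply/negP => ak; apply: nk.
  by apply: (linked_step qa) => //; exact: ltW.
- move=> i j ij; apply/seteqP; split => // x [qx /linked_sym xq].
  exact: (sep i j ij (linked_trans qx xq)).
Qed.

(** * From the scaling exponent to the box dimension *)

Lemma ess_lim_right0_ex (R : realType) (f : R -> \bar R) (eta : R) :
  ess_lim_right0 f 0%E -> 0 < eta -> exists2 e, 0 < e < eta & (f e < 1)%E.
Proof.
move=> [Z Z0 fZ] eta0.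
have N1 : nbhs (0%E : \bar R) [set x | (x < 1)%E].
  by apply: open_nbhs_nbhs; split; [exact: open_ereal_lt_ereal|exact: lte01].
have : nbhs (0 : R) (fun e => 0 < e -> (~` Z) e -> (f e < 1)%E) by exact: fZ _ N1.
move=> /(@nbhs_ballP R R^o)[eta' /= eta'0 fe].
apply: contrapT => none.
pose b := Num.min eta eta'.
have b0 : 0 < b by rewrite lt_min eta0.
have : (@lebesgue_measure R).-negligible `]0, b[%classic.
  apply: negligibleS Z0 => x /=; rewrite in_itv/= lt_min => /and3P[x0 xe xe'].
  apply: contrapT => nZ; apply: none; exists x; first by rewrite x0.
  by apply: fe => //; rewrite /ball/= /ball_/= sub0r normrN gtr0_norm.
move=> neg; have : @lebesgue_measure R `]0, b[%classic = 0%E.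
  by apply: measure_negligible neg; exact: measurable_itv.
rewrite lebesgue_measure_itv/= lte_fin b0 sube0 => -[b00].
by rewrite b00 ltxx in b0.
Qed.

Lemma minkowski_dim_le (R : realType) (n : nat) (K : set 'rV[R]_n) (s : R) : 0 <= s ->
  (forall t, s < t -> forall eta, 0 < eta -> exists2 delta, 0 < delta < eta &
     ln (covering_number K delta) / - ln delta <= t) ->
  minkowski_dim K <= s.
Proof.
move=> s0 small; rewrite /minkowski_dim.
set f := fun delta => ln (covering_number K delta) / - ln delta.
(* Without convergence, [lim] is the default value 0, and [0 <= s] suffices. *)
have [cf|/dvgP ->] := pselect (cvg (f delta @[delta --> (0 : R)^'+])); last exact: s0.
set D := lim _; rewrite leNgt; apply/negP => sD.
have tD : (s + D) / 2 < D by rewrite midf_lt.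
have : nbhs (0 : R) (fun delta => 0 < delta -> (s + D) / 2 < f delta).
  exact: cvgr_gt D cf _ tD.
move=> /(@nbhs_ballP R R^o)[eta /= eta0 fe].
have [delta /andP[d0 de]] := small ((s + D) / 2) (midf_lt sD).1 eta eta0.
rewrite leNgt => /negP; apply; apply: fe => //.
by rewrite /ball/= /ball_/= sub0r normrN gtr0_norm.
Qed.

Lemma minkowski_dim_le_exponent (R : realType) (n : nat) (K : set 'rV[R]_n)
    (f : R -> \bar R) (a b s : R) :
  0 < a -> 0 < b -> 0 <= s ->
  (forall e, 0 < e <= 1 -> ((covering_number K (a * e) * b)%:E <= f e)%E) ->
  ess_lim_right0 (fun e => (e `^ s)%:E * f e)%E 0%E -> minkowski_dim K <= s.
Proof.
move=> a0 b0 s0 Nf fs; apply: minkowski_dim_le => // t st eta eta0.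
(* Once [- ln e] exceeds [M], the margin [t - s] in the exponent absorbs the constants [a] and
   [b]. *)
pose M := (- ln b + t * `|ln a|) / (t - s).
(* In order, the bounds give [e <= 1], [a * e < eta], [ln (a * e) < 0] and [- ln e > M]. *)
pose beta := Num.min (Num.min 1 (eta / a)) (Num.min a^-1 (expR (- M))).
have beta0 : 0 < beta by rewrite !lt_min ltr01 divr_gt0// invr_gt0 a0 expR_gt0.
have [e /andP[e0]] := ess_lim_right0_ex fs beta0.
rewrite !lt_min => /andP[/andP[e1 ea] /andP[ea' eM]] fe.
exists (a * e); first by rewrite mulr_gt0//= mulrC -ltr_pdivlMr.
have ae0 : 0 < a * e by rewrite mulr_gt0.
have ae1 : a * e < 1 by rewrite mulrC -ltr_pdivlMr// div1r.
have ln0' : 0 < - ln (a * e) by rewrite oppr_gt0 ln_lt0// ae0.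
rewrite ler_pdivrMr//.
have [N1|N1] := leP (covering_number K (a * e)) 1.
  by apply: (le_trans (ln_le0 N1)); rewrite mulr_ge0// ltW// (le_lt_trans s0).
have N0 : 0 < covering_number K (a * e) by apply: lt_trans N1.
have es0 : 0 < e `^ s by exact: powR_gt0.
have Nbe : covering_number K (a * e) * b * e `^ s < 1.
  rewrite -lte_fin; apply: le_lt_trans fe; rewrite mulrC EFinM.
  by apply: lee_wpmul2l; [rewrite lee_fin ltW|apply: Nf; rewrite e0 ltW].
have lnN : ln (covering_number K (a * e)) + ln b + s * ln e < 0.
  have : ln (covering_number K (a * e) * b * e `^ s) < 0.
    by rewrite ln_lt0// Nbe !mulr_gt0.
  by rewrite !lnM ?posrE ?mulr_gt0// ln_powR.
have lne : ln e < - M by rewrite -(expRK (- M)) ltr_ln// posrE ?expR_gt0.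
have : M * (t - s) <= - ln e * (t - s).
  by rewrite ler_wpM2r ?subr_ge0 ?(ltW st)// -lerN2 opprK ltW.
rewrite /M divfK ?gt_eqF ?subr_gt0// lnM ?posrE//.
have t0 : 0 < t by exact: le_lt_trans st.
have : t * ln a <= t * `|ln a| by rewrite ler_pM2l// ler_norm.
move: lnN; clear; nra.
Qed.

Theorem corollary5p5 (R : realType) (d N : nat)
  (S : 'I_N -> 'rV[R]_d -> 'rV[R]_d) (r : 'I_N -> R) (K : set 'rV[R]_d)
  (d_gt0 : (0 < d)%N) (N_ge2 : (2 <= N)%N)
  (r_bounds : forall i, 0 < r i < 1)
  (S_similarity : forall i, similarity (r i) (S i))
  (K_self_similar : self_similar_set S K)
  (S_osc : open_set_condition S)
  (K_regular : regular_set K)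
  (K_totally_disconnected : totally_disconnected K) :
  ((minkowski_dim K)%:E <= scaling_exponent K)%E.
Proof.
case: d d_gt0 => // p _ in S K S_similarity K_self_similar S_osc K_regular K_totally_disconnected *.
have [_ cK _] := K_self_similar.
have [C C0 lk] := linked_diameter r_bounds S_similarity K_self_similar
  K_totally_disconnected S_osc.
apply: le_ereal_inf_tmp => _ [s [s0 fs] <-]; rewrite lee_fin.
apply: (@minkowski_dim_le_exponent _ _ _ (C0_var K) (C * 3) (2^-1 ^+ p)) fs => //.
- by rewrite mulr_gt0.
- by move=> e e01; rewrite -mulrA; exact: covering_number_C0_var.
Qed.
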